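(* There exists a polynomial $p$ such that the following holds. Let $G$ be a plane graph with $n$ vertices. For every proper $5$-coloring $\alpha$ of $G$ (with colors in $\{1,\dots,5\}$) and every proper $4$-coloring $\beta$ of $G$ (with colors in $\{1,2,3,4\}$), there is a sequence of K-changes transforming $\alpha$ into $\beta$ in which each vertex has its color changed at most $p(n)$ times.
   Context: A proper coloring assigns colors to vertices so that adjacent vertices receive distinct colors. Given a proper coloring and two colors $a,b$, a Kempe chain in colors $\{a,b\}$ is a maximal connected subgraph of $G$ all of whose vertices have color $a$ or $b$; swapping $a$ and $b$ on all vertices of such a chain is called a K-change. A vertex's color is changed by a K-change when it belongs to the swapped chain. *)

(* Defs.v *)
From mathcomp Require Import all_boot all_order all_algebra perm.
From mathcomp Require Import all_classical all_reals all_analysis.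
Set Implicit Arguments.
Unset Strict Implicit.
Unset Printing Implicit Defensive.

Import Order.TTheory GRing.Theory Num.Theory.
Import numFieldNormedType.Exports.
Local Open Scope classical_set_scope.
Local Open Scope ring_scope.

(* A subset [A] of the plane that is a simple arc from [a] to [b]. As [`[0, 1]]
   is compact and the plane is Hausdorff, [f] is a homeomorphism onto [A]. *)
Definition simple_arc (R : realType) (A : set (R * R)) (a b : R * R) : Prop :=
  exists f : R -> R * R,
    [/\ {within `[0, 1], continuous f},
        {in `[0, 1] &, injective f},
        f 0 = a, f 1 = b & A = f @` `[0, 1]].

(* A finite simple graph drawn in the plane without crossings. The point set
   [curve x y] is meaningful only when [adj x y] holds. *)
Record plane_graph (R : realType) := PlaneGraph {
  vertex :> finType;
  adj : rel vertex;
  adj_sym : symmetric adj;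
  adj_irr : irreflexive adj;
  pos : vertex -> R * R;
  curve : vertex -> vertex -> set (R * R);
  pos_inj : injective pos;
  curve_sym : forall x y, adj x y -> curve x y = curve y x;
  curve_arc : forall x y, adj x y -> simple_arc (curve x y) (pos x) (pos y);
  curve_vertex : forall x y z,
    adj x y -> curve x y (pos z) -> z = x \/ z = y;
  (* no point of another edge lies in the interior of the edge [xy] *)
  curve_disjoint : forall x y u v,
    adj x y -> adj u v -> ~ (u = x /\ v = y) -> ~ (u = y /\ v = x) ->
    curve x y `&` curve u v `<=` [set pos x; pos y]
}.

Section Kempe.
Variables (T : finType) (e : rel T) (k : nat).
Implicit Types (c d : {ffun T -> 'I_k}) (a b : 'I_k) (K : {set T}).

Definition proper_coloring c : Prop := forall x y, e x y -> c x != c y.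

(* [K] is nonempty and induces a connected subgraph. *)
Definition connected_set K : bool :=
  (K != finset.set0) &&
  [forall x in K, forall y in K,
     connect [rel u v | [&& u \in K, v \in K & e u v]] x y].

(* A maximal connected subgraph with a prescribed set of allowed vertices is
   induced, so a Kempe chain is determined by its vertex set. *)
Definition kempe_chain c a b K : bool :=
  maxset (fun K' : {set T} =>
    connected_set K' && [forall x in K', (c x == a) || (c x == b)]) K.

Definition kempe_swap c a b K : {ffun T -> 'I_k} :=
  [ffun x => if x \in K then tperm a b (c x) else c x].

(* A K-change, given by its two colors and the swapped chain. *)
Definition kchange : Type := ('I_k * 'I_k * {set T})%type.

Fixpoint kempe_sequence c (s : seq kchange) d : Prop :=
  match s with
  | [::] => c = d
  | (a, b, K) :: s' =>
      [/\ a != b, kempe_chain c a b K & kempe_sequence (kempe_swap c a b K) s' d]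
  end.

(* A vertex of the swapped chain has color [a] or [b] with [a != b], so its
   color does change. *)
Definition color_changes (s : seq kchange) (x : T) : nat :=
  count (fun m : kchange => x \in m.2) s.

End Kempe.

(* A 4-coloring seen as a 5-coloring that does not use the last color. *)
Definition as_5coloring (T : finType) (c : {ffun T -> 'I_4}) : {ffun T -> 'I_5} :=
  [ffun x => widen_ord (leqnSn 4) (c x)].

(* Main.v *)
(* The 4-coloring is only used as a proper 5-coloring. Remove a set S of pairwise
   nonadjacent vertices of degree at most 6. A vertex of degree at
   most 4 is harmless; around one of degree 5 or 6 a few K-changes make some
   neighbors share a color, so that at most four classes remain once these
   neighbors are identified. A K-change of the smaller graph obtained then
   extends to the whole graph at the cost of a bounded number of changes per
   vertex. The two given colorings use disjoint sets S and S' for this; a third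
   coloring, constant on the classes of both, exists because identifying all of
   them leaves a planar graph, and by induction it is reached from both sides.
   As |S| = |S'| is at least a fixed fraction of n, the number f(n) of changes
   satisfies f(n) <= 24 f(n - |S|) + O(n), hence is polynomial.

   Planarity is only used through the parity of the number of crossings of two
   walks, which telescopes: it is preserved by minors, it excludes K_5 and hence
   bounds the number of edges, and it decides which Kempe chains at a vertex
   exclude each other. *)
Require Import Defs.
From mathcomp Require Import all_boot perm zify.
From Stdlib Require Import Btauto.
Set Implicit Arguments.
Unset Strict Implicit.
Unset Printing Implicit Defensive.

(** * Crossing parities *)

(** The merges that can be made depend on the coloring, so a single set [S] would receive two
    incompatible identifications. With disjoint sets both can be made at once, and a 5-coloring of
    the result, given by the five color theorem, is the meeting point. As it may use all five
    colors, the induction speaks about all pairs of proper 5-colorings.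

    The factor 24 is two sides times 12, and 12 is two changes for each of at most six neighbors.
    Such a factor is affordable only at logarithmic depth, hence the removal of a fixed fraction of
    the vertices. This forces degree six into the argument, since large planar graphs may have only
    twelve vertices of degree at most five. A vertex of degree six has to lose two classes, possibly
    through two pairs merged across the same vertex; planarity survives only if these pairs do not
    interleave, and this is what the Kempe games must achieve.

    A graph too small for two disjoint sets loses one vertex. The pairs found for the two colorings
    may then clash, and a K_5 minor shows that they cannot always do so. *)

Lemma xorbE (a b : bool) : a (+) b = xorb a b.
Proof. by case: a; case: b. Qed.

Ltac xor_tauto := rewrite ?xorbE; btauto.

Section Crossings.
Variables (T : Type) (l : T -> T -> bool) (lam : T -> T -> T -> bool).

(* The parity of the number of crossings of the segments [uv] and [wt], when
   [l] compares abscissae and [lam u v w] tells whether [w] is above [uv]. *)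
Definition cross4 (u v w t : T) : bool :=
  (l u w (+) l u t (+) l v w (+) l v t) (+)
  (lam u v w (+) lam u v t (+) lam w t u (+) lam w t v).

Fixpoint lamw (x : T) (p : seq T) (z : T) : bool :=
  if p is y :: p' then lam x y z (+) lamw y p' z else false.

Fixpoint crossw1 (u v w : T) (q : seq T) : bool :=
  if q is t :: q' then cross4 u v w t (+) crossw1 u v t q' else false.

Fixpoint crossw (x : T) (p : seq T) (z : T) (q : seq T) : bool :=
  if p is y :: p' then crossw1 x y z q (+) crossw y p' z q else false.

Lemma crossw1E u v z q :
  crossw1 u v z q =
  (l u z (+) l u (last z q) (+) l v z (+) l v (last z q)) (+)
  (lam u v z (+) lam u v (last z q) (+) lamw z q u (+) lamw z q v).
Proof.
elim: q z => [|t q IH] z /=; first by xor_tauto.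
rewrite IH /cross4; xor_tauto.
Qed.

(* The sum over all pairs of steps telescopes: it only sees the end points. *)
Lemma crosswE x p z q :
  crossw x p z q =
  (l x z (+) l x (last z q) (+) l (last x p) z (+) l (last x p) (last z q)) (+)
  (lamw x p z (+) lamw x p (last z q) (+) lamw z q x (+) lamw z q (last x p)).
Proof.
elim: p x => [|y p IH] x /=; first by xor_tauto.
rewrite IH crossw1E; xor_tauto.
Qed.

Lemma crossw_closed x p z q :
  last x p = x -> last z q = z -> crossw x p z q = false.
Proof. by move=> px qz; rewrite crosswE px qz; xor_tauto. Qed.

Lemma crossw1_cat u v z q1 q2 :
  crossw1 u v z (q1 ++ q2) = crossw1 u v z q1 (+) crossw1 u v (last z q1) q2.
Proof. by elim: q1 z => [|t q1 IH] z //=; rewrite IH addbA. Qed.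

Lemma crossw_cat x p1 p2 z q :
  crossw x (p1 ++ p2) z q = crossw x p1 z q (+) crossw (last x p1) p2 z q.
Proof. by elim: p1 x => [|y p1 IH] x //=; rewrite IH addbA. Qed.

Lemma crossw_catr x p z q1 q2 :
  crossw x p z (q1 ++ q2) = crossw x p z q1 (+) crossw x p (last z q1) q2.
Proof. by elim: p x => [|y p IH] x //=; rewrite IH crossw1_cat; xor_tauto. Qed.

End Crossings.

Lemma crossw1_eq0 (T : eqType) (l : rel T) lam (e : rel T) (A : pred T) u v :
  (forall w t, e w t -> A w -> A t -> cross4 l lam u v w t = false) ->
  forall z q, path e z q -> all A (z :: q) -> crossw1 l lam u v z q = false.
Proof.
move=> H z q; elim: q z => [|t q IH] z //= /andP[ezt pq] /and3P[Az At Aq].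
by rewrite H //= IH //= At.
Qed.

Lemma crossw_eq0 (T : eqType) (l : rel T) lam (e e' : rel T) (A B : pred T) :
  (forall u v w t, e u v -> e' w t -> A u -> A v -> B w -> B t ->
     cross4 l lam u v w t = false) ->
  forall x p z q, path e x p -> path e' z q -> all A (x :: p) -> all B (z :: q) ->
    crossw l lam x p z q = false.
Proof.
move=> H x p z q pp pq Ap Bq; elim: p x pp Ap => [|y p IH] x //=.
case/andP=> exy pp /and3P[Ax Ay Ap].
rewrite (@crossw1_eq0 _ _ _ e' B) ?IH //= ?Ay // => w t ewt Bw Bt.
exact: H.
Qed.

Section ParityDrawing.
Variable V : finType.
Implicit Types (e : rel V) (l : rel V) (lam : V -> V -> V -> bool).

(* What is used of a plane drawing: independent edges cross an even number of
   times. *)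
Record parity_drawing e l lam : Prop := ParityDrawing {
  pd_anti : forall u w, u != w -> l u w = ~~ l w u;
  pd_sym : forall u v w, lam u v w = lam v u w;
  pd_cross : forall u v w t, e u v -> e w t ->
    u != w -> u != t -> v != w -> v != t -> cross4 l lam u v w t = false
}.

Definition planar_like e := exists l lam, parity_drawing e l lam.

(* Orienting every edge makes the potential symmetric. *)
Lemma planar_likeI e l lam : symmetric e ->
  (forall u w, u != w -> l u w = ~~ l w u) ->
  (forall u v w t, e u v -> e w t ->
    u != w -> u != t -> v != w -> v != t -> cross4 l lam u v w t = false) ->
  planar_like e.
Proof.
move=> esym lanti H.
pose lam' u v w := if enum_rank u < enum_rank v then lam u v w else lam v u w.
exists l, lam'; split=> //.
  move=> u v w; rewrite /lam'; case: ltngtP => // /val_inj /enum_rank_inj -> //.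
move=> u v w t euv ewt uw ut vw vt; rewrite /cross4 /lam'.
have evu : e v u by rewrite esym.
have etw : e t w by rewrite esym.
case: ifP => _; case: ifP => _.
- exact: H.
- rewrite -(H _ _ _ _ euv etw ut uw vt vw) /cross4; xor_tauto.
- rewrite -(H _ _ _ _ evu ewt vw vt uw ut) /cross4; xor_tauto.
- rewrite -(H _ _ _ _ evu etw vt vw ut uw) /cross4; xor_tauto.
Qed.

Lemma planar_like_sub e e' : subrel e' e -> planar_like e -> planar_like e'.
Proof.
move=> sub [l [lam [H1 H2 H3]]]; exists l, lam; split=> // u v w t /sub euv /sub.
exact: H3.
Qed.

End ParityDrawing.

Section Rotation.
Variables (V : finType) (l : rel V) (lam : V -> V -> V -> bool).

(* A tournament on the neighbors of [v], recording their rotation about [v] only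
   up to reversing all the comparisons at a neighbor. *)
Definition rot (v x z : V) : bool := cross4 l lam v x v z.

(* Whether the pairs [xy] and [zw] interleave around [v]. *)
Definition chi (v x y z w : V) : bool :=
  (rot v x z (+) rot v x w) (+) (rot v y z (+) rot v y w).

End Rotation.

Section Jordan.
Variables (V : finType) (e l : rel V) (lam : V -> V -> V -> bool).
Hypothesis pd : parity_drawing e l lam.

Local Notation rot := (rot l lam).
Local Notation chi := (chi l lam).
Local Notation cross4 := (cross4 l lam).

Lemma cross4Cl u v w t : cross4 u v w t = cross4 v u w t.
Proof. rewrite /cross4 (pd_sym pd u v w) (pd_sym pd u v t); xor_tauto. Qed.

Lemma cross4Cr u v w t : cross4 u v w t = cross4 u v t w.
Proof. rewrite /cross4 (pd_sym pd w t u) (pd_sym pd w t v); xor_tauto. Qed.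

Lemma crossw1C u v z q : crossw1 l lam u v z q = crossw1 l lam v u z q.
Proof. by elim: q z => [|t q IH] z //=; rewrite cross4Cl IH. Qed.

Lemma rot_anti v x z : v != x -> v != z -> x != z -> rot v x z = ~~ rot v z x.
Proof.
move=> vx vz xz; rewrite /rot /cross4.
rewrite (pd_anti pd vx) (pd_anti pd vz) (pd_anti pd xz); xor_tauto.
Qed.

(** Of the three pairings of four points on a circle exactly one interleaves; for a tournament the
    parity of this number survives. In the sum every comparison occurs twice, in opposite directions
    for the three pairs among [y], [z], [w], and three reversals leave [true]. *)
Lemma chi_sum v x y z w : uniq [:: v; x; y; z; w] ->
  chi v x y z w (+) chi v x z y w (+) chi v x w y z = true.
Proof.
rewrite /= !inE !negb_or -!andbA.
case/and5P=> vx vy vz vw /and5P[xy xz xw yz /and3P[yw zw _]].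
rewrite /chi (rot_anti vy vz yz) (rot_anti vy vw yw) (rot_anti vz vw zw).
xor_tauto.
Qed.

Lemma chiC v x y z w : uniq [:: v; x; y; z; w] -> chi v z w x y = chi v x y z w.
Proof.
rewrite /= !inE !negb_or -!andbA.
case/and5P=> vx vy vz vw /and5P[xy xz xw yz /and3P[yw zw _]].
rewrite /chi (rot_anti vx vz xz) (rot_anti vx vw xw) (rot_anti vy vz yz).
rewrite (rot_anti vy vw yw); xor_tauto.
Qed.

Lemma chiCl v x y z w : chi v y x z w = chi v x y z w.
Proof. rewrite /chi; xor_tauto. Qed.

Lemma chiCr v x y z w : chi v x y w z = chi v x y z w.
Proof. rewrite /chi; xor_tauto. Qed.

Lemma chi_add v x y y' z w : chi v x y z w (+) chi v y y' z w = chi v x y' z w.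
Proof. rewrite /chi; xor_tauto. Qed.

Lemma chi_addr v x y z w w' : chi v x y z w (+) chi v x y w w' = chi v x y z w'.
Proof. rewrite /chi; xor_tauto. Qed.

(* The Jordan curve theorem, for two disjoint paths avoiding [v]. *)
Lemma chi_path v x y z w p q :
  e v x -> e v y -> e v z -> e v w ->
  path e x p -> last x p = y -> path e z q -> last z q = w ->
  v \notin x :: p -> v \notin z :: q -> ~~ has [in x :: p] (z :: q) ->
  chi v x y z w = false.
Proof.
move=> vx vy vz vw pp lp pq lq vp vq dis.
have dis1 a b : a \in x :: p -> b \in z :: q -> a != b.
  by move=> ap bq; apply: contra dis => /eqP ab; apply/hasP; exists b; rewrite // -ab.
have yp : y \in x :: p by rewrite -lp mem_last.
have wq : w \in z :: q by rewrite -lq mem_last.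
have vnp a : a \in x :: p -> v != a by move=> ap; apply: contraNneq vp => ->.
have vnq a : a \in z :: q -> v != a by move=> ap; apply: contraNneq vq => ->.
(* Both paths are closed through [v]. Among the crossings of the two closed walks, only those
   between the four edges at [v] are not already even, and their sum is [chi]. *)
have e0 : crossw l lam v (x :: p ++ [:: v]) v (z :: q ++ [:: v]) = false.
  by rewrite crossw_closed //= last_cat.
have e1 : crossw l lam x p z q = false.
  apply: (@crossw_eq0 _ _ _ e e (mem (x :: p)) (mem (z :: q))) => //;
    try by apply/allP.
  by move=> a b c d eab ecd ap bp cq dq; apply: (pd_cross pd) => //; apply: dis1.
have e2 a : a \in x :: p -> e v a -> crossw1 l lam v a z q = false.
  move=> ap va; apply: (@crossw1_eq0 _ _ _ e (mem (z :: q))) => //;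
    try by apply/allP.
  by move=> c d ecd cq dq; apply: (pd_cross pd) => //; (exact: vnq || exact: dis1).
have e3 p' x' b : path e x' p' -> {subset x' :: p' <= x :: p} ->
    e v b -> b \in z :: q -> crossw l lam x' p' v [:: b] = false.
  move=> + + vb bq; elim: p' x' => [|y' p' IH] x' //= /andP[exy pp'] sub.
  rewrite (pd_cross pd exy vb) ?IH //.
  - by move=> c cp; apply: sub; rewrite inE cp orbT.
  - by rewrite eq_sym vnp // sub // mem_head.
  - by rewrite dis1 // sub // mem_head.
  - by rewrite eq_sym vnp // sub // !inE eqxx orbT.
  - by rewrite dis1 // sub // !inE eqxx orbT.
have e4 p' x' b : path e x' p' -> {subset x' :: p' <= x :: p} ->
    e v b -> b \in z :: q -> crossw l lam x' p' b [:: v] = false.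
  move=> px' sub vb bq; rewrite -(e3 _ _ _ px' sub vb bq).
  by elim: (p') (x') => [|y' p1 IH] x1 //=; rewrite IH cross4Cr.
have e2' : crossw1 l lam v y z q = false by apply: e2; rewrite // -lp mem_last.
have px0 : {subset x :: p <= x :: p} by [].
move: e0; rewrite -!(cat1s _ (_ ++ _)) !crossw_cat /= lp.
rewrite !crossw1_cat -[z :: q ++ _]/([:: z] ++ q ++ _) !crossw_catr /= lq e1.
rewrite (e2 x) ?mem_head // (e3 p x z) ?mem_head // (e4 p x w) //.
rewrite [crossw1 _ _ y v z q]crossw1C // e2' /chi /rot.
rewrite !(cross4Cl y v) !(cross4Cr _ _ w v) => <-; xor_tauto.
Qed.

End Jordan.

(** * Minors and the complete graph on five vertices *)

(* A minor model: [f] names the branch sets, [r] their roots. *)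
Lemma planar_like_minor (V H : finType) (e : rel V) (eH : rel H)
    (f : V -> option H) (r : H -> V) :
  symmetric eH -> irreflexive eH -> planar_like e ->
  (forall h, f (r h) = Some h) ->
  (forall h k, eH h k -> exists p, [/\ path e (r h) p, last (r h) p = r k &
     all (fun x => (f x == Some h) || (f x == Some k)) (r h :: p)]) ->
  planar_like eH.
Proof.
move=> symH irrH [l [lam pd]] fr walk.
have [P HP] : exists P : H * H -> seq V, forall hk, eH hk.1 hk.2 ->
    [/\ path e (r hk.1) (P hk), last (r hk.1) (P hk) = r hk.2 &
     all (fun x => (f x == Some hk.1) || (f x == Some hk.2)) (r hk.1 :: P hk)].
  pose Q (hk : H * H) (p : seq V) := eH hk.1 hk.2 -> [/\ path e (r hk.1) p,
    last (r hk.1) p = r hk.2 &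
    all (fun x => (f x == Some hk.1) || (f x == Some hk.2)) (r hk.1 :: p)].
  apply: (@fin_all_exists _ (fun=> seq V) Q) => -[h k]; rewrite /Q /=.
  by case: (boolP (eH h k)) => [/walk[p Hp]|_]; [exists p | exists [::]].
have r_inj : injective r by move=> h k E; apply: Some_inj; rewrite -!fr E.
apply: (@planar_likeI _ eH (fun h k => l (r h) (r k))
         (fun h k j => lamw lam (r h) (P (h, k)) (r j))) => //.
  by move=> u w uw; apply: (pd_anti pd); apply: contraNneq uw => /r_inj ->.
move=> u v w t euv ewt uw ut vw vt.
have [/= p1 l1 a1] := HP (u, v) euv; have [/= p2 l2 a2] := HP (w, t) ewt.
(* The drawing of the minor keeps just the end-point data of [crosswE], so the parity for two of its
   edges is that of their walks, which visit disjoint branch sets. *)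
have := crosswE l lam (r u) (P (u, v)) (r w) (P (w, t)).
rewrite l1 l2 /cross4 => <-.
apply: crossw_eq0 p1 p2 a1 a2 => a b c d eab ecd fa fb fc fd.
have ne x y : (f x == Some u) || (f x == Some v) ->
    (f y == Some w) || (f y == Some t) -> x != y.
  move=> fx fy; apply: contraTneq fx => ->; rewrite negb_or.
  by case/orP: fy => /eqP ->; apply/andP; split; apply/eqP => -[]/eqP;
    rewrite eq_sym ?(negPf uw) ?(negPf ut) ?(negPf vw) ?(negPf vt).
by apply: (pd_cross pd) => //; apply: ne.
Qed.

(** Around a vertex of K_5 each pairing of the other four consists of two disjoint edges, so by
    [chi_path] none interleaves, against [chi_sum]. *)
Lemma K5_not_planar_like : ~ planar_like (fun i j : 'I_5 => i != j).
Proof.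
case=> l [lam pd].
have sym : symmetric (fun i j : 'I_5 => i != j) by move=> i j; rewrite eq_sym.
pose v : 'I_5 := ord_max; pose o i : 'I_5 := inord i.
have oE i j : i < 5 -> j < 5 -> (o i == o j) = (i == j).
  by move=> i5 j5; rewrite -val_eqE /= !inordK.
have vE : v = o 4 by apply: val_inj; rewrite /= inordK.
have c0 x y z w : uniq [:: v; x; y; z; w] -> chi l lam v x y z w = false.
  rewrite /= !inE !negb_or -!andbA.
  case/and5P=> vx vy vz vw /and5P[xy xz xw yz /and3P[yw zw _]].
  apply: (@chi_path _ _ _ _ pd v x y z w [:: y] [:: w]) => //=;
    rewrite ?xy ?zw ?inE ?negb_or ?vx ?vy ?vz ?vw //.
  by rewrite !(eq_sym z) !(eq_sym w) (negPf xz) (negPf yz) (negPf xw) (negPf yw).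
have U a b c d : uniq [:: 4; a; b; c; d] -> all (fun i => i < 5) [:: a; b; c; d] ->
    uniq [:: v; o a; o b; o c; o d].
  move=> + /= /and5P[a5 b5 c5 d5 _]; rewrite vE /= !inE !oE //.
have := chi_sum pd (U 0 1 2 3 isT isT).
by rewrite !c0 //; apply: U.
Qed.

Section K5Model.
Variables (V : finType) (e : rel V).
Hypotheses (esym : symmetric e).

Definition touching (a b : V * V) : bool :=
  [&& a.1 != b.1, a.1 != b.2, a.2 != b.1, a.2 != b.2 &
   [|| e a.1 b.1, e a.1 b.2, e a.2 b.1 | e a.2 b.2]].

Lemma touchingC : symmetric touching.
Proof.
move=> a b; rewrite /touching !(eq_sym b.1) !(eq_sym b.2) !(esym b.1) !(esym b.2).
by do 4!case: eqP => //= _; do 4!case: (e _ _).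
Qed.

(* A branch set [(a, b)] is an edge, or a vertex when [a = b]. *)
Lemma no_K5_model (bs : seq (V * V)) : planar_like e -> size bs = 5 ->
  all (fun a => (a.1 == a.2) || e a.1 a.2) bs -> pairwise touching bs -> False.
Proof.
move=> pl bs5 /allP edge pw.
case: bs bs5 edge pw => [//|b0 bs'] ; set bs := b0 :: bs' => bs5 edge pw.
pose b (i : 'I_5) := nth b0 bs i.
have bin (i : 'I_5) : b i \in bs by rewrite mem_nth ?bs5.
have tch i j : i != j -> touching (b i) (b j).
  move=> ij; wlog lij : i j ij / i < j.
    move=> W; have := ij; rewrite -val_eqE neq_ltn => /orP[]; first exact: W.
    by move=> ji; rewrite touchingC; apply: W; rewrite // eq_sym.
  by move/(pairwiseP b0): pw => -> //; rewrite inE bs5.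
pose f x := [pick i : 'I_5 | (x == (b i).1) || (x == (b i).2)].
have fE i x : (x == (b i).1) || (x == (b i).2) -> f x = Some i.
  move=> xi; rewrite /f; case: pickP => [j xj|/(_ i)]; last by rewrite xi.
  congr Some; apply/eqP; apply: contraTT isT => ji.
  case/and5P: (tch _ _ ji) => n1 n2 n3 n4 _.
  by case/orP: xi xj n1 n2 n3 n4 => /eqP-> /orP[]/eqP->; rewrite eqxx.
apply: K5_not_planar_like; apply: (@planar_like_minor V _ e _ f (fun i => (b i).1)) => //.
- by move=> i j; rewrite eq_sym.
- by move=> i; rewrite eqxx.
- by move=> i; apply: fE; rewrite eqxx.
move=> i j ij; case/and5P: (tch _ _ ij) => _ _ _ _ adj.
have f1 k : f (b k).1 == Some k by apply/eqP/fE; rewrite eqxx.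
have f2 k : f (b k).2 == Some k by apply/eqP/fE; rewrite eqxx orbT.
have ei := edge _ (bin i); have ej := edge _ (bin j).
have go x : (x == (b i).1) || (x == (b i).2) -> e x (b j).1 || e x (b j).2 ->
  exists p, [/\ path e x p, last x p = (b j).1 &
    all (fun x => (f x == Some i) || (f x == Some j)) (x :: p)].
  move=> xi; have fx : f x == Some i by apply/eqP/fE.
  case/orP=> ex; first by exists [:: (b j).1]; rewrite /= ex fx f1 orbT.
  case/orP: ej => [/eqP E|ej]; first by exists [:: (b j).1]; rewrite /= E ex fx f2 orbT.
  by exists [:: (b j).2; (b j).1]; rewrite /= ex esym ej fx f1 f2 !orbT.
case: (boolP (e (b i).1 (b j).1 || e (b i).1 (b j).2)) => [H|H].
  by apply: go; rewrite ?eqxx.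
have H2 : e (b i).2 (b j).1 || e (b i).2 (b j).2.
  by move: adj H; do 2 case: (e (b i).1 _).
case/orP: ei => [/eqP E|ei]; first by apply: go; rewrite ?eqxx // E.
have [|p [pp lp ap]] := go (b i).2 _ H2; first by rewrite eqxx orbT.
by exists ((b i).2 :: p); rewrite /= ei pp lp f1 /=; split.
Qed.

End K5Model.

(** * Degree sums, forbidden models and contraction *)

Section DegreeSum.
Variable V : finType.
Implicit Type e : rel V.

Definition deg e (x : V) : nat := \sum_y e x y.
Definition degsum e : nat := \sum_x deg e x.

Lemma degE e x : deg e x = #|[set y | e x y]|.
Proof. by rewrite /deg -big_mkcond sum1_card cardsE. Qed.

Lemma degsum_pair e : degsum e = \sum_(p : V * V) e p.1 p.2.
Proof. by rewrite /degsum /deg pair_big. Qed.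

Lemma degsum_del e u : symmetric e -> irreflexive e ->
  degsum e = (\sum_(x | x != u) \sum_(y | y != u) e x y) + (deg e u).*2.
Proof.
move=> esym eirr; rewrite /degsum (bigD1 u) //= addnC -addnn addnA; congr (_ + _).
rewrite /deg [X in _ = _ + X](bigD1 u) //= eirr add0n -big_split /=.
by apply: eq_bigr => x xu; rewrite (bigD1 u) //= addnC [e x u]esym.
Qed.

End DegreeSum.

Section NoK5.
Variables (V : finType) (e : rel V).
Hypotheses (esym : symmetric e) (pl : planar_like e).

Lemma no_K5_edge a a' x y z t :
  uniq [:: a; a'; x; y; z; t] -> e a a' -> all (fun u => e a u || e a' u) [:: x; y; z; t] ->
  pairwise e [:: x; y; z; t] -> False.
Proof.
rewrite /= !inE !negb_or -!andbA.
case/and5P=> aa' ax ay az /and5P[at_ a'x a'y a'z /and5P[a't xy xz xt /and4P[yz yt zt _]]].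
move=> eaa' /and5P[ex ey ez et _] /and5P[exy exz ext _ /and5P[eyz eyt _ ezt _]].
apply: (@no_K5_model V e esym [:: (a, a'); (x, x); (y, y); (z, z); (t, t)]) => //=.
  by rewrite !eqxx eaa' orbT.
rewrite /touching /= ax a'x ay a'y az a'z at_ a't xy xz xt yz yt zt exy exz ext eyz eyt ezt.
by rewrite !orbb !andbT /=; move: ex ey ez et; do 8!case: (e _ _).
Qed.

Lemma no_K5 a x y z t :
  uniq [:: a; x; y; z; t] -> pairwise e [:: a; x; y; z; t] -> False.
Proof.
rewrite /= !inE !negb_or -!andbA => /and5P[ax ay az at_ /and5P[xy xz xt yz /and3P[yt zt _]]].
case/and5P=> eax eay eaz eat /and5P[_ exy exz ext /and5P[_ eyz eyt _ /and3P[ezt _ _]]].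
apply: (@no_K5_model V e esym [:: (a, a); (x, x); (y, y); (z, z); (t, t)]) => //=.
  by rewrite !eqxx.
by rewrite /touching /= ax ay az at_ xy xz xt yz yt zt eax eay eaz eat exy exz ext eyz eyt ezt.
Qed.

End NoK5.

Section Contraction.
Variables (V : finType) (e : rel V) (u w : V).
Hypotheses (esym : symmetric e) (eirr : irreflexive e) (euw : e u w).

Definition contract_adj (x y : {x in predC1 u}) : bool :=
  [|| e (val x) (val y), (val x == w) && e u (val y) && (val y != w) |
     (val y == w) && e u (val x) && (val x != w)].

Lemma contract_adj_sym : symmetric contract_adj.
Proof. by move=> x y; rewrite /contract_adj esym; congr orb; rewrite orbC. Qed.

Lemma contract_adj_irr : irreflexive contract_adj.
Proof. by move=> x; rewrite /contract_adj eirr orbb; case: eqP; rewrite ?andbF. Qed.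

Lemma contract_planar_like : planar_like e -> planar_like contract_adj.
Proof.
move=> pl; have wu : w \in predC1 u.
  by rewrite inE /=; apply: contraTneq euw => ->; rewrite eirr.
pose f x : option {x in predC1 u} := if x == u then Some (exist _ w wu) else insub x.
have fv (h : {x in predC1 u}) : f (val h) == Some h.
  by rewrite /f valK; have := valP h; rewrite inE /= => /negPf ->.
have fu (h : {x in predC1 u}) : val h = w -> f u == Some h.
  by move=> hw; rewrite /f eqxx; apply/eqP; congr Some; apply: val_inj.
apply: (@planar_like_minor V _ e _ f val) contract_adj_sym contract_adj_irr pl _ _.
  by move=> h; apply/eqP.
move=> h k /or3P[ehk|/andP[/andP[/eqP hw euk] _]|/andP[/andP[/eqP kw euh] _]].
- by exists [:: val k]; rewrite /= ehk !fv !orbT.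
- by exists [:: u; val k]; rewrite /= !fv fu // esym hw euw euk !orbT.
- by exists [:: u; val k]; rewrite /= !fv (fu k) // esym euh kw euw !orbT.
Qed.

(** Contraction loses the edge [uw] and fuses the two edges to each common neighbor; a degree sum
    counts every lost edge twice. *)
Lemma contract_degsum :
  degsum e = degsum contract_adj + 2 + (\sum_y (e u y && e w y)).*2.
Proof.
have uw : u != w by apply: contraTneq euw => ->; rewrite eirr.
(* The neighbors that [w] gains. *)
pose D y := [&& e u y, ~~ e w y & y != w].
have -> : degsum contract_adj =
    \sum_(x | x != u) \sum_(y | y != u) (e x y + ((x == w) && D y) + ((y == w) && D x)).
  rewrite /degsum [RHS](big_sub (predC1 u)); apply: eq_bigr => x _ /=.
  rewrite /deg [RHS](big_sub (predC1 u)); apply: eq_bigr => y _ /=.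
  rewrite /contract_adj /D /=.
  case: (eqVneq (sval x) w) => [->|xw]; case: (eqVneq (sval y) w) => [->|yw] /=;
    rewrite ?eirr ?andbF ?andbT ?orbF ?addn0 //.
  - by case: (e w _); case: (e u _).
  - by rewrite (esym w); case: (e _ w); case: (e u _).
have DE : \sum_(y | y != u) D y + 1 + \sum_y (e u y && e w y) = deg e u.
  rewrite /deg [RHS](bigD1 u) //= eirr add0n.
  rewrite [X in _ + X](bigD1 u) //= eirr add0n.
  rewrite (bigD1 w) /= ?[RHS](bigD1 w) /= ?[X in _ + X](bigD1 w) 1?eq_sym //=.
  rewrite /D eqxx !andbF eirr andbF euw !add0n addnAC -big_split /= addnC.
  by congr (_ + _); apply: eq_bigr => y /andP[_ ->]; case: (e u y); case: (e w y).
rewrite (degsum_del u esym eirr).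
under [in RHS]eq_bigr do rewrite !big_split /=.
rewrite !big_split /=.
have -> : \sum_(x | x != u) \sum_(y | y != u) ((x == w) && D y) = \sum_(y | y != u) D y.
  rewrite (bigD1 w) 1?eq_sym //= [X in _ + X]big1 ?addn0.
    by apply: eq_bigr => y _; rewrite eqxx.
  by move=> x /andP[_ /negPf xw]; rewrite big1 // => y _; rewrite xw.
have -> : \sum_(x | x != u) \sum_(y | y != u) ((y == w) && D x) = \sum_(y | y != u) D y.
  apply: eq_bigr => x xu.
  rewrite (bigD1 w) 1?eq_sym //= [X in _ + X]big1 ?addn0 ?eqxx //.
  by move=> y /andP[_ /negPf yw]; rewrite yw.
move: DE; lia.
Qed.

End Contraction.

Section Induced.
Variables (V : finType) (e : rel V) (A : {pred V}).

Definition induced_adj (x y : {x in A}) : bool := e (val x) (val y).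

Lemma induced_planar_like : planar_like e -> planar_like induced_adj.
Proof.
case=> l [lam pd]; exists (fun x y => l (val x) (val y)).
exists (fun x y z => lam (val x) (val y) (val z)); split.
- by move=> x y xy; apply: (pd_anti pd).
- by move=> x y z; apply: (pd_sym pd).
- by move=> x y z t exy ezt xz xt yz yt; apply: (pd_cross pd).
Qed.

End Induced.

Lemma card_sub_in (V : finType) (A : {pred V}) : #|{: {x in A}}| = #|A|.
Proof. by rewrite card_sig; apply: eq_card => x; rewrite !inE. Qed.

(** * Sparsity *)

Lemma degsum_le_complete (V : finType) (e : rel V) : irreflexive e ->
  degsum e <= #|V| * #|V|.-1.
Proof.
move=> eirr; rewrite /degsum -sum_nat_const; apply: leq_sum => x _.
rewrite degE -(cardC1 x) -cardsE; apply: subset_leq_card.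
by apply/subsetP => y; rewrite !inE; apply: contraTneq => ->; rewrite eirr.
Qed.

Section EdgeDeletion.
Variables (V : finType) (e : rel V) (a b : V).
Hypotheses (esym : symmetric e) (eirr : irreflexive e) (eab : e a b).

Definition del_edge (x y : V) : bool :=
  e x y && ~~ ((x == a) && (y == b) || (x == b) && (y == a)).

Lemma del_edge_degsum : degsum e = degsum del_edge + 2.
Proof.
have ab : a != b by apply: contraTneq eab => ->; rewrite eirr.
have ne : (b, a) != (a, b) by rewrite xpair_eqE eq_sym (negPf ab).
rewrite !degsum_pair (bigD1 (a, b)) //= (bigD1 (b, a)) //= [e b a]esym eab.
rewrite [in RHS](bigD1 (a, b)) //= [in RHS](bigD1 (b, a)) //=.
rewrite /del_edge !eqxx orbT !andbF !add0n addnA addnC; congr (_ + _).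
apply: eq_bigr => -[x y] /=; rewrite !xpair_eqE => /andP[/negPf -> /negPf ->].
by rewrite andbT.
Qed.

Lemma del_edge_sym : symmetric del_edge.
Proof.
by move=> x y; rewrite /del_edge esym orbC; congr (_ && ~~ (_ || _)); rewrite andbC.
Qed.

Lemma del_edge_irr : irreflexive del_edge.
Proof. by move=> x; rewrite /del_edge eirr. Qed.

End EdgeDeletion.

Ltac minor N S K := have := K; rewrite /= ?inE ?negb_or ?N ?S => /(_ isT isT).

(* If every edge at [v] lies in three triangles, then the neighborhood of [v]
   has a vertex of degree at least three everywhere; on at most five vertices
   this leaves a K4 minor, hence with [v] a K5 minor. *)
Lemma low_degree_K5 (V : finType) (e : rel V) (v : V) :
  symmetric e -> irreflexive e -> planar_like e -> 3 < deg e v <= 5 ->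
  (forall x, e v x -> 3 <= \sum_y (e v y && e x y)) -> False.
Proof.
move=> esym eirr pl dv tri.
pose s := enum [set y | e v y].
have ssz : size s = deg e v by rewrite -cardE degE.
have us : uniq s by apply: enum_uniq.
have sv x : (x \in s) = e v x by rewrite mem_enum inE.
have cnt x : x \in s -> 3 <= count (e x) s.
  rewrite sv => /tri; congr (_ <= _).
  rewrite -sum1_count /s big_enum_cond /= [RHS]big_mkcond /=.
  by apply: eq_bigr => y _; rewrite inE; case: (e v y); case: (e x y).
have vs : v \notin s by rewrite sv eirr.
have svs : all (e v) s by apply/allP => x; rewrite sv.
move: ssz us cnt vs svs dv; clear sv; clearbody s; move=> <-.
case: s => [|a [|b [|c [|d s]]]] // us cnt vs svs.
have := cnt a; have := cnt b; have := cnt c; have := cnt d.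
rewrite !inE !eqxx !orbT /= !eirr !add0n.
move: svs => /=; case/and5P=> ea eb ec ed es.
rewrite ![e b a]esym ![e c a]esym ![e d a]esym ![e c b]esym ![e d b]esym ![e d c]esym.
case: s us cnt vs es => [|f [|//]] us cnt vs es /=.
  rewrite !addn0 => Hd Hc Hb Ha _.
  apply: (@no_K5 V e esym pl v a b c d); first by rewrite /= vs.
  rewrite /= ea eb ec ed /=.
  move: (Ha isT) (Hb isT) (Hc isT).
  by case: (e a b); case: (e a c); case: (e a d); case: (e b c); case: (e b d); case: (e c d).
have := cnt f; rewrite !inE !eqxx !orbT /= !eirr !addn0.
rewrite ![e f a]esym ![e f b]esym ![e f c]esym ![e f d]esym.
move=> Hf Hd Hc Hb Ha _.
move: (Ha isT) (Hb isT) (Hc isT) (Hd isT) (Hf isT) => {Ha Hb Hc Hd Hf cnt}.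
case/andP: es => ef _.
have K4 x y z t : uniq [:: v; x; y; z; t] -> all (e v) [:: x; y; z; t] ->
    [&& e x y, e x z, e x t, e y z, e y t & e z t] = false.
  move=> U /= /and5P[vx vy vz vt _]; apply/negP => /and5P[xy xz xt yz /andP[yt zt]].
  by apply: (no_K5 esym pl U); rewrite /= vx vy vz vt xy xz xt yz yt zt.
have KE x x' y z t : uniq [:: x; x'; v; y; z; t] -> all (e v) [:: x; x'; y; z; t] ->
    [&& e x x', e x y || e x' y, e x z || e x' z, e x t || e x' t, e y z, e y t & e z t]
    = false.
  move=> U /= /and5P[vx vx' vy vz /andP[vt _]]; apply/negP.
  case/and5P=> xx' xy xz xt /and3P[yz yt zt].
  apply: (no_K5_edge esym pl U) => //=; first by rewrite (esym x v) vx xy xz xt.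
  by rewrite vy vz vt yz yt zt.
have Uv : uniq [:: v; a; b; c; d; f] by rewrite cons_uniq vs us.
move: ea eb ec ed ef Uv; rewrite /= !inE !negb_or -!andbA => va vb vc vd vf.
case/and5P=> nva nvb nvc nvd /and5P[nvf nab nac nad /and5P[naf nbc nbd nbf /and4P[ncd ncf ndf _]]].
have nav : a != v by rewrite eq_sym nva.
have nbv : b != v by rewrite eq_sym nvb.
have ncv : c != v by rewrite eq_sym nvc.
have ndv : d != v by rewrite eq_sym nvd.
have nfv : f != v by rewrite eq_sym nvf.
have nba : b != a by rewrite eq_sym nab.
have nca : c != a by rewrite eq_sym nac.
have nda : d != a by rewrite eq_sym nad.
have nfa : f != a by rewrite eq_sym naf.
have ncb : c != b by rewrite eq_sym nbc.
have ndb : d != b by rewrite eq_sym nbd.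
have nfb : f != b by rewrite eq_sym nbf.
have ndc : d != c by rewrite eq_sym ncd.
have nfc : f != c by rewrite eq_sym ncf.
have nfd : f != d by rewrite eq_sym ndf.
have N := ((nva, nav, nvb, nbv, nvc, ncv, nvd, ndv, nvf, nfv), (nab, nba, nac, nca, nad, nda),
  (naf, nfa, nbc, ncb, nbd, ndb), (nbf, nfb, ncd, ndc, ncf, nfc, ndf, nfd), (va, vb, vc, vd, vf)).
have S := (esym b a, esym c a, esym d a, esym f a, esym c b, esym d b, esym f b, esym d c, esym f c,
  esym f d).
(* The unknowns left are the ten adjacencies among the five neighbors. The listed models, four
   neighbors or five with one edge contracted, suffice to contradict minimum degree three in the
   final case analysis. *)
minor N S (K4 a b c d).
minor N S (K4 a b c f).
minor N S (K4 a b d f).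
minor N S (K4 a c d f).
minor N S (K4 b c d f).
minor N S (KE b d a c f).
minor N S (KE b c a d f).
minor N S (KE b c a f d).
minor N S (KE a d b c f).
minor N S (KE a c b d f).
minor N S (KE a c b f d).
minor N S (KE a d c b f).
minor N S (KE a b c d f).
minor N S (KE a b c f d).
minor N S (KE a c d b f).
minor N S (KE a b d c f).
minor N S (KE a b d f c).
minor N S (KE a c f b d).
minor N S (KE a b f c d).
minor N S (KE a b f d c).
clear.
by do 10!case: (e _ _).
Qed.

Lemma induced_degsum (V : finType) (e : rel V) (u : V) :
  symmetric e -> irreflexive e ->
  degsum e = degsum (@induced_adj V e (predC1 u)) + (deg e u).*2.
Proof.
move=> esym eirr; rewrite (degsum_del u esym eirr); congr (_ + _).
rewrite [LHS](big_sub (predC1 u)); apply: eq_bigr => x _ /=.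
by rewrite /deg [LHS](big_sub (predC1 u)).
Qed.

(** A parity drawing has no faces to count, so the bound of 3n - 6 edges comes from a minimal
    counterexample. Deleting an edge shows that it barely exceeds the bound, so some degree is at
    most five; deleting that vertex makes its degree at least four; contracting an edge at it puts
    this edge in three triangles. *)
Lemma planar_like_degsum (V : finType) (e : rel V) :
  symmetric e -> irreflexive e -> planar_like e -> 3 <= #|V| ->
  degsum e + 12 <= 6 * #|V|.
Proof.
have [k] := ubnP (#|V| + degsum e); elim: k => // k IH in V e *.
move=> lek esym eirr pl V3; rewrite leqNgt; apply/negP => big.
have := degsum_le_complete eirr => small.
have V4 : 3 < #|V|.
  by rewrite ltn_neqAle V3 andbT; apply/eqP => E; move: small big; rewrite -E; lia.
have cC1 (u : V) : #|{: {x in predC1 u}}| = #|V|.-1.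
  by rewrite card_sub_in cardC1.
have big2 : degsum e + 10 <= 6 * #|V|.
  rewrite leqNgt; apply/negP => big2.
  have [[a b] /= eab|E] := pickP (fun p : V * V => e p.1 p.2); last first.
    by move: big2; rewrite degsum_pair big1 => [|p _]; [lia | rewrite E].
  have dd := del_edge_degsum esym eirr eab.
  have pl' : planar_like (del_edge e a b).
    by apply: planar_like_sub pl => x y /andP[].
  have {}IH := IH V _ _ (del_edge_sym a b esym) (del_edge_irr a b eirr) pl' V3.
  have : degsum (del_edge e a b) + 12 <= 6 * #|V| by apply: IH; move: lek dd; lia.
  by move: big2 dd; lia.
have [v dv] : exists v, deg e v <= 5.
  apply/existsP; apply: contraTT big2; rewrite negb_exists => /forallP D6.
  rewrite -ltnNge; apply: leq_ltn_trans (_ : degsum e < _); last by lia.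
  rewrite mulnC -sum_nat_const; apply: leq_sum => v _.
  by move: (D6 v); rewrite -ltnNge.
have dv4 : 3 < deg e v.
  rewrite ltnNge; apply/negP => dv3.
  have := induced_degsum v esym eirr => dd.
  have s : symmetric (induced_adj e (A := predC1 v)) by move=> x y; apply: esym.
  have i : irreflexive (induced_adj e (A := predC1 v)) by move=> x; apply: eirr.
  have {}IH := IH _ _ _ s i (@induced_planar_like _ _ _ pl).
  have {}IH : degsum (induced_adj e (A := predC1 v)) + 12 <= 6 * #|V|.-1.
    by rewrite -(cC1 v); apply: IH; rewrite cC1; move: big lek dd V4; lia.
  by move: big lek dd dv3 V4 IH; lia.
apply: (@low_degree_K5 V e v) => //; first by rewrite dv4.
move=> x evx; rewrite leqNgt; apply/negP => tri.
have := contract_degsum esym eirr evx => dd.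
have {}IH := IH _ _ _ (@contract_adj_sym V e v x esym) (@contract_adj_irr _ _ v x eirr)
  (contract_planar_like esym eirr evx pl).
have {}IH : degsum (@contract_adj V e v x) + 12 <= 6 * #|V|.-1.
  by rewrite -(cC1 v); apply: IH; rewrite cC1; move: big lek dd tri V4; lia.
by move: big lek dd tri V4; lia.
Qed.

(** * Kempe changes along closed sets *)

Section KempeTheory.
Variables (V : finType) (k : nat).
Implicit Types (L e : rel V) (c d : {ffun V -> 'I_k}) (a b : 'I_k) (K : {set V}).
Implicit Types (s : seq (kchange V k)).

(* Closed sets are unions of Kempe chains; unlike chains they are stable under
   unions and under taking preimages along identifications of vertices. *)
Definition kempe_closed L c a b K : bool :=
  [forall x in K, (c x \in [:: a; b]) &&
     [forall y, L x y && (c y \in [:: a; b]) ==> (y \in K)]].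

Lemma kempe_closedP L c a b K :
  reflect ((forall x, x \in K -> c x \in [:: a; b]) /\
           (forall x y, x \in K -> L x y -> c y \in [:: a; b] -> y \in K))
          (kempe_closed L c a b K).
Proof.
apply: (iffP forall_inP) => [H|[H1 H2] x xK].
  split=> [x xK|x y xK Lxy cy]; first by case/andP: (H x xK).
  by case/andP: (H x xK) => _ /forallP/(_ y); rewrite Lxy cy.
rewrite H1 //=; apply/forallP => y; apply/implyP => /andP[Lxy cy].
exact: H2 Lxy cy.
Qed.

Fixpoint kempe_path L c s d : Prop :=
  match s with
  | [::] => c = d
  | (a, b, K) :: s' =>
      [/\ a != b, kempe_closed L c a b K & kempe_path L (kempe_swap c a b K) s' d]
  end.

Lemma kempe_path_cat L c s d s' d' :
  kempe_path L c s d -> kempe_path L d s' d' -> kempe_path L c (s ++ s') d'.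
Proof.
by elim: s c => [|[[a b] K] s IH] c /= => [->|[ab cl p] q] //; split=> //; exact: IH p q.
Qed.

Lemma kempe_swapE c a b K x :
  kempe_swap c a b K x = if x \in K then tperm a b (c x) else c x.
Proof. by rewrite ffunE. Qed.

Lemma tperm_pair a b x : (tperm a b x \in [:: a; b]) = (x \in [:: a; b]).
Proof.
by rewrite !inE; case: tpermP => [->|->|/eqP/negPf -> /eqP/negPf ->] //; rewrite !eqxx orbT.
Qed.

Lemma kempe_swapK c a b K : kempe_swap (kempe_swap c a b K) a b K = c.
Proof. by apply/ffunP => x; rewrite !ffunE; case: (x \in K); rewrite ?tpermK. Qed.

Lemma kempe_swap_pair c a b K x :
  (kempe_swap c a b K x \in [:: a; b]) = (c x \in [:: a; b]).
Proof. by rewrite kempe_swapE; case: ifP => // _; rewrite tperm_pair. Qed.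

Lemma kempe_closed_swap L c a b K :
  kempe_closed L c a b K -> kempe_closed L (kempe_swap c a b K) a b K.
Proof.
move=> /kempe_closedP[H1 H2]; apply/kempe_closedP; split=> [x|x y].
  by rewrite kempe_swap_pair; exact: H1.
by rewrite kempe_swap_pair; exact: H2.
Qed.

Lemma kempe_path_rev L c s d : kempe_path L c s d -> kempe_path L d (rev s) c.
Proof.
elim: s c => [|[[a b] K] s IH] c /= => [->|[ab cl /IH p]] //.
rewrite rev_cons -cats1; apply: kempe_path_cat p _; split=> //=.
  exact: kempe_closed_swap.
exact: kempe_swapK.
Qed.

Lemma kempe_swap_proper e c a b K : symmetric e ->
  proper_coloring e c -> kempe_closed e c a b K ->
  proper_coloring e (kempe_swap c a b K).
Proof.
move=> esym pc /kempe_closedP[H1 H2] x y exy; rewrite !kempe_swapE.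
have cxy := pc _ _ exy; have eyx : e y x by rewrite esym.
case: ifPn => xK; case: ifPn => yK //.
- by rewrite (inj_eq perm_inj).
- have cy : c y \notin [:: a; b] by apply: contra yK; exact: H2 xK exy.
  by apply: contraNneq cy => <-; rewrite tperm_pair H1.
- have cx : c x \notin [:: a; b] by apply: contra xK; exact: H2 yK eyx.
  by apply: contraNneq cx => ->; rewrite tperm_pair H1.
Qed.

Lemma kempe_path_proper e c s d : symmetric e ->
  proper_coloring e c -> kempe_path e c s d -> proper_coloring e d.
Proof.
move=> esym; elim: s c => [|[[a b] K] s IH] c pc /= => [<- //|[ab cl /IH]]; apply.
exact: kempe_swap_proper cl.
Qed.

(* Meaningful only when [c x] is [a] or [b]. *)
Definition chain L c a b x : {set V} :=
  [set y | connect [rel u v | [&& c u \in [:: a; b], c v \in [:: a; b] & L u v]] x y].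

Lemma chain_refl L c a b x : x \in chain L c a b x.
Proof. by rewrite inE connect0. Qed.

Lemma chain_color L c a b x y :
  c x \in [:: a; b] -> y \in chain L c a b x -> c y \in [:: a; b].
Proof.
move=> cx; rewrite inE => /connectP[p pp ->].
by elim: p x cx pp => //= z p IH x cx /andP[/and3P[_ cz _] pp]; exact: IH pp.
Qed.

Lemma chain_step L c a b x y z : y \in chain L c a b x ->
  c y \in [:: a; b] -> c z \in [:: a; b] -> L y z -> z \in chain L c a b x.
Proof.
rewrite !in_set => xy cy cz Lyz; apply: connect_trans xy _; apply: connect1.
by rewrite /= cy cz.
Qed.

Lemma chain_closed L c a b x : c x \in [:: a; b] ->
  kempe_closed L c a b (chain L c a b x).
Proof.
move=> cx; apply/kempe_closedP; split=> [y|y z yC Lyz cz]; first exact: chain_color.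
exact: chain_step yC (chain_color cx yC) cz Lyz.
Qed.

Lemma chain_min L c a b x K : x \in K -> kempe_closed L c a b K ->
  chain L c a b x \subset K.
Proof.
move=> xK /kempe_closedP[H1 H2]; apply/subsetP => y; rewrite inE => /connectP[p pp ->].
elim: p x xK pp => //= z p IH x xK /andP[/and3P[_ cz Lxz] pp].
exact: IH (H2 _ _ xK Lxz cz) pp.
Qed.

Lemma chainC L c a b x y : symmetric L ->
  (y \in chain L c a b x) = (x \in chain L c a b y).
Proof.
move=> Lsym; rewrite !in_set; apply: sym_connect_sym => u v /=.
by rewrite Lsym andbCA.
Qed.

Lemma chain_trans L c a b x y z :
  y \in chain L c a b x -> z \in chain L c a b y -> z \in chain L c a b x.
Proof. by rewrite !inE; apply: connect_trans. Qed.

Lemma chain_connect L c a b x y : c x \in [:: a; b] -> y \in chain L c a b x ->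
  connect [rel u v | [&& u \in chain L c a b x, v \in chain L c a b x & L u v]] x y.
Proof.
move=> cx; rewrite inE => /connectP[p pp ->]; set C := chain _ _ _ _ _.
have xC : x \in C by apply: chain_refl.
suff gen u : u \in C -> c u \in [:: a; b] ->
    path [rel u v | [&& c u \in [:: a; b], c v \in [:: a; b] & L u v]] u p ->
    connect [rel u v | [&& u \in C, v \in C & L u v]] u (last u p) by exact: gen pp.
elim: p u {pp} => //= z p IH u uC cu /andP[/and3P[_ cz Luz] pp].
have zC : z \in C by apply: chain_step uC cu cz Luz.
by apply: connect_trans (IH z zC cz pp); apply: connect1; rewrite /= uC zC.
Qed.

Lemma chain_kempe_chain e c a b x : symmetric e -> c x \in [:: a; b] ->
  kempe_chain e c a b (chain e c a b x).
Proof.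
move=> esym cx; apply/maxsetP; split.
  apply/andP; split; last by apply/forall_inP => y /(chain_color cx); rewrite !inE.
  apply/andP; split; first by apply/set0Pn; exists x; apply: chain_refl.
  have csym : connect_sym [rel u v | [&& u \in chain e c a b x, v \in chain e c a b x & e u v]].
    by apply: sym_connect_sym => u v /=; rewrite esym andbCA.
  apply/forall_inP => y yC; apply/forall_inP => z zC.
  apply: connect_trans (chain_connect cx zC); rewrite csym.
  exact: chain_connect.
move=> B /andP[/andP[_ /forall_inP con] /forall_inP col] sub.
apply/eqP; rewrite eqEsubset sub andbT; apply/subsetP => y yB.
have xB : x \in B by apply: (subsetP sub); apply: chain_refl.
rewrite inE; have /forall_inP/(_ y yB) := con x xB.
apply: connect_sub => u v /and3P[uB vB euv]; apply: connect1.
by rewrite /= !inE col // col.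
Qed.

(** A closed set is a disjoint union of chains in the same two colors. Swapping one of them leaves
    the rest closed, and each vertex lies in just one chain, so no change is counted twice. *)
Lemma kempe_step_chains e c a b K : symmetric e -> a != b -> kempe_closed e c a b K ->
  exists s, kempe_sequence e c s (kempe_swap c a b K) /\
    forall x, color_changes s x = (x \in K).
Proof.
move=> esym ab; have [n] := ubnP #|K|; elim: n => // n IH in c K *.
have [->|[x xK]] := set_0Vmem K.
  move=> _ _; exists [::]; split=> [|x]; last by rewrite inE.
  by apply/ffunP => x; rewrite ffunE inE.
move=> ltK cl; have [H1 H2] := kempe_closedP _ _ _ _ _ cl.
have cx := H1 x xK; set C := chain e c a b x.
have CK : C \subset K by apply: chain_min.
have xC : x \in C by apply: chain_refl.
have [||s [ks cs]] := IH (kempe_swap c a b C) (K :\: C).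
- have := cardsD K C; rewrite (setIidPr CK); have : 0 < #|C| by apply/card_gt0P; exists x.
  by have := subset_leq_card CK; move: ltK; lia.
- apply/kempe_closedP; split=> [y /setDP[yK _]|y z /setDP[yK yC] eyz].
    by rewrite kempe_swap_pair H1.
  rewrite kempe_swap_pair in_setD => cz; rewrite (H2 _ _ yK eyz cz) andbT.
  apply: contra yC => zC; apply: chain_step zC cz (H1 _ yK) _.
  by rewrite esym.
exists ((a, b, C) :: s); split=> [|y]; last first.
  have -> : color_changes ((a, b, C) :: s) y = (y \in C) + color_changes s y by [].
  rewrite cs in_setD; have := subsetP CK y.
  by case: (y \in C) => // /(_ isT) ->.
split=> //; first exact: chain_kempe_chain.
congr (kempe_sequence _ _ _ _): ks; apply/ffunP => y; rewrite !kempe_swapE in_setD.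
have := subsetP CK y.
by case: (y \in C) => // /(_ isT) ->.
Qed.

Lemma kempe_sequence_cat e c s1 d s2 d' :
  kempe_sequence e c s1 d -> kempe_sequence e d s2 d' -> kempe_sequence e c (s1 ++ s2) d'.
Proof.
by elim: s1 c => [|[[a b] K] s1 IH] c /= => [->|[ab cl p] q] //; split=> //; exact: IH p q.
Qed.

Lemma kempe_path_sequence e c s d : symmetric e -> kempe_path e c s d ->
  exists s', kempe_sequence e c s' d /\ forall x, color_changes s' x = color_changes s x.
Proof.
move=> esym; elim: s c => [|[[a b] K] s IH] c /= => [->|[ab cl /IH[s2 [k2 c2]]]].
  by exists [::].
have [s1 [k1 c1]] := kempe_step_chains esym ab cl.
exists (s1 ++ s2); split=> [|x]; first exact: kempe_sequence_cat k1 k2.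
by rewrite /color_changes count_cat -!/(color_changes _ _) c1 c2.
Qed.

Definition reconf e n c d : Prop :=
  exists2 s, kempe_path e c s d & forall x, color_changes s x <= n.

Lemma reconf_refl e n c : reconf e n c c.
Proof. by exists [::]. Qed.

Lemma reconf_sym e n c d : reconf e n c d -> reconf e n d c.
Proof.
case=> s p b; exists (rev s); first exact: kempe_path_rev.
by move=> x; rewrite /color_changes count_rev; exact: b.
Qed.

Lemma reconf_trans e m n c d d' :
  reconf e m c d -> reconf e n d d' -> reconf e (m + n) c d'.
Proof.
case=> s p b [s' p' b']; exists (s ++ s'); first exact: kempe_path_cat p p'.
by move=> x; rewrite /color_changes count_cat; apply: leq_add; [exact: b|exact: b'].
Qed.

Lemma reconf_leq e m n c d : m <= n -> reconf e m c d -> reconf e n c d.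
Proof. by move=> mn [s p b]; exists s => // x; apply: leq_trans (b x) mn. Qed.

End KempeTheory.

(** * Merging neighbors of removed vertices *)

(** When [g x] is absent around [x], the singleton of [x] is closed for the colors [c x] and [g x];
    independence of [R] keeps the other target colors free. *)
Lemma recolor (V : finType) (k : nat) (e : rel V) (c : {ffun V -> 'I_k}) (g : V -> 'I_k)
    (R : {set V}) : symmetric e -> irreflexive e ->
  (forall x y, x \in R -> y \in R -> ~~ e x y) -> proper_coloring e c ->
  (forall x y, x \in R -> e x y -> c y != g x) ->
  exists s, kempe_path e c s [ffun x => if x \in R then g x else c x] /\
    forall x, color_changes s x <= (x \in R).
Proof.
move=> esym eirr; have [n] := ubnP #|R|; elim: n => // n IH in c R *.
have [->|[r rR]] := set_0Vmem R.
  move=> _ _ _ _; exists [::]; split=> [|x] //=.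
  by apply/ffunP => x; rewrite ffunE inE.
move=> ltR ind pc free.
pose c1 : {ffun V -> 'I_k} := [ffun x => if x == r then g r else c x].
have pc1 : proper_coloring e c1.
  move=> x y exy; rewrite !ffunE; case: (eqVneq x r) => [xr|_]; case: (eqVneq y r) => [yr|_].
  - by move: exy; rewrite xr yr eirr.
  - by rewrite /= eq_sym; apply: free => //; rewrite -xr.
  - by rewrite /=; apply: free => //; rewrite esym -yr.
  - exact: pc.
have [||||s [ps cs]] := IH c1 (R :\ r).
- by have := cardsD1 r R; rewrite rR; move: ltR; lia.
- by move=> x y /setD1P[_ xR] /setD1P[_ yR]; exact: ind.
- exact: pc1.
- move=> x y /setD1P[xr xR] exy; rewrite ffunE; case: (eqVneq y r) => [yr|_]; last exact: free xR exy.
  by have := ind _ _ xR rR; rewrite -yr exy.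
have E : [ffun x => if x \in R :\ r then g x else c1 x] =
         [ffun x => if x \in R then g x else c x].
  by apply/ffunP => x; rewrite !ffunE in_setD1; case: eqP => [->|_] //=; rewrite rR.
rewrite E in ps; case: (eqVneq (c r) (g r)) => [cg|cg].
  have c1E : c1 = c by apply/ffunP => x; rewrite ffunE; case: eqP => [->|].
  rewrite c1E in ps; exists s; split=> // x.
  by apply: leq_trans (cs x) _; rewrite in_setD1; case: (x \in R); rewrite ?andbF // leq_b1.
exists ((c r, g r, [set r]) :: s); split=> [|x].
  split=> //.
    apply/kempe_closedP; split=> [x /set1P ->|x y /set1P -> ery]; first by rewrite !inE eqxx.
    by rewrite !inE [c y == c r]eq_sym (negPf (pc _ _ ery)) (negPf (free _ _ rR ery)).
  congr (kempe_path _ _ _ _): ps; apply/ffunP => x; rewrite !ffunE in_set1.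
  by case: eqP => // ->; rewrite tpermL.
have -> : color_changes ((c r, g r, [set r]) :: s) x = (x \in [set r]) + color_changes s x by [].
by have := cs x; rewrite in_setD1 in_set1; case: eqP => [->|_] //=; rewrite rR.
Qed.

Section Merge.
Variables (V : finType) (e l : rel V) (lam : V -> V -> V -> bool).
Hypotheses (esym : symmetric e) (eirr : irreflexive e) (pd : parity_drawing e l lam).
Variables (R : {set V}) (m cen : V -> V).

(* The vertices of [R] are to be removed and [x] is to be identified with [m x]
   along the path through [cen x]. *)
Record merge_data : Prop := MergeData {
  md_out : forall x, x \notin R -> m x \notin R;
  md_removed : forall x, x \in R -> m x = x;
  md_idem : forall x, m (m x) = m x;
  md_cen : forall x, m x != x -> [/\ cen x \in R, e (cen x) x & e (cen x) (m x)];
  md_noncross : forall x y, m x != x -> m y != y -> m x != m y -> cen x = cen y ->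
    chi l lam (cen x) x (m x) y (m y) = false;
  md_class_indep : forall x y, x \notin R -> y \notin R -> m x = m y -> ~~ e x y;
  md_indep : forall x y, x \in R -> y \in R -> ~~ e x y;
  md_classes : forall r, r \in R -> #|m @: [set y | e r y]| <= 4;
  md_deg : forall r, r \in R -> deg e r <= 6
}.

Hypothesis md : merge_data.

Definition jump (x y : V) : bool := (x != y) && ((m x == y) || (m y == x)).

(** Joining [x] to [m x] instead of identifying them keeps the vertex type. For a coloring constant
    on classes, these extra edges force a closed set to contain each class wholly or not at all. *)
Definition merged_adj (x y : V) : bool := [&& x \notin R, y \notin R & e x y || jump x y].

(** A jump is drawn along the two edges through its removed center. *)
Definition merged_lam (x y z : V) : bool :=
  if e x y then lam x y z
  else if m x == y then lam x (cen x) z (+) lam (cen x) y z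
  else if m y == x then lam x (cen y) z (+) lam (cen y) y z
  else lam x y z.

Lemma jump_sym : symmetric jump.
Proof. by move=> x y; rewrite /jump eq_sym orbC. Qed.

Lemma merged_adj_sym : symmetric merged_adj.
Proof. by move=> x y; rewrite /merged_adj esym jump_sym andbCA. Qed.

Lemma merged_lam_sym u v w : merged_lam u v w = merged_lam v u w.
Proof.
rewrite /merged_lam esym; case: ifP => _; first exact: (pd_sym pd).
case: (eqVneq (m u) v) => [muv|_]; case: (eqVneq (m v) u) => [mvu|_] //.
- have uv : u = v by rewrite -mvu -muv (md_idem md).
  by rewrite uv; xor_tauto.
- by rewrite (pd_sym pd u (cen u)) (pd_sym pd (cen u) v); xor_tauto.
- by rewrite (pd_sym pd u (cen v)) (pd_sym pd (cen v) v); xor_tauto.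
- exact: (pd_sym pd).
Qed.

Lemma class_merged x : x \notin R -> m x != x -> ~~ e x (m x).
Proof.
by move=> xR mx; apply: (md_class_indep md); rewrite ?(md_out md) ?(md_idem md).
Qed.

Lemma merged_out x : m x != x -> x \notin R.
Proof. by move=> mx; apply: contra_neqN mx => /(md_removed md). Qed.

(** A jump decomposes into two edges of [e] at its center, which no surviving edge touches. Two
    jumps through different centers reduce to independent edges; through the same center their
    crossing parity is [chi], which [md_noncross] controls. *)
Lemma merged_adj_pd : parity_drawing merged_adj l merged_lam.
Proof.
split; [exact: (pd_anti pd) | exact: merged_lam_sym | ].
have symL u v w t : cross4 l merged_lam u v w t = cross4 l merged_lam v u w t.
  by rewrite /cross4 (merged_lam_sym u v w) (merged_lam_sym u v t); xor_tauto.
have symLR u v w t : cross4 l merged_lam u v w t = cross4 l merged_lam w t u v (+)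
    ((l u w (+) l w u) (+) (l u t (+) l t u) (+) (l v w (+) l w v) (+) (l v t (+) l t v)).
  by rewrite /cross4; xor_tauto.
have swap u v w t : u != w -> u != t -> v != w -> v != t ->
    cross4 l merged_lam u v w t = cross4 l merged_lam w t u v.
  move=> uw ut vw vt; rewrite symLR (pd_anti pd uw) (pd_anti pd ut) (pd_anti pd vw).
  by rewrite (pd_anti pd vt); xor_tauto.
have ee u v w t : e u v -> e w t -> u != w -> u != t -> v != w -> v != t ->
    cross4 l merged_lam u v w t = false.
  by move=> uv wt *; rewrite -(pd_cross pd uv wt) // /cross4 /merged_lam uv wt.
have nR x c : x \notin R -> c \in R -> (x != c) * (c != x).
  by move=> xR cR; have xc : x != c by [apply: contraNneq xR => ->]; rewrite xc eq_sym xc.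
have viaE u z : m u != u -> merged_lam u (m u) z = lam u (cen u) z (+) lam (cen u) (m u) z.
  by move=> mu; rewrite /merged_lam (negPf (class_merged (merged_out mu) mu)) eqxx.
have je u w t : m u != u -> e w t -> w \notin R -> t \notin R ->
    u != w -> u != t -> m u != w -> m u != t -> cross4 l merged_lam u (m u) w t = false.
  move=> mu wt wR tR uw ut vw vt; have [cR ecu ecm] := md_cen md mu.
  have euc : e u (cen u) by rewrite esym.
  rewrite /cross4 !(viaE u) // /merged_lam wt -/(merged_lam _ _ _).
  have := pd_cross pd euc wt uw ut (nR _ _ wR cR).2 (nR _ _ tR cR).2.
  have := pd_cross pd ecm wt (nR _ _ wR cR).2 (nR _ _ tR cR).2 vw vt.
  rewrite /cross4 => E1 E2.
  by apply: etrans (f_equal2 addb E1 E2); xor_tauto.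
have jj u w : m u != u -> m w != w ->
    u != w -> u != m w -> m u != w -> m u != m w ->
    cross4 l merged_lam u (m u) w (m w) = false.
  move=> mu mw uw umw muw mumw; have [cR ecu ecm] := md_cen md mu.
  have [dR edw edm] := md_cen md mw.
  have euc : e u (cen u) by rewrite esym.
  have ewd : e w (cen w) by rewrite esym.
  have uR := merged_out mu; have wR := merged_out mw.
  have muR := md_out md uR; have mwR := md_out md wR.
  rewrite /cross4 !(viaE u) // !(viaE w) //.
  case: (eqVneq (cen u) (cen w)) => [cd|cd].
    have := md_noncross md mu mw mumw cd; rewrite /chi /rot -cd /cross4.
    rewrite !(pd_sym pd (cen u) u) !(pd_sym pd (cen u) w) => <-; xor_tauto.
  have E1 := pd_cross pd euc ewd uw (nR _ _ uR dR).1 (nR _ _ wR cR).2 cd.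
  have E2 := pd_cross pd euc edm (nR _ _ uR dR).1 umw cd (nR _ _ mwR cR).2.
  have E3 := pd_cross pd ecm ewd (nR _ _ wR cR).2 cd muw (nR _ _ muR dR).1.
  have E4 := pd_cross pd ecm edm cd (nR _ _ mwR cR).2 (nR _ _ muR dR).1 mumw.
  move: E1 E2 E3 E4; rewrite /cross4 => E1 E2 E3 E4.
  by apply: etrans (f_equal2 addb (f_equal2 addb E1 E2) (f_equal2 addb E3 E4)); xor_tauto.
have jumpP u v : jump u v -> (v = m u /\ m u != u) \/ (u = m v /\ m v != v).
  by case/andP=> uv /orP[] /eqP E; [left|right]; rewrite E // eq_sym.
move=> u v w t /and3P[uR vR huv] /and3P[wR tR hwt] uw ut vw vt.
have symR u1 v1 w1 t1 : cross4 l merged_lam u1 v1 w1 t1 = cross4 l merged_lam u1 v1 t1 w1.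
  by rewrite /cross4 (merged_lam_sym w1 t1 u1) (merged_lam_sym w1 t1 v1); xor_tauto.
pose ok u v := e u v \/ (v = m u /\ m u != u).
have main u1 v1 w1 t1 : ok u1 v1 -> ok w1 t1 -> u1 \notin R -> v1 \notin R ->
    w1 \notin R -> t1 \notin R -> u1 != w1 -> u1 != t1 -> v1 != w1 -> v1 != t1 ->
    cross4 l merged_lam u1 v1 w1 t1 = false.
  move=> [e1|[-> m1]] [e2|[-> m2]] uR1 vR1 wR1 tR1 uw1 ut1 vw1 vt1.
  - exact: ee.
  - by rewrite swap //; apply: je; rewrite // eq_sym.
  - exact: je.
  - exact: jj.
have okP u1 v1 : e u1 v1 || jump u1 v1 -> ok u1 v1 \/ ok v1 u1.
  by case/orP=> [|/jumpP[]]; rewrite /ok; tauto.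
case: (okP _ _ huv) => o1; case: (okP _ _ hwt) => o2.
- exact: main.
- by rewrite symR; apply: main.
- by rewrite symL; apply: main.
- by rewrite symL symR; apply: main.
Qed.

End Merge.

(** * The graph of classes and the lifting of its K-changes *)

Section Quotient.
Variables (V : finType) (e l : rel V) (lam : V -> V -> V -> bool).
Hypotheses (esym : symmetric e) (eirr : irreflexive e) (pd : parity_drawing e l lam).
Variables (R : {set V}) (m cen : V -> V).
Hypothesis md : merge_data e l lam R m cen.

Local Notation eplus := (merged_adj e R m).
Local Notation lamplus := (merged_lam e lam m cen).

Lemma rot_plus v x z : e v x -> e v z -> rot l lamplus v x z = rot l lam v x z.
Proof. by move=> vx vz; rewrite /rot /cross4 /merged_lam vx vz. Qed.

Lemma chi_plus v x y z w : e v x -> e v y -> e v z -> e v w ->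
  chi l lamplus v x y z w = chi l lam v x y z w.
Proof. by move=> *; rewrite /chi !rot_plus. Qed.

Definition quot_pred : pred V := [pred x | (x \notin R) && (m x == x)].

Definition quot := {x in quot_pred}.

Definition quot_adj (h k : quot) : bool :=
  (h != k) && [exists x, exists y,
    [&& x \notin R, y \notin R, m x == val h, m y == val k & e x y]].

Lemma quot_adjP (h k : quot) :
  reflect (h != k /\ exists x y, [/\ x \notin R, y \notin R, m x = val h, m y = val k & e x y])
    (quot_adj h k).
Proof.
apply: (iffP andP) => -[hk H]; split=> //.
  by case/existsP: H => x /existsP[y /and5P[xR yR /eqP mx /eqP my exy]]; exists x, y.
case: H => x [y [xR yR mx my exy]]; apply/existsP; exists x; apply/existsP; exists y.
by rewrite xR yR mx my !eqxx.
Qed.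

Lemma quot_adj_sym : symmetric quot_adj.
Proof.
suff W h k : quot_adj h k -> quot_adj k h by move=> h k; apply/idP/idP; apply: W.
case/quot_adjP=> hk [x [y [xR yR mx my exy]]]; apply/quot_adjP; split; first by rewrite eq_sym.
by exists y, x; rewrite esym.
Qed.

Lemma quot_adj_irr : irreflexive quot_adj.
Proof. by move=> h; rewrite /quot_adj eqxx. Qed.

Lemma card_quot : #|{: quot}| + #|R| <= #|V|.
Proof.
rewrite card_sub_in -(cardsC R) addnC leq_add2l; apply: subset_leq_card.
by apply/subsetP => x /andP[xR _]; rewrite inE.
Qed.

Lemma quot_valP (h : quot) : val h \notin R /\ m (val h) = val h.
Proof. by have /andP[? /eqP] := valP h. Qed.

Lemma class_in x : x \notin R -> m x \in quot_pred.
Proof. by move=> xR; rewrite inE /= (md_out md) // (md_idem md) eqxx. Qed.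

(** This is a minor of the merged graph rather than of [e]: one center may serve two classes and so
    could not be put in the branch set of either, whereas jumps connect each class without it. *)
Lemma quot_planar_like : planar_like quot_adj.
Proof.
pose f x : option quot := if x \in R then None else insub (m x).
have fE x (h : quot) : x \notin R -> m x = val h -> f x == Some h.
  by move=> xR mx; rewrite /f (negPf xR) mx valK.
have fv (h : quot) : f (val h) == Some h.
  by have [hR mh] := quot_valP h; apply: fE.
apply: (@planar_like_minor V _ eplus _ f val) quot_adj_sym quot_adj_irr _ _ _.
- by exists l, lamplus; apply: merged_adj_pd.
- by move=> h; apply/eqP.
move=> h k /quot_adjP[hk [x [y [xR yR mx my exy]]]].
have [hR mh] := quot_valP h; have [kR mk] := quot_valP k.
have exyp : eplus x y by rewrite /merged_adj xR yR exy.
have [p [pp lp ap]] : exists p, [/\ path eplus y p, last y p = val k &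
    all (fun z => f z == Some k) (y :: p)].
  case: (eqVneq y (val k)) => [->|yk]; first by exists [::]; rewrite /= fv.
  by exists [:: val k]; rewrite /= fv (fE y) // /merged_adj yR kR /jump yk my eqxx orbT.
have {}ap : all (fun z => (f z == Some h) || (f z == Some k)) (y :: p).
  by apply: sub_all ap => z ->; rewrite orbT.
case: (eqVneq x (val h)) => [xh|xh].
  exists (y :: p); split=> //; first by rewrite /= pp andbT -xh.
  by rewrite [all _ _]/= fv; exact: ap.
exists (x :: y :: p); split=> //.
  have ehx : eplus (val h) x by rewrite /merged_adj xR hR /jump eq_sym xh mx eqxx !orbT.
  by rewrite /= pp exyp ehx.
have fxh := fE x h xR mx.
by rewrite [all _ _]/= fv fxh; exact: ap.
Qed.

Section Colorings.
Implicit Types c d : {ffun V -> 'I_5}.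

Definition class_const c : Prop := forall x, x \notin R -> c (m x) = c x.

Definition quot_col c : {ffun quot -> 'I_5} := [ffun h => c (val h)].

Lemma quot_col_proper c : proper_coloring e c -> class_const c ->
  proper_coloring quot_adj (quot_col c).
Proof.
move=> pc cc h k /quot_adjP[_ [x [y [xR yR mx my exy]]]].
by rewrite !ffunE -mx -my !cc // pc.
Qed.

Lemma class_closed c a b K x : class_const c -> kempe_closed eplus c a b K ->
  x \notin R -> (m x \in K) = (x \in K).
Proof.
move=> cc /kempe_closedP[H1 H2] xR; case: (eqVneq (m x) x) => [->//|mx].
have j : jump m (m x) x by rewrite /jump mx eqxx orbT.
have mxR := md_out md xR.
have E1 : eplus (m x) x by rewrite /merged_adj xR mxR j orbT.
have E2 : eplus x (m x) by rewrite /merged_adj xR mxR jump_sym j orbT.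
apply/idP/idP => xK.
  by apply: (H2 _ _ xK E1); rewrite -(cc x xR); apply: H1.
by apply: (H2 _ _ xK E2); rewrite (cc x xR); apply: H1.
Qed.

Lemma class_const_swap c a b K : class_const c -> kempe_closed eplus c a b K ->
  class_const (kempe_swap c a b K).
Proof.
by move=> cc cl x xR; rewrite !kempe_swapE (class_closed cc cl xR) cc.
Qed.

Definition avoids (s : seq (kchange V 5)) : Prop :=
  forall K, K \in s -> [disjoint K.2 & R].

Definition lift_set (K : {set quot}) : {set V} :=
  [set x | (x \notin R) && [exists h in K, val h == m x]].

Lemma lift_setE (K : {set quot}) x (h : quot) : x \notin R -> m x = val h ->
  (x \in lift_set K) = (h \in K).
Proof.
move=> xR mx; rewrite inE xR /=; apply/exists_inP/idP => [[k kK /eqP kx]|hK].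
  have hk : h = k by apply: val_inj; rewrite /= -mx kx.
  by rewrite hk.
by exists h; rewrite // mx.
Qed.

Lemma class_of x : x \notin R -> exists h : quot, m x = val h.
Proof. by move=> xR; exists (exist _ (m x) (class_in xR)). Qed.

Lemma quot_lift c n dq : proper_coloring e c -> class_const c ->
  reconf quot_adj n (quot_col c) dq ->
  exists s d, [/\ kempe_path eplus c s d, class_const d, quot_col d = dq, avoids s &
    forall x, x \notin R -> color_changes s x <= n].
Proof.
move=> _ + [s p b]; suff : forall cc : class_const c, exists s' d,
    [/\ kempe_path eplus c s' d, class_const d, quot_col d = dq, avoids s' &
    forall x (h : quot), x \notin R -> m x = val h ->
      color_changes s' x = color_changes s h].
  move=> W /W[s' [d [p' cd qd av cs]]]; exists s', d; split=> // x xR.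
  by have [h mx] := class_of xR; rewrite (cs _ _ xR mx).
elim: s c p {b} => [|[[a b] K] s IH] c /=.
  by move=> <- cc; exists [::], c.
move=> [ab /kempe_closedP[H1 H2] p] cc.
have cl : kempe_closed eplus c a b (lift_set K).
  apply/kempe_closedP; split=> [x|x y].
    rewrite inE => /andP[xR /exists_inP[h hK /eqP mx]].
    by have := H1 _ hK; rewrite ffunE mx cc.
  rewrite [x \in _]inE => /andP[xR /exists_inP[h hK /eqP mx]] /and3P[_ yR exy] cy.
  have [k my] := class_of yR; rewrite (lift_setE _ yR my).
  case: (eqVneq h k) => [<- //|hk].
  apply: (H2 h _ hK); last by rewrite ffunE -my cc.
  case/orP: exy => [exy|]; first by apply/quot_adjP; split=> //; exists x, y.
  case/andP=> _ /orP[/eqP E|/eqP E]; case/eqP: hk; apply: val_inj.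
    by rewrite mx -my -E (md_idem md).
  by rewrite mx -my -{1}E (md_idem md).
have cc' := class_const_swap cc cl.
have [|s' [d [p' cd qd av cs]]] := IH (kempe_swap c a b (lift_set K)) _ cc'.
  congr (kempe_path _ _ _ _): p; apply/ffunP => h; rewrite !ffunE.
  by have [hR mh] := quot_valP h; rewrite (@lift_setE K (val h) h).
exists ((a, b, lift_set K) :: s'), d; split=> //.
  move=> k; rewrite inE => /orP[/eqP ->|]; last exact: av.
  by rewrite disjoint_subset; apply/subsetP => x; rewrite inE => /andP[].
move=> x h xR mx.
have -> : color_changes ((a, b, lift_set K) :: s') x =
  (x \in lift_set K) + color_changes s' x by [].
by rewrite (cs _ _ xR mx) (lift_setE _ xR mx).
Qed.

Lemma removed_nbr_out r y : r \in R -> e r y -> y \notin R.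
Proof. by move=> rR ery; apply: contraTN ery => yR; apply: md_indep md _ _ rR yR. Qed.

(** Four colors differ from [c r]. Either one of them is absent around [r], or all four occur on at
    most four classes, so that each occupies just one. *)
Lemma few_classes c r : class_const c -> r \in R ->
  (exists2 a, a != c r & forall y, e r y -> c y != a) \/
  (forall y z, e r y -> e r z -> c y = c z -> c r != c y -> m y = m z).
Proof.
move=> cc rR; pose N := [set y | e r y].
have [/exists_inP[a ar /forallP H]|/exists_inPn H] :=
    boolP [exists a in [set~ c r], [forall y, e r y ==> (c y != a)]].
  by left; exists a; [move: ar; rewrite !inE | move=> y ery; have := H y; rewrite ery].
right=> y z ery erz cyz ryN.
have sub : [set~ c r] \subset c @: (m @: N).
  apply/subsetP => a /H; rewrite negb_forall => /existsP[x]; rewrite negb_imply negbK.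
  case/andP=> erx /eqP <-; rewrite -cc ?(removed_nbr_out rR erx) //.
  by apply/imset_f/imset_f; rewrite inE.
have c4 : #|[set~ c r]| = 4 by rewrite cardsC1 card_ord.
have /imset_injP inj : #|c @: (m @: N)| == #|m @: N|.
  rewrite eqn_leq leq_imset_card /=; apply: leq_trans (md_classes md rR) _.
  by have := subset_leq_card sub; rewrite c4.
apply: inj; rewrite ?imset_f ?inE // !cc //; exact: removed_nbr_out rR _.
Qed.

End Colorings.
End Quotient.

Lemma pair_other (T : eqType) (a b u v w : T) :
  u \in [:: a; b] -> v \in [:: a; b] -> w \in [:: a; b] -> u != v -> u != w -> v = w.
Proof. by rewrite !inE; do 3!case/orP=> /eqP ->; rewrite ?eqxx. Qed.

(** * Extending K-changes to the removed vertices *)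

Section Extension.
Variables (V : finType) (e l : rel V) (lam : V -> V -> V -> bool).
Hypotheses (esym : symmetric e) (eirr : irreflexive e) (pd : parity_drawing e l lam).
Variables (R : {set V}) (m cen : V -> V).
Hypothesis md : merge_data e l lam R m cen.
Implicit Types c d : {ffun V -> 'I_5}.

Local Notation eplus := (merged_adj e R m).
Local Notation class_const := (class_const R m).
Local Notation quot_adj := (@quot_adj V e R m).

(* A removed vertex that would block the swap of [K] is first given a color
   outside [a, b]; if it has none, then all its neighbors colored [a] or [b]
   form one class, and it can be swapped together with [K]. *)
Lemma extend_swap c a b K : a != b -> proper_coloring e c -> class_const c ->
  kempe_closed eplus c a b K -> [disjoint K & R] ->
  exists s d, [/\ kempe_path e c s d, proper_coloring e d, class_const d &
    forall x, x \notin R -> d x = kempe_swap c a b K x] /\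
    [/\ forall x, x \notin R -> color_changes s x = (x \in K) &
    forall r, r \in R -> color_changes s r <= 2 * \sum_(y | e r y) (y \in K)].
Proof.
move=> ab pc cc cl KR; have [H1 H2] := kempe_closedP _ _ _ _ _ cl.
have KnR x : x \in K -> x \notin R by move=> xK; rewrite (disjointFr KR xK).
(* The removed vertices that block the swap of [K]. *)
pose T1 := [set r in R | (c r \in [:: a; b]) && [exists y, e r y && (y \in K)]].
pose fr r q := (q \notin [:: a; b]) && [forall y, e r y ==> (c y != q)].
pose R2 := [set r in T1 | [exists q, fr r q]].
pose g r := odflt (c r) [pick q | fr r q].
have gP r : r \in R2 -> fr r (g r).
  rewrite in_set => /andP[_ /existsP[q Hq]]; rewrite /g.
  by case: pickP => [//|/(_ q)]; rewrite Hq.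
have T1P r : r \in T1 -> [/\ r \in R, c r \in [:: a; b] & exists2 y, e r y & y \in K].
  by rewrite in_set => /and3P[rR cr /existsP[y /andP[ery yK]]]; split=> //; exists y.
have R2T r : r \in R2 -> r \in T1 by rewrite in_set => /andP[].
have R2R r : r \in R2 -> r \in R by move/R2T/T1P => [].
have [s1 [p1 c1]] : exists s, kempe_path e c s [ffun x => if x \in R2 then g x else c x] /\
    forall x, color_changes s x <= (x \in R2).
  apply: recolor => // [x y /R2R xR /R2R yR|x y xR2 exy]; first exact: (md_indep md).
  by have /andP[_ /forallP/(_ y)] := gP _ xR2; rewrite exy.
set c' := [ffun _ => _] in p1.
have pc' : proper_coloring e c' by apply: kempe_path_proper p1.
have c'E x : x \notin R -> c' x = c x.
  by move=> xR; rewrite ffunE; case: ifP => // /R2R; rewrite (negPf xR).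
pose K' := K :|: (T1 :\: R2).
have oneclass r x y : r \in T1 -> r \notin R2 -> e r x -> e r y -> x \in K ->
    c y \in [:: a; b] -> y \in K.
  move=> rT; have [rR cr _] := T1P r rT; rewrite in_set rT => nf erx ery xK cy.
  have xR := KnR _ xK; have yR := removed_nbr_out md rR ery.
  have crx := pc _ _ erx; have cry := pc _ _ ery.
  have cxy := pair_other cr (H1 _ xK) cy crx cry.
  case: (few_classes md cc rR) => [[q qr qN]|one]; last first.
    have mxy := one x y erx ery cxy crx.
    by rewrite -(class_closed md cc cl yR) -mxy (class_closed md cc cl xR).
  case/negP: nf; apply/existsP; exists q; apply/andP; split; last first.
    by apply/forallP => z; apply/implyP => /qN.
  apply/negP => qab; have := qN _ erx; rewrite eq_sym in qr.
  by rewrite (pair_other cr (H1 _ xK) qab crx qr) eqxx.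
have cl' : kempe_closed e c' a b K'.
  apply/kempe_closedP; split=> [x|x y].
    rewrite in_setU in_setD => /orP[xK|/andP[xR2 /T1P[xR cx _]]].
      by rewrite c'E ?KnR //; exact: H1.
    by rewrite ffunE (negPf xR2).
  have yRcase : y \in R -> c' y \in [:: a; b] -> (exists2 z, e y z & z \in K) -> y \in K'.
    rewrite ffunE in_setU in_setD => yR; case: ifP => [yR2|yR2] cy [z eyz zK].
      by have /andP[/negP] := gP _ yR2.
    apply/orP; right; rewrite in_set yR cy; apply/existsP; exists z.
    by rewrite eyz.
  rewrite in_setU => /orP[xK|xT] exy cy; have [yR|yR] := boolP (y \in R).
  - by apply: yRcase => //; exists x; rewrite // esym.
  - rewrite in_setU (H2 _ _ xK) //; last by rewrite -c'E.
    by rewrite /merged_adj KnR // yR exy.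
  - have /T1P[xR _ _] : x \in T1 by move: xT; rewrite in_setD => /andP[].
    by have := md_indep md xR yR; rewrite exy.
  - move: xT; rewrite in_setD => /andP[xR2 xT]; have [xR _ [z exz zK]] := T1P _ xT.
    by rewrite in_setU (oneclass _ _ _ xT xR2 exz exy zK) // -c'E.
have K'nR x : x \notin R -> (x \in K') = (x \in K).
  move=> xR; rewrite in_setU in_setD orbC; case: (boolP (x \in T1)) => [/T1P[]|_].
    by rewrite (negPf xR).
  by rewrite andbF.
have dE x : x \notin R -> kempe_swap c' a b K' x = kempe_swap c a b K x.
  by move=> xR; rewrite !kempe_swapE K'nR // c'E.
exists (s1 ++ [:: (a, b, K')]), (kempe_swap c' a b K'); split; split=> //.
- by apply: kempe_path_cat p1 _.
- exact: kempe_swap_proper pc' cl'.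
- move=> x xR; have mxR := md_out md xR; rewrite !dE //.
  by have := class_const_swap md cc cl; apply.
- move=> x xR; rewrite [LHS]count_cat -/(color_changes s1 x) /= addn0 K'nR //.
  have := c1 x; case: (boolP (x \in R2)) => [/R2R|_]; first by rewrite (negPf xR).
  by rewrite leqn0 => /eqP ->.
move=> r rR; rewrite [leqLHS]count_cat -/(color_changes s1 r) /= addn0.
case: (boolP (r \in T1)) => [rT|rT]; last first.
  have rK : r \in K = false by rewrite (disjointFl KR rR).
  have := c1 r; case: (boolP (r \in R2)) => [/R2T|_]; first by rewrite (negPf rT).
  by rewrite leqn0 => /eqP ->; rewrite in_setU in_setD (negPf rT) rK andbF.
have [_ _ [z erz zK]] := T1P _ rT.
(* One change for the recoloring and one for the swap, both charged to the neighbor [z] in [K]. *)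
rewrite mul2n -addnn leq_add //.
  by apply: leq_trans (c1 r) _; rewrite (bigD1 z) //= zK; case: (r \in R2).
by rewrite (bigD1 z) //= zK; case: (r \in K').
Qed.

(** The path in the merged graph ignores what happens on [R], so its coloring [c0] and the actual
    coloring [c] are compared only outside [R]. *)
Lemma extend_path c s d c0 : proper_coloring e c -> class_const c ->
  (forall x, x \notin R -> c0 x = c x) ->
  kempe_path eplus c0 s d -> avoids R s ->
  exists s' d', [/\ kempe_path e c s' d', proper_coloring e d', class_const d' &
    forall x, x \notin R -> d' x = d x] /\
    [/\ forall x, x \notin R -> color_changes s' x = color_changes s x &
    forall r, r \in R -> color_changes s' r <= 2 * \sum_(y | e r y) color_changes s y].
Proof.
elim: s c c0 => [|[[a b] K] s IH] c c0 pc cc c0c /=.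
  by move=> <- _; exists [::], c; split; split=> // x xR; rewrite c0c.
case=> ab cl p av.
have KR : [disjoint K & R] by apply: (av (a, b, K)); rewrite inE eqxx.
have KnR x : x \in K -> x \notin R by move=> xK; rewrite (disjointFr KR xK).
have cl1 : kempe_closed eplus c a b K.
  have [H1 H2] := kempe_closedP _ _ _ _ _ cl.
  apply/kempe_closedP; split=> [x xK|x y xK exy cy]; first by rewrite -c0c ?KnR ?H1.
  by apply: (H2 x y xK exy); case/and3P: exy => _ yR _; rewrite c0c.
have [s1 [d1 [[p1 pc1 cc1 d1E] [n1 r1]]]] := extend_swap ab pc cc cl1 KR.
have [| |s2 [d2 [[p2 pc2 cc2 d2E] [n2 r2]]]] := IH d1 (kempe_swap c0 a b K) pc1 cc1 _ p.
- by move=> x xR; rewrite d1E // !kempe_swapE c0c.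
- by move=> k ks; apply: av; rewrite inE ks orbT.
exists (s1 ++ s2), d2; split; split=> //.
- exact: kempe_path_cat p1 p2.
- by move=> x xR; rewrite [LHS]count_cat; congr (_ + _); [exact: n1 | exact: n2].
move=> r rR; rewrite [leqLHS]count_cat.
apply: leq_trans (leq_add (r1 r rR) (r2 r rR)) _.
by rewrite -mulnDr -big_split /=.
Qed.

Lemma extend_bound c s d c0 n : proper_coloring e c -> class_const c ->
  (forall x, x \notin R -> c0 x = c x) ->
  kempe_path eplus c0 s d -> avoids R s ->
  (forall x, x \notin R -> color_changes s x <= n) ->
  exists d', [/\ reconf e (12 * n) c d', proper_coloring e d', class_const d' &
    forall x, x \notin R -> d' x = d x].
Proof.
move=> pc cc c0c p av bn.
have [s' [d' [[p' pd' cd' d'E] [n' r']]]] := extend_path pc cc c0c p av.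
exists d'; split=> //; exists s' => // x.
have [xR|xR] := boolP (x \in R); last first.
  by rewrite n' //; apply: leq_trans (bn x xR) _; rewrite -{1}[n]mul1n leq_mul2r orbT.
(* Two changes for each change of a neighbor, and at most six neighbors. *)
apply: leq_trans (r' x xR) _; rewrite -[12]/(2 * 6) -mulnA leq_mul2l /=.
apply: (@leq_trans (\sum_(y | e x y) n)).
  by apply: leq_sum => y exy; apply: bn; exact: (removed_nbr_out md xR exy).
rewrite sum_nat_const leq_mul2r; apply/orP; right.
by apply: leq_trans (md_deg md xR); rewrite degE cardsE.
Qed.

Lemma reconf_quot n c d : proper_coloring e c -> proper_coloring e d ->
  class_const c -> class_const d ->
  reconf quot_adj n (quot_col R m c) (quot_col R m d) -> reconf e (12 * n + 1) c d.
Proof.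
move=> pc pd' cc cd /(quot_lift md pc cc)[s [c1 [p cc1 qc1 av bn]]].
have [c2 [r2 pc2 cc2 c2E]] := extend_bound pc cc (fun _ _ => erefl) p av bn.
have c2d x : x \notin R -> c2 x = d x.
  move=> xR; rewrite c2E // -(cc1 x xR) -(cd x xR).
  have [h mx] := class_of md xR.
  by move/ffunP/(_ h): qc1; rewrite !ffunE mx.
apply: reconf_trans r2 _.
(* Outside [R] the target is reached already; recoloring [R] costs the final 1. *)
have [|s3 [p3 b3]] := @recolor _ _ e c2 d R esym eirr (@md_indep _ _ _ _ _ _ _ md) pc2.
  move=> x y xR exy; have yR := removed_nbr_out md xR exy.
  by rewrite c2d // eq_sym; apply: pd'.
exists s3; last by move=> x; apply: leq_trans (b3 x) (leq_b1 _).
congr (kempe_path _ _ _ _): p3; apply/ffunP => x; rewrite ffunE.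
by case: ifPn => // xR; rewrite c2d.
Qed.

(** A removed vertex sees at most four classes, so a coloring of the classes always leaves it one of
    the five colors. *)
Lemma hub_coloring (cq : {ffun quot R m -> 'I_5}) : proper_coloring quot_adj cq ->
  exists2 c, proper_coloring e c & class_const c.
Proof.
move=> pq; pose cW x : 'I_5 := if insub (m x) is Some h then cq h else ord0.
have cWE x h : m x = val h -> cW x = cq h by move=> mx; rewrite /cW mx valK.
have cWm x : cW (m x) = cW x by rewrite /cW (md_idem md).
have free r : r \in R -> exists q, [forall y, e r y ==> (cW y != q)].
  move=> rR; have [/existsP[q Hq]|] := boolP [exists q, [forall y, e r y ==> (cW y != q)]].
    by exists q.
  move/existsPn => H; pose N := [set y | e r y].
  have sub : [set: 'I_5] \subset cW @: (m @: N).
    apply/subsetP => q _; have := H q; rewrite negb_forall => /existsP[x].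
    rewrite negb_imply negbK => /andP[erx /eqP <-]; rewrite -cWm.
    by apply/imset_f/imset_f; rewrite inE.
  have := subset_leq_card sub; rewrite cardsT card_ord => c5.
  have := leq_trans c5 (leq_imset_card _ _) => {}c5.
  by have := leq_trans c5 (md_classes md rR).
pose g r := odflt ord0 [pick q | [forall y, e r y ==> (cW y != q)]].
have gP r y : r \in R -> e r y -> cW y != g r.
  move=> /free[q Hq] ery; rewrite /g; case: pickP => [q' /forallP/(_ y)|/(_ q)]; last by rewrite Hq.
  by rewrite ery.
exists [ffun x => if x \in R then g x else cW x]; last first.
  by move=> x xR; rewrite !ffunE (negPf (md_out md xR)) (negPf xR) cWm.
move=> x y exy; rewrite !ffunE.
case: ifPn => xR; case: ifPn => yR.
- by have := md_indep md xR yR; rewrite exy.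
- by rewrite eq_sym gP.
- by rewrite gP // esym.
have [h mx] := class_of md xR; have [k my] := class_of md yR.
rewrite (cWE _ _ mx) (cWE _ _ my); apply: pq; apply/quot_adjP; split; last by exists x, y.
by apply/eqP => hk; have := md_class_indep md xR yR; rewrite mx my hk exy => /(_ erefl).
Qed.

End Extension.

(** * Building merges one vertex at a time *)

Section MergeConstruction.
Variables (V : finType) (e l : rel V) (lam : V -> V -> V -> bool).
Hypotheses (esym : symmetric e) (eirr : irreflexive e).

Lemma merge_nothing : merge_data e l lam set0 id id.
Proof.
by split=> // x; rewrite ?eqxx ?inE // => y _ _ ->; rewrite eirr.
Qed.

Definition merge_map (m : V -> V) (Q : {set V}) (t : V -> V) x := if x \in Q then t x else m x.

Definition merge_cen (cen : V -> V) (Q : {set V}) v x : V := if x \in Q then v else cen x.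

(** A vertex of [Q] must be alone in its class, but its target may be the root of an older class;
    hence independence is asked against every [y] with [m y = t x]. This permits merging, one after
    the other, two pairs that share a vertex. *)
Lemma merge_extend R m cen v (Q : {set V}) t : merge_data e l lam R m cen ->
  v \notin R -> (forall r, r \in R -> ~~ e v r) ->
  (forall x, x \in Q -> [/\ e v x, e v (t x), m x = x & m (t x) = t x]) ->
  (forall x, x \in Q -> t x \notin Q) ->
  (forall x y, x \in Q -> m y = x -> y = x) ->
  (forall x y, x \in Q -> y \in Q -> t x != t y -> chi l lam v x (t x) y (t y) = false) ->
  (forall x y, x \in Q -> y \in Q -> t x = t y -> ~~ e x y) ->
  (forall x y, x \in Q -> m y = t x -> ~~ e x y) ->
  deg e v <= 6 -> #|merge_map m Q t @: [set y | e v y]| <= 4 ->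
  merge_data e l lam (v |: R) (merge_map m Q t) (merge_cen cen Q v).
Proof.
move=> md vR vN H1 H2 H3 nc ind1 ind2 degv cls.
have mv : m v = v.
  apply/eqP; apply/negPn/negP => mv; have [cR ecv _] := md_cen md mv.
  by have := vN _ cR; rewrite esym ecv.
have nv x : e v x -> x \notin v |: R.
  move=> evx; rewrite in_setU1 negb_or; apply/andP; split.
    by apply: contraTneq evx => ->; rewrite eirr.
  by apply: contraTN evx => /vN.
have mxv x : m x = v -> x = v.
  move=> mx; apply/eqP; apply/negPn/negP => xv.
  have mxx : m x != x by rewrite mx eq_sym.
  by have [cR _] := md_cen md mxx; rewrite mx esym => H; have := vN _ cR; rewrite H.
have mQ x : x \notin Q -> m x \notin Q.
  by move=> xQ; apply/negP => mQ; have := H3 _ x mQ erefl => xE; rewrite -xE (negPf xQ) in mQ.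
have mm x : merge_map m Q t (m x) = merge_map m Q t x.
  rewrite /merge_map; case: (boolP (x \in Q)) => xQ.
    by have [_ _ -> _] := H1 x xQ; rewrite xQ.
  by rewrite (negPf (mQ _ xQ)) (md_idem md).
split.
- move=> x; rewrite /merge_map; case: ifP => [xQ _|xQ].
    by have [_ evt _ _] := H1 x xQ; apply: nv.
  rewrite !in_setU1 !negb_or => /andP[xv xR]; rewrite (md_out md) // andbT.
  by apply: contra xv => /eqP/mxv ->.
- move=> x xR; rewrite /merge_map; case: ifP => [xQ|_].
    by have [/nv] := H1 x xQ; rewrite xR.
  by move: xR; rewrite in_setU1 => /orP[/eqP ->|/(md_removed md)].
- move=> x; rewrite /merge_map; have [xQ|xQ] := boolP (x \in Q).
    by rewrite (negPf (H2 _ xQ)); have [] := H1 x xQ.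
  by rewrite (negPf (mQ _ xQ)) (md_idem md).
- move=> x; rewrite /merge_map /merge_cen; case: ifP => xQ.
    by have [evx evt _ _] := H1 x xQ; rewrite setU11.
  by move/(md_cen md) => [cR e1 e2]; rewrite in_setU1 cR orbT.
- move=> x y; rewrite /merge_map /merge_cen; case: ifP => xQ; case: ifP => yQ.
  + by move=> _ _ txy _; apply: nc.
  + move=> _ /(md_cen md)[cR _ _] _ vc; by rewrite vc cR in vR.
  + move=> /(md_cen md)[cR _ _] _ _ vc; by rewrite -vc cR in vR.
  + exact: (md_noncross md).
- move=> x y; rewrite !in_setU1 !negb_or => /andP[xv xR] /andP[yv yR].
  rewrite /merge_map; case: ifP => xQ; case: ifP => yQ.
  + exact: ind1.
  + by move=> txy; apply: ind2.
  + by move=> mxt; rewrite esym; apply: ind2.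
  + exact: (md_class_indep md).
- move=> x y; rewrite !in_setU1 => /orP[/eqP ->|xR] /orP[/eqP ->|yR].
  + by rewrite eirr.
  + exact: vN.
  + by rewrite esym; apply: vN.
  + exact: (md_indep md).
- move=> r; rewrite in_setU1 => /orP[/eqP -> //|rR].
  have -> : merge_map m Q t @: [set y | e r y] = merge_map m Q t @: (m @: [set y | e r y]).
    by rewrite -imset_comp; apply: eq_imset => x /=; rewrite mm.
  exact: leq_trans (leq_imset_card _ _) (md_classes md rR).
- by move=> r; rewrite in_setU1 => /orP[/eqP -> //|/(md_deg md)].
Qed.

Lemma merge_extend_low R m cen v : merge_data e l lam R m cen ->
  v \notin R -> (forall r, r \in R -> ~~ e v r) -> deg e v <= 4 ->
  merge_data e l lam (v |: R) m cen.
Proof.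
move=> md vR vN d4.
have E : merge_map m set0 id =1 m by move=> x; rewrite /merge_map in_set0.
have E' : merge_cen cen set0 v =1 cen by move=> x; rewrite /merge_cen in_set0.
have := @merge_extend R m cen v set0 id md vR vN.
move=> H; have {H} : merge_data e l lam (v |: R) (merge_map m set0 id) (merge_cen cen set0 v).
  apply: H => // [x|x|x y|x y|x y|x y| |]; rewrite ?in_set0 //; first exact: leq_trans d4 _.
  by apply: leq_trans (leq_imset_card _ _) _; rewrite -degE.
case=> h1 h2 h3 h4 h5 h6 h7 h8 h9; split=> //.
- by move=> x /h1; rewrite E.
- by move=> x /h2; rewrite E.
- by move=> x; have := h3 x; rewrite !E.
- by move=> x; have := h4 x; rewrite !E E'.
- by move=> x y; have := h5 x y; rewrite !E !E'.
- by move=> x y; have := h6 x y; rewrite !E.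
- by move=> r /h8; rewrite (eq_imset _ E).
Qed.

Lemma merge_extend_pair R m cen v x y : merge_data e l lam R m cen ->
  v \notin R -> (forall r, r \in R -> ~~ e v r) -> deg e v <= 5 ->
  e v x -> e v y -> x != y -> m x = x -> m y = y ->
  (forall z, m z = x -> z = x) -> (forall z, m z = y -> ~~ e x z) ->
  merge_data e l lam (v |: R) (merge_map m [set x] (fun=> y)) (merge_cen cen [set x] v).
Proof.
move=> md vR vN d5 vx vy xy mx my px ny.
apply: merge_extend => //.
- by move=> z /set1P ->.
- by move=> z _; rewrite in_set1 eq_sym.
- by move=> z w /set1P -> /px.
- by move=> z w _ _; rewrite eqxx.
- by move=> z w /set1P -> /set1P -> _; rewrite eirr.
- by move=> z w /set1P -> /ny.
- exact: leq_trans d5 _.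
have sub : merge_map m [set x] (fun=> y) @: [set z | e v z]
    \subset m @: ([set z | e v z] :\ x).
  apply/subsetP => z /imsetP[w]; rewrite inE => vw ->; rewrite /merge_map in_set1.
  case: eqP => [_|/eqP wx]; first by rewrite -my imset_f // !inE eq_sym xy.
  by rewrite imset_f // !inE wx.
apply: leq_trans (subset_leq_card sub) _; apply: leq_trans (leq_imset_card _ _) _.
have := cardsD1 x [set z | e v z]; rewrite inE vx -degE; move: d5; lia.
Qed.

End MergeConstruction.

Lemma exists_low_degree (V : finType) (e : rel V) : symmetric e -> irreflexive e ->
  planar_like e -> 0 < #|V| -> exists v, deg e v <= 5.
Proof.
move=> esym eirr pl V0; apply/existsP; apply: contraT; rewrite negb_exists => /forallP H.
have big : 6 * #|V| <= degsum e.
  rewrite mulnC -sum_nat_const; apply: leq_sum => v _.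
  by have := H v; rewrite -ltnNge.
have [V3|V3] := leqP 3 #|V|.
  by have := planar_like_degsum esym eirr pl V3; move: big; lia.
by have := degsum_le_complete eirr; move: big V3 V0; case: #|V| => [|[|[|n]]] //; lia.
Qed.

(** The classical argument by identification: a vertex of degree five has two nonadjacent neighbors,
    for otherwise it would lie in a K_5; they are merged and the vertex removed. *)
Lemma five_colorable (V : finType) (e : rel V) : symmetric e -> irreflexive e ->
  planar_like e -> exists c : {ffun V -> 'I_5}, proper_coloring e c.
Proof.
have [n] := ubnP #|V|; elim: n => // n IH in V e * => ltV esym eirr pl.
have [V0|V0] := posnP #|V|.
  by exists [ffun=> ord0] => x; have := card0_eq V0 x; rewrite inE.
have [v dv] := exists_low_degree esym eirr pl V0.
have [l [lam pd]] := pl.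
have go m cen : merge_data e l lam [set v] m cen ->
    exists c : {ffun V -> 'I_5}, proper_coloring e c.
  move=> md; have [||||cq pq] := IH _ (@quot_adj V e [set v] m).
  - by rewrite ltnS in ltV; apply: leq_trans ltV; have := card_quot [set v] m; rewrite cards1 addn1.
  - exact: quot_adj_sym.
  - exact: quot_adj_irr.
  - exact: quot_planar_like md.
  have [c pc _] := hub_coloring esym md pq.
  by exists c.
have m0 := merge_nothing l lam eirr.
have [d4|d4] := leqP (deg e v) 4.
  apply: (go id id); rewrite -[[set v]]setU0.
  by apply: merge_extend_low => // [|r]; rewrite in_set0.
have [[x y] /= /and4P[vx vy xy nxy]|none] := pickP (fun p : V * V =>
    [&& e v p.1, e v p.2, p.1 != p.2 & ~~ e p.1 p.2]).
  apply: (go (merge_map id [set x] (fun=> y)) (merge_cen id [set x] v)).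
  rewrite -[[set v]]setU0; apply: merge_extend_pair => // [|r|z ->] //; rewrite in_set0 //.
have adj x y : e v x -> e v y -> x != y -> e x y.
  by move=> vx vy xy; have := none (x, y); rewrite /= vx vy xy /= => /negbFE.
have : exists s, [/\ uniq s, size s = 4 & all (e v) s].
  exists (take 4 (enum [set z | e v z])); split.
  - by rewrite take_uniq ?enum_uniq.
  - by rewrite size_takel // -cardE -degE ltnW.
  - by apply/allP => z /mem_take; rewrite mem_enum inE.
case=> s [us s4 vs]; case: (@no_K5 V e esym pl v (nth v s 0) (nth v s 1) (nth v s 2) (nth v s 3)).
  case: s us s4 vs => [|a [|b [|c [|d [|//]]]]] //= us _ /and5P[va vb vc vd _].
  rewrite us andbT !inE !negb_or; apply/and4P.
  by split; apply: contraTneq isT => vE; [move: va|move: vb|move: vc|move: vd]; rewrite -vE eirr.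
case: s us s4 vs => [|a [|b [|c [|d [|//]]]]] //=; rewrite !inE !negb_or -!andbA.
case/and5P=> ab ac ad bc /and3P[bd cd _] _ /and5P[va vb vc vd _].
by rewrite va vb vc vd (adj a b) // (adj a c) // (adj a d) // (adj b c) // (adj b d) // (adj c d).
Qed.

(** * Kempe games at a vertex of degree five or six *)

Section Tournament.
Variable V : eqType.
Implicit Types (T : V -> V -> bool) (x y p r q s : V).

Definition chiT T x y z w : bool := (T x z (+) T x w) (+) (T y z (+) T y w).

(** The crossing pattern won by a swap at [q] or at [s]; see [reach_ucond]. *)
Definition ucond T x y p r q s : bool :=
  [&& chiT T s x q p, chiT T s y q p, chiT T s y q r & ~~ chiT T y s p r].

Definition ucond4 T x y p r q s : bool :=
  [|| ucond T x y p r q s, ucond T y x p r q s, ucond T x y r p q s | ucond T y x r p q s].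

(* Positions of the pairs [x y], [p r] and the vertices [q], [s] from which one
   Kempe change suffices. *)
Definition nonstuck T x y p r q s : bool :=
  [|| ~~ chiT T x y q s, ~~ chiT T p r q s, ucond4 T x y p r q s | ucond4 T x y p r s q].

(** The premise is a stuck position, normalized by the naming of [x], [y] and of [p], [r]. The
    conclusion collects what [reach_escape] needs: the positions after either of two moves are not
    stuck, and three crossing values settle the cases that end at once. *)
Definition escape T x y p r q s : bool :=
  [&& chiT T x y p r, chiT T x y q s, chiT T p r q s, ~~ chiT T x y p q,
      ~~ chiT T p r q x & ~~ nonstuck T x y p r q s] ==>
  [&& nonstuck T x y q r p s, nonstuck T x s p r y q, chiT T s x q r,
      ~~ chiT T x y q p & ~~ chiT T y s p r].

Lemma chiT_gauge T T' (g : V -> bool) x y z w :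
  (forall a b, T' a b = T a b (+) (g a (+) g b)) -> chiT T' x y z w = chiT T x y z w.
Proof. by move=> E; rewrite /chiT !E; xor_tauto. Qed.

(* By [chiT_gauge] one may assume that [T x] vanishes; this leaves the values of
   [T] on the ten pairs of other vertices. *)
Lemma escapeT T x y p r q s : uniq [:: x; y; p; r; q; s] ->
  {in [:: x; y; p; r; q; s] &, forall a b, a != b -> T a b = ~~ T b a} ->
  escape T x y p r q s.
Proof.
move=> U anti; pose g a := if a == x then false else T x a.
pose T' a b := T a b (+) (g a (+) g b).
have E a b c d : chiT T a b c d = chiT T' a b c d.
  by rewrite -(@chiT_gauge T T' g).
have ET : escape T x y p r q s = escape T' x y p r q s.
  by rewrite /escape /nonstuck /ucond4 /ucond !E.
have Tx a : x != a -> T' x a = false.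
  by move=> xa; rewrite /T' /g eqxx eq_sym (negPf xa); xor_tauto.
have [xin yin pin rin qin] : [/\ x \in [:: x; y; p; r; q; s], y \in [:: x; y; p; r; q; s],
    p \in [:: x; y; p; r; q; s], r \in [:: x; y; p; r; q; s] & q \in [:: x; y; p; r; q; s]].
  by split; rewrite !inE eqxx ?orbT.
have sin : s \in [:: x; y; p; r; q; s] by rewrite !inE eqxx !orbT.
have {}anti a b : a \in [:: x; y; p; r; q; s] -> b \in [:: x; y; p; r; q; s] -> a != b ->
    T' a b = ~~ T' b a.
  by move=> ain bin ab; rewrite /T' (anti a b ain bin ab); xor_tauto.
move: U; rewrite /= !inE !negb_or -!andbA.
case/and5P=> xy xp xr xq /and5P[xs yp yr yq /and5P[ys pr pq ps /and4P[rq rs qs _]]].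
rewrite ET /escape /nonstuck /ucond4 /ucond /chiT.
have X a : a \in [:: x; y; p; r; q; s] -> x != a -> T' a x = true.
  by move=> ain xa; rewrite anti 1?eq_sym // Tx.
rewrite !(X y, X p, X r, X q, X s) // !(Tx y, Tx p, Tx r, Tx q, Tx s) //.
rewrite (anti _ _ yin pin yp) (anti _ _ yin rin yr) (anti _ _ yin qin yq) (anti _ _ yin sin ys).
rewrite (anti _ _ pin rin pr) (anti _ _ pin qin pq) (anti _ _ pin sin ps) (anti _ _ rin qin rq).
rewrite (anti _ _ rin sin rs) (anti _ _ qin sin qs).
clear; move: (T' p y) (T' r y) (T' q y) (T' s y) (T' r p) (T' q p) (T' s p) (T' q r) (T' s r) (T' s q).
by do 10!case.
Qed.

End Tournament.

Section Game.
Variables (V : finType) (L l : rel V) (lam : V -> V -> V -> bool) (R : {set V}) (v : V).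
Hypotheses (Lsym : symmetric L) (pd : parity_drawing L l lam).
Hypothesis LR : forall x y, L x y -> y \notin R.
Implicit Types c d : {ffun V -> 'I_5}.

Local Notation chi := (chi l lam v).

Lemma chi_sets (A B : {set V}) x y z w : [disjoint A & B] -> v \notin A -> v \notin B ->
  L v x -> L v y -> L v z -> L v w -> x \in A -> z \in B ->
  connect [rel a b | [&& a \in A, b \in A & L a b]] x y ->
  connect [rel a b | [&& a \in B, b \in B & L a b]] z w -> chi x y z w = false.
Proof.
move=> AB vA vB vx vy vz vw xA zB /connectP[p pp py] /connectP[q qq qw].
have sub (C : {set V}) a p' : a \in C ->
    path [rel a b | [&& a \in C, b \in C & L a b]] a p' ->
    path L a p' /\ {subset a :: p' <= C}.
  elim: p' a => [|b p' IH] a aC /=; first by split=> // u; rewrite inE => /eqP->.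
  case/andP=> /and3P[_ bC Lab] /(IH b bC)[pp' sub]; rewrite Lab pp'; split=> // u.
  by rewrite inE => /orP[/eqP -> //|/sub].
have [ppL pA] := sub _ _ _ xA pp; have [qqL qB] := sub _ _ _ zB qq.
apply: (chi_path pd vx vy vz vw ppL (esym py) qqL (esym qw)).
- by apply: contra vA => /pA.
- by apply: contra vB => /qB.
apply/hasPn => u /qB uB; apply/negP => /pA uA.
by rewrite (disjointFr AB uA) in uB.
Qed.

Local Notation linked c a b x y := (y \in chain L c a b x).

Lemma linkedC c a b x y : linked c a b x y = linked c a b y x.
Proof. exact: chainC. Qed.

Lemma chi_chains c a b a' b' x y z w : c x \in [:: a; b] -> c z \in [:: a'; b'] ->
  c v \notin [:: a; b] -> c v \notin [:: a'; b'] ->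
  L v x -> L v y -> L v z -> L v w ->
  [disjoint chain L c a b x & chain L c a' b' z] ->
  linked c a b x y -> linked c a' b' z w -> chi x y z w = false.
Proof.
move=> cx cz cv cv' vx vy vz vw dis xy zw.
apply: (chi_sets dis) => //; try exact: chain_refl; try exact: chain_connect.
  by apply: contra cv => /(chain_color cx).
by apply: contra cv' => /(chain_color cz).
Qed.

Lemma chi_linked c a b a' b' x y z w : c x \in [:: a; b] -> c z \in [:: a'; b'] ->
  c v \notin [:: a; b] -> c v \notin [:: a'; b'] ->
  L v x -> L v y -> L v z -> L v w -> a \notin [:: a'; b'] -> b \notin [:: a'; b'] ->
  linked c a b x y -> linked c a' b' z w -> chi x y z w = false.
Proof.
move=> cx cz cv cv' vx vy vz vw aN bN; apply: chi_chains => //.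
rewrite disjoint_subset; apply/subsetP => u /(chain_color cx) cu.
apply/negP => /(chain_color cz); apply/negP.
by move: cu; rewrite !in_cons in_nil orbF => /orP[] /eqP ->; rewrite -[_ || _]/(_ \in [:: a'; b']).
Qed.

Lemma chi_linked_same c a b x y z w : c x \in [:: a; b] -> c z \in [:: a; b] ->
  c v \notin [:: a; b] -> L v x -> L v y -> L v z -> L v w ->
  linked c a b x y -> linked c a b z w -> ~~ linked c a b x z -> chi x y z w = false.
Proof.
move=> cx cz cv vx vy vz vw xy zw xz; apply: chi_chains xy zw => //.
rewrite disjoint_subset; apply/subsetP => u xu; apply/negP => zu.
by case/negP: xz; apply: chain_trans xu _; rewrite chainC.
Qed.

Definition reach n c (P : {ffun V -> 'I_5} -> Prop) : Prop :=
  exists s d, [/\ kempe_path L c s d, size s <= n, avoids R s & P d].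

Lemma reach_now n c (P : _ -> Prop) : P c -> reach n c P.
Proof. by exists [::], c. Qed.

Lemma reach_leq m n c P : m <= n -> reach m c P -> reach n c P.
Proof. by move=> mn [s [d [p ss av Pd]]]; exists s, d; split=> //; apply: leq_trans mn. Qed.

Lemma reach_swap n c a b x P : a != b -> c x \in [:: a; b] -> L v x ->
  reach n (kempe_swap c a b (chain L c a b x)) P -> reach n.+1 c P.
Proof.
move=> ab cx vx [s [d [p ss av Pd]]].
exists ((a, b, chain L c a b x) :: s), d; split=> //; first by split=> //; apply: chain_closed.
move=> K; rewrite inE => /orP[/eqP -> /=|]; last exact: av.
(* The chain starts next to [v] and no step of [L] enters [R], so it avoids [R]. *)
rewrite disjoint_subset; apply/subsetP => u; rewrite inE => /connectP[q qq ->].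
apply/negP; apply/negP; case/lastP: q qq => [_|q w]; first exact: LR vx.
by rewrite rcons_path last_rcons => /andP[_ /and3P[_ _ /LR]].
Qed.

Definition swap_at c a b x := kempe_swap c a b (chain L c a b x).

Lemma swap_at_self c a b x : swap_at c a b x x = tperm a b (c x).
Proof. by rewrite kempe_swapE chain_refl. Qed.

Lemma swap_at_linked c a b x y : linked c a b x y -> swap_at c a b x y = tperm a b (c y).
Proof. by rewrite kempe_swapE => ->. Qed.

Lemma swap_at_unlinked c a b x y : ~~ linked c a b x y -> swap_at c a b x y = c y.
Proof. by rewrite kempe_swapE => /negPf ->. Qed.

Lemma swap_at_other c a b x y : c x \in [:: a; b] -> c y \notin [:: a; b] ->
  swap_at c a b x y = c y.
Proof.
by move=> cx cy; apply: swap_at_unlinked; apply: contra cy => /(chain_color cx).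
Qed.

Section Targets.
Variable Q : pred V.

Definition mono_pair c := exists x y, [/\ Q x, Q y, x != y & c x = c y].

(** Six marked neighbors must lose two classes: either three of them become one, or two pairs that
    do not interleave around [v] become two. *)
Definition mono_merge c :=
  (exists x y z, [/\ uniq [:: x; y; z], all Q [:: x; y; z], c x = c y & c x = c z]) \/
  (exists x y z w, [/\ uniq [:: x; y; z; w], all Q [:: x; y; z; w], c x = c y,
    c z = c w & chi x y z w = false]).

(** Kempe's argument. If the four colors differ, some pairing interleaves by [chi_sum]; its two
    pairs use disjoint color sets, so they cannot both be linked, and a swap at an unlinked one
    makes it monochromatic. *)
Lemma reach_mono_pair c x y z w : uniq [:: v; x; y; z; w] -> all Q [:: x; y; z; w] ->
  all (L v) [:: x; y; z; w] -> all (fun u => c u != c v) [:: x; y; z; w] ->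
  reach 1 c mono_pair.
Proof.
move=> U /and5P[Qx Qy Qz Qw _] /and5P[vx vy vz vw _] /and5P[cx cy cz cw _].
have now p q : Q p -> Q q -> p != q -> c p = c q -> reach 1 c mono_pair.
  by move=> *; apply: reach_now; exists p, q.
have pairing p q r s : uniq [:: p; q; r; s] -> Q p -> Q q -> Q r -> Q s ->
    L v p -> L v q -> L v r -> L v s -> c p != c v -> c q != c v -> c r != c v -> c s != c v ->
    c p \notin [:: c r; c s] -> c q \notin [:: c r; c s] -> c p != c q -> c r != c s ->
    chi p q r s -> reach 1 c mono_pair.
  move=> U4 Qp Qq Qr Qs vp vq vr vs cp cq cr cs cprs cqrs cpq crs X.
  move: U4; rewrite /= !inE !negb_or => /and4P[/and3P[pq pr ps] /andP[qr qs] rs _].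
  have cv1 : c v \notin [:: c p; c q] by rewrite !inE negb_or eq_sym cp eq_sym cq.
  have cv2 : c v \notin [:: c r; c s] by rewrite !inE negb_or eq_sym cr eq_sym cs.
  have sw u u' : Q u -> Q u' -> u != u' -> L v u -> c u != c u' -> ~~ linked c (c u) (c u') u u' ->
      reach 1 c mono_pair.
    move=> Qu Qu' uu' vu cuu' nl; apply: (@reach_swap 0 c (c u) (c u') u) => //.
      by rewrite !inE eqxx.
    apply: reach_now; exists u, u'; split=> //.
    by rewrite -/(swap_at _ _ _ _) swap_at_self tpermL swap_at_unlinked.
  have [l1|] := boolP (linked c (c p) (c q) p q); last exact: sw.
  have [l2|] := boolP (linked c (c r) (c s) r s); last exact: sw.
  by rewrite (chi_linked (mem_head _ _) (mem_head _ _) cv1 cv2 vp vq vr vs cprs cqrs l1 l2) in X.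
move: (U); rewrite /= !inE !negb_or -!andbA.
case/and5P=> nvx nvy nvz nvw /and5P[xy xz xw yz /and3P[yw zw _]].
have [E|cxy] := eqVneq (c x) (c y); first exact: (now _ _ Qx Qy xy E).
have [E|cxz] := eqVneq (c x) (c z); first exact: (now _ _ Qx Qz xz E).
have [E|cxw] := eqVneq (c x) (c w); first exact: (now _ _ Qx Qw xw E).
have [E|cyz] := eqVneq (c y) (c z); first exact: (now _ _ Qy Qz yz E).
have [E|cyw] := eqVneq (c y) (c w); first exact: (now _ _ Qy Qw yw E).
have [E|czw] := eqVneq (c z) (c w); first exact: (now _ _ Qz Qw zw E).
have N := (cxy, cxz, cxw, cyz, cyw, czw).
have N' : (c y != c x) * (c z != c x) * (c w != c x) * (c z != c y) * (c w != c y) * (c w != c z).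
  by rewrite ![c y == _]eq_sym ![c z == _]eq_sym ![c w == _]eq_sym !N.
have M := (xy, xz, xw, yz, yw, zw).
have M' : (y != x) * (z != x) * (w != x) * (z != y) * (w != y) * (w != z).
  by rewrite ![y == _]eq_sym ![z == _]eq_sym ![w == _]eq_sym !M.
have := chi_sum pd U; case X1: (chi x y z w).
  by move=> _; apply: (pairing x y z w); rewrite //= ?inE ?negb_or ?N ?N' ?M ?M'.
case X2: (chi x z y w).
  by move=> _; apply: (pairing x z y w); rewrite //= ?inE ?negb_or ?N ?N' ?M ?M'.
move=> X3.
by apply: (pairing x w y z); rewrite //= ?inE ?negb_or ?N ?N' ?M ?M'.
Qed.

End Targets.
End Game.

(** * The game around a vertex with six marked neighbors *)

Section Game6.
Variables (V : finType) (L l : rel V) (lam : V -> V -> V -> bool) (R : {set V}) (v : V).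
Hypotheses (Lsym : symmetric L) (pd : parity_drawing L l lam).
Hypothesis LR : forall x y, L x y -> y \notin R.
Variable Q : pred V.
Implicit Types c d : {ffun V -> 'I_5}.

Local Notation chi := (chi l lam v).
Local Notation linked c a b x y := (y \in chain L c a b x).
Local Notation goal := (mono_merge l lam v Q).
Local Notation reach n c := (reach L R n c goal).

Record position c (s : seq V) : Prop := Position {
  pos_uniq : uniq (v :: s);
  pos_Q : all Q s;
  pos_adj : all (L v) s;
  pos_col : all (fun u => c u != c v) s
}.

Lemma uniq_pick (T : eqType) (x0 : T) (idx : seq nat) (s t : seq T) : uniq s ->
  t = [seq nth x0 s i | i <- idx] -> uniq idx -> all (fun i => i < size s) idx -> uniq t.
Proof.
move=> Us -> Ui /allP idxs; rewrite map_inj_in_uniq // => i j /idxs si /idxs sj /eqP.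
by rewrite nth_uniq // => /eqP.
Qed.

Lemma uniq4_neq (T : eqType) (a b c d : T) : uniq [:: a; b; c; d] ->
  ((a != b) * (a != c) * (a != d) * (b != c) * (b != d) * (c != d)) *
  ((b != a) * (c != a) * (d != a) * (c != b) * (d != b) * (d != c)).
Proof.
rewrite /= !inE !negb_or -!andbA => /and5P[ab ac ad bc /and3P[bd cd _]].
rewrite ![b == a]eq_sym ![c == a]eq_sym ![d == a]eq_sym ![c == b]eq_sym ![d == b]eq_sym.
by rewrite ![d == c]eq_sym ab ac ad bc bd cd.
Qed.

(* [t] lists the entries of [v :: s] with the positive indices [idx]. *)
Lemma position_pick (idx : seq nat) c s t : position c s ->
  t = [seq nth v (v :: s) i | i <- idx] -> uniq idx -> all (fun i => 0 < i < size (v :: s)) idx ->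
  position c t.
Proof.
move=> [U q a k] E Ui bi; have sub : {subset t <= s}.
  rewrite E => u /mapP[[|i] /(allP bi) //= si ->]; exact: mem_nth.
split; try by apply/allP => u /sub; first [apply: (allP q) | apply: (allP a) | apply: (allP k)].
apply: (uniq_pick (x0 := v) (idx := 0 :: idx) U); first by rewrite /= E.
  by rewrite /= Ui andbT; apply/negP => /(allP bi).
by rewrite /=; apply/allP => i /(allP bi) /andP[].
Qed.

Lemma position_perm c s s' : perm_eq s s' -> position c s -> position c s'.
Proof.
move=> P [U q a k]; split; rewrite -?(perm_all _ P) //.
have P' : perm_eq (v :: s) (v :: s') by rewrite perm_cons.
by rewrite -(perm_uniq P').
Qed.

Lemma position_swap c s x a b : position c s -> c x \in [:: a; b] ->
  c v \notin [:: a; b] -> position (swap_at L c a b x) s.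
Proof.
case=> U q ad k cx cv; split=> //; apply/allP => u us.
rewrite (@swap_at_other _ L _ _ _ _ _ cx cv) /swap_at kempe_swapE; case: ifP => _; last exact: (allP k).
apply: contraNneq (allP k u us) => E.
have cuN : c u \notin [:: a; b] by rewrite -tperm_pair E.
move: E cuN; rewrite !inE !negb_or => + /andP[ua ub].
by rewrite tpermD 1?eq_sym // => ->.
Qed.

Lemma goal3 c s x y z : position c s -> uniq [:: x; y; z] -> {subset [:: x; y; z] <= s} ->
  c x = c y -> c x = c z -> goal c.
Proof.
move=> P U sub xy xz; left; exists x, y, z; split=> //.
by apply/allP => u /sub; apply: (allP (pos_Q P)).
Qed.

Lemma goal22 c s x y z w : position c s -> uniq [:: x; y; z; w] ->
  {subset [:: x; y; z; w] <= s} ->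
  c x = c y -> c z = c w -> chi x y z w = false -> goal c.
Proof.
move=> P U sub xy zw X; right; exists x, y, z, w; split=> //.
by apply/allP => u /sub; apply: (allP (pos_Q P)).
Qed.

Ltac sub_tac := by let u := fresh in move=> u; rewrite !inE;
  repeat (case/orP; [move/eqP-> | ]); try move/eqP->; rewrite ?eqxx ?orbT.

Ltac uniq_tac U idx := exact (uniq_pick (x0 := v) (idx := idx) U erefl isT isT).
Ltac ucol_tac U idx := exact (uniq_pick (x0 := ord0) (idx := idx) U erefl isT isT).
Ltac pos_tac P idx := exact (position_pick (idx := idx) P erefl isT isT).

Lemma reach_step n c s x b : position c s -> x \in s -> b != c x -> b != c v ->
  reach n (swap_at L c (c x) b x) -> reach n.+1 c.
Proof.
move=> P xs bx bv; apply: (reach_swap LR (v := v)); rewrite ?mem_head //.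
  by rewrite eq_sym.
by move/allP: (pos_adj P); apply.
Qed.

Section Position.
Variables (c : {ffun V -> 'I_5}) (s : seq V).
Hypothesis P : position c s.

Lemma free_pair x b : x \in s -> b != c v -> c v \notin [:: c x; b].
Proof.
by move=> xs bv; rewrite !inE negb_or eq_sym (allP (pos_col P)) // eq_sym bv.
Qed.

Lemma position_step x b : x \in s -> b != c v -> position (swap_at L c (c x) b x) s.
Proof. by move=> xs bv; apply: position_swap P (mem_head _ _) (free_pair xs bv). Qed.

Lemma pos_neq x : x \in s -> c x != c v.
Proof. exact: (allP (pos_col P)). Qed.

Lemma chi_linked2 x y z w (b b' : 'I_5) : {subset [:: x; y; z; w] <= s} -> b != c v -> b' != c v ->
  c x \notin [:: c z; b'] -> b \notin [:: c z; b'] ->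
  linked c (c x) b x y -> linked c (c z) b' z w -> chi x y z w = false.
Proof.
move=> sub bv dv xN bN.
have S u : u \in [:: x; y; z; w] -> L v u by move=> /sub; apply: (allP (pos_adj P)).
apply: (chi_linked pd) => //; rewrite ?mem_head //; try (by apply: S; rewrite !inE eqxx ?orbT);
  by apply: free_pair => //; apply: sub; rewrite !inE eqxx ?orbT.
Qed.

End Position.

(** If [r] is linked to neither [x] nor [y], its swap gives three equal colors. Otherwise that link
    separates [q] from [s], and a swap at [q] pairs them; the two assumed crossings cancel, so [q s]
    does not interleave with [x y]. *)
Lemma reach_triple c x y q r s :
  position c [:: x; y; q; r; s] -> c x = c y -> uniq [:: c x; c q; c r; c s] ->
  chi x r q s -> chi y r q s -> reach 1 c.
Proof.
move=> P cxy Uc X Y; have U := pos_uniq P.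
have N : [/\ c x != c q, c x != c r, c x != c s, c q != c r & c q != c s /\ c r != c s].
  by move: Uc; rewrite /= !inE !negb_or -!andbA => /and5P[? ? ? ? /and3P[]].
case: N => xq xr xs qr [qs rs].
have [xl|xl] := boolP (linked c (c r) (c x) r x || linked c (c r) (c x) r y).
  have qsl : ~~ linked c (c q) (c s) q s.
    apply/negP => qsl.
    case/orP: xl => xl.
      rewrite -chiCl (chi_linked2 P _ _ _ _ _ xl qsl) // in X; first sub_tac.
      - by apply: (pos_neq P); rewrite mem_head.
      - by apply: (pos_neq P); rewrite !inE eqxx !orbT.
      - by rewrite !inE negb_or eq_sym qr rs.
      - by rewrite !inE negb_or xq xs.
    rewrite -chiCl (chi_linked2 P _ _ _ _ _ xl qsl) // in Y; first sub_tac.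
    - by apply: (pos_neq P); rewrite mem_head.
    - by apply: (pos_neq P); rewrite !inE eqxx !orbT.
    - by rewrite !inE negb_or eq_sym qr rs.
    - by rewrite !inE negb_or xq xs.
  have qin : q \in [:: x; y; q; r; s] by rewrite !inE eqxx !orbT.
  have sv : c s != c v by apply: (pos_neq P); rewrite !inE eqxx !orbT.
  apply: (reach_step P qin _ sv); first by rewrite eq_sym.
  apply: reach_now; apply: (@goal22 _ _ x y q s (position_step P qin sv)).
  - uniq_tac U [:: 1; 2; 3; 5].
  - sub_tac.
  - by rewrite !swap_at_other ?mem_head // -?cxy !inE negb_or xq xs.
  - by rewrite swap_at_self tpermL swap_at_unlinked.
  by rewrite -(chi_add l lam v x r y q s) X (chiCl l lam v y r) Y.
have rin : r \in [:: x; y; q; r; s] by rewrite !inE eqxx !orbT.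
have xv : c x != c v by apply: (pos_neq P); rewrite mem_head.
move: xl; rewrite negb_or => /andP[xl yl].
apply: (reach_step P rin xr xv); apply: reach_now.
apply: (@goal3 _ _ x y r (position_step P rin xv)).
- uniq_tac U [:: 1; 2; 4].
- sub_tac.
- by rewrite !swap_at_unlinked.
- by rewrite swap_at_self tpermL swap_at_unlinked.
Qed.

(* The link between [z] and [w] separates [x] from [y] and [p] from [r]. *)
Lemma reach_linked c x y p r z w b :
  position c [:: x; y; p; r; z; w] -> c x = c y -> c p = c r -> c x != c p ->
  b != c v -> c x \notin [:: c z; b] -> c p \notin [:: c z; b] ->
  linked c (c z) b z w -> chi x y z w -> chi p r z w -> chi x y p r -> reach 1 c.
Proof.
move=> P cxy cpr xp bv xN pN zw X1 X2 X3.
(* Since [p] and [r] are separated, one of them is on the side of [x]; it is named [p]. *)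
wlog X4 : p r P cpr xp pN X2 X3 / chi x p z w = false.
  move=> W; case X4 : (chi x p z w); last exact: W P cpr xp pN X2 X3 X4.
  apply: (W r p); rewrite -?cpr //.
  - pos_tac P [:: 1; 2; 4; 3; 5; 6].
  - by rewrite chiCl.
  - by rewrite chiCr.
  - by rewrite -(chi_add l lam v x p r z w) X4 X2.
have U := pos_uniq P.
set s6 := [:: x; y; p; r; z; w] in P.
have [xin yin pin rin] : [/\ x \in s6, y \in s6, p \in s6 & r \in s6].
  by rewrite /s6; split; rewrite !inE eqxx ?orbT.
have xv := pos_neq P xin; have pv := pos_neq P pin.
have nol u u' b' : u \in s6 -> u' \in s6 -> c u \notin [:: c z; b] -> b' \notin [:: c z; b] ->
    b' != c v -> chi u u' z w -> ~~ linked c (c u) b' u u'.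
  move=> us u's cu cb' bv'; apply: contraL => lk.
  rewrite (chi_linked2 P _ _ _ _ _ lk zw) //.
  by apply/allP; rewrite /= us u's /s6 !inE !eqxx !orbT.
have yN : c y \notin [:: c z; b] by rewrite -cxy.
have xr : chi x r z w by rewrite -(chi_add l lam v x p r z w) X4 X2.
have yp : chi y p z w by rewrite -(chi_add l lam v y x p z w) chiCl X1 X4.
have nxy := nol x y (c p) xin yin xN pN pv X1.
have nxr := nol x r (c p) xin rin xN pN pv xr.
have nyx := nol y x (c p) yin xin yN pN pv (etrans (chiCl l lam v x y z w) X1).
have nyp := nol y p (c p) yin pin yN pN pv yp.
have px : c p != c x by rewrite eq_sym.
have py : c p != c y by rewrite -cxy.
(* A chain in the colors of [x] and [p] stays on one side of the link [z w], so it can only join [x]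
   to [p] or [y] to [r]. If one of these links is missing, a swap at [x] or [y] makes a triple with
   [p] and [r]. If both are present, swapping at [x] exchanges the colors of [x] and [p], and the
   new pairs [x r] and [y p] do not interleave. *)
have [lxp|lxp] := boolP (linked c (c x) (c p) x p); last first.
  apply: (reach_step P xin px pv); apply: reach_now.
  apply: (@goal3 _ _ p r x (position_step P xin pv)).
  - uniq_tac U [:: 3; 4; 1].
  - by move=> u; rewrite /s6 !inE => /or3P[] /eqP ->; rewrite ?eqxx ?orbT.
  - by rewrite !swap_at_unlinked.
  - by rewrite swap_at_self tpermL swap_at_unlinked.
have [lyr|lyr] := boolP (linked c (c y) (c p) y r); last first.
  apply: (reach_step P yin py pv); apply: reach_now.
  apply: (@goal3 _ _ p r y (position_step P yin pv)).
  - uniq_tac U [:: 3; 4; 2].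
  - by move=> u; rewrite /s6 !inE => /or3P[] /eqP ->; rewrite ?eqxx ?orbT.
  - by rewrite !swap_at_unlinked.
  - by rewrite swap_at_self tpermL swap_at_unlinked.
have X5 : chi x p y r = false.
  have sub : {subset [:: x; p; y; r] <= s6}.
    by move=> u; rewrite /s6 !inE => /or4P[] /eqP ->; rewrite ?eqxx ?orbT.
  have S u : u \in [:: x; p; y; r] -> L v u by move=> /sub; apply: (allP (pos_adj P)).
  rewrite -cxy in lyr.
  apply: (chi_linked_same Lsym pd _ _ _ _ _ _ _ lxp lyr); rewrite -?cxy ?mem_head //;
    try (by apply: S; rewrite !inE eqxx ?orbT).
  refine (free_pair P xin pv).
have X6 : chi x r y p = false.
  have UU : uniq [:: v; x; p; y; r] by uniq_tac U [:: 0; 1; 3; 2; 4].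
  have := chi_sum pd UU; rewrite X5 [chi x y p r]X3 addFb addTb chiCr.
  by move/negbTE => X; rewrite -X; case: chi.
apply: (reach_step P xin px pv); apply: reach_now.
apply: (@goal22 _ _ x r y p (position_step P xin pv)).
- uniq_tac U [:: 1; 4; 2; 3].
- by move=> u; rewrite /s6 !inE => /or4P[] /eqP ->; rewrite ?eqxx ?orbT.
- by rewrite swap_at_self tpermL swap_at_unlinked.
- by rewrite (swap_at_unlinked nxy) (swap_at_linked lxp) tpermR cxy.
- exact: X6.
Qed.

(** As [x] and [y] are not separated by any two of [q], [r], [s], both interleave in the same way
    with them; [chi_sum] supplies a pairing for [reach_triple]. *)
Lemma reach_noncrossing c x y q r s :
  position c [:: x; y; q; r; s] -> c x = c y -> uniq [:: c x; c q; c r; c s] ->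
  chi x y q r = false -> chi x y q s = false -> reach 1 c.
Proof.
move=> P cxy Uc X1 X2; have U := pos_uniq P.
have Ux : uniq [:: v; x; q; r; s] by uniq_tac U [:: 0; 1; 3; 4; 5].
have Y1 : chi y r q s = chi x r q s by rewrite -(chi_add l lam v x y r q s) X2.
have Y2 : chi y q r s = chi x q r s.
  by rewrite -(chi_add l lam v x y q r s) -(chi_addr l lam v x y r q s) (chiCr l lam v x y q r) X1 X2.
have Y3 : chi y s q r = chi x s q r by rewrite -(chi_add l lam v x y s q r) X1.
have := chi_sum pd Ux.
case X : (chi x r q s).
  by move=> _; apply: (reach_triple P cxy Uc X); rewrite Y1.
case X' : (chi x q r s).
  move=> _; apply: (reach_triple (x := x) (y := y) (q := r) (r := q) (s := s) _ cxy) => //.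
  - pos_tac P [:: 1; 2; 4; 3; 5].
  - by ucol_tac Uc [:: 0; 2; 1; 3].
  - by rewrite Y2.
rewrite addFb => X''.
apply: (reach_triple (x := x) (y := y) (q := q) (r := s) (s := r) _ cxy) => //.
- pos_tac P [:: 1; 2; 3; 5; 4].
- by ucol_tac Uc [:: 0; 1; 3; 2].
- by rewrite Y3.
Qed.

(** If [q] is linked to neither [p] nor [r], its swap makes a triple. A link to either one separates
    [s] from [y], so a swap at [s] gives the triple [x], [y], [s], or, when it also recolors [x],
    the pairs [y s] and [p r]. *)
Lemma reach_ucond c x y p r q s :
  position c [:: x; y; p; r; q; s] -> c x = c y -> c p = c r ->
  uniq [:: c x; c p; c q; c s] -> ucond (rot l lam v) x y p r q s -> reach 1 c.
Proof.
move=> P cxy cpr Uc /and4P[X1 X2 X3 /negbTE X4]; have U := pos_uniq P.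
have N := uniq4_neq Uc.
have [xs pq] : c x != c s /\ c p != c q by rewrite !N.
have xin : x \in [:: x; y; p; r; q; s] by rewrite !inE eqxx.
have pin : p \in [:: x; y; p; r; q; s] by rewrite !inE eqxx !orbT.
have qin : q \in [:: x; y; p; r; q; s] by rewrite !inE eqxx !orbT.
have sin : s \in [:: x; y; p; r; q; s] by rewrite !inE eqxx !orbT.
have xv := pos_neq P xin; have pv := pos_neq P pin.
have [] := boolP (linked c (c q) (c p) q p || linked c (c q) (c p) q r); last first.
  rewrite negb_or => /andP[np nr].
  apply: (reach_step P qin pq pv); apply: reach_now.
  apply: (@goal3 _ _ p r q (position_step P qin pv)).
  - uniq_tac U [:: 3; 4; 5].
  - sub_tac.
  - by rewrite !swap_at_unlinked.
  - by rewrite swap_at_self tpermL swap_at_unlinked.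
move=> lq.
have ny : ~~ linked c (c s) (c x) s y.
  apply/negP => ly; case/orP: lq => lk.
    have := chi_linked2 P _ xv pv _ _ ly lk; rewrite [chi _ _ _ _]X2 => W.
    suff: true = false by [].
    by apply: W; rewrite ?inE ?negb_or ?N //; sub_tac.
  have := chi_linked2 P _ xv pv _ _ ly lk; rewrite [chi _ _ _ _]X3 => W.
  suff: true = false by [].
  by apply: W; rewrite ?inE ?negb_or ?N //; sub_tac.
have [lx|nx] := boolP (linked c (c s) (c x) s x); last first.
  apply: (reach_step P sin xs xv); apply: reach_now.
  apply: (@goal3 _ _ x y s (position_step P sin xv)).
  - uniq_tac U [:: 1; 2; 6].
  - sub_tac.
  - by rewrite !swap_at_unlinked.
  - by rewrite swap_at_self tpermL swap_at_unlinked.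
apply: (reach_step P sin xs xv); apply: reach_now.
apply: (@goal22 _ _ y s p r (position_step P sin xv)) => //.
- uniq_tac U [:: 2; 6; 3; 4].
- sub_tac.
- by rewrite swap_at_self tpermL swap_at_unlinked.
by rewrite !swap_at_other ?mem_head // -?cpr !inE negb_or !N.
Qed.

(** The pair [x y] separates [p] from [r] but not [q] from [s]; whichever of [p], [r] lies with [q]
    and [s] gives a position of [reach_noncrossing]. *)
Lemma reach_crossing c x y p r q s :
  position c [:: x; y; p; r; q; s] -> c x = c y -> c p = c r ->
  uniq [:: c x; c p; c q; c s] -> chi x y p r -> chi x y q s = false -> reach 1 c.
Proof.
move=> P cxy cpr Uc X X1.
case X2 : (chi x y q p).
  apply: (reach_noncrossing (x := x) (y := y) (q := q) (r := r) (s := s) _ cxy) => //.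
  - pos_tac P [:: 1; 2; 5; 4; 6].
  - by rewrite -cpr; ucol_tac Uc [:: 0; 2; 1; 3].
  - by rewrite -(chi_addr l lam v x y q p r) X X2.
apply: (reach_noncrossing (x := x) (y := y) (q := q) (r := p) (s := s) _ cxy) => //.
- pos_tac P [:: 1; 2; 5; 3; 6].
- by ucol_tac Uc [:: 0; 2; 1; 3].
Qed.

Lemma reach_nonstuck c x y p r q s :
  position c [:: x; y; p; r; q; s] -> c x = c y -> c p = c r ->
  uniq [:: c x; c p; c q; c s] -> nonstuck (rot l lam v) x y p r q s -> reach 1 c.
Proof.
move=> P cxy cpr Uc; have U := pos_uniq P.
case X : (chi x y p r); last first.
  move=> _; apply: reach_now; apply: (goal22 P _ _ cxy cpr X); last sub_tac.
  by uniq_tac U [:: 1; 2; 3; 4].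
have Uxy : uniq [:: v; x; y; p; r] by uniq_tac U [:: 0; 1; 2; 3; 4].
case/or4P=> [/negbTE X1|/negbTE X1|/or4P W|/or4P W].
- exact: (reach_crossing P cxy cpr Uc X X1).
- apply: (reach_crossing (x := p) (y := r) (p := x) (r := y) (q := q) (s := s) _ cpr cxy) => //.
  + pos_tac P [:: 3; 4; 1; 2; 5; 6].
  + by ucol_tac Uc [:: 1; 0; 2; 3].
  + by rewrite (chiC pd Uxy).
- case: W => W; [ have Z := @reach_ucond c x y p r q s | have Z := @reach_ucond c y x p r q s
                | have Z := @reach_ucond c x y r p q s | have Z := @reach_ucond c y x r p q s];
  apply: (Z _ _ _ _ W); rewrite -?cxy -?cpr //.
  + pos_tac P [:: 2; 1; 3; 4; 5; 6].
  + pos_tac P [:: 1; 2; 4; 3; 5; 6].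
  + pos_tac P [:: 2; 1; 4; 3; 5; 6].
have Us : uniq [:: c x; c p; c s; c q] by ucol_tac Uc [:: 0; 1; 3; 2].
case: W => W; [ have Z := @reach_ucond c x y p r s q | have Z := @reach_ucond c y x p r s q
              | have Z := @reach_ucond c x y r p s q | have Z := @reach_ucond c y x r p s q];
apply: (Z _ _ _ _ W); rewrite -?cxy -?cpr //.
- pos_tac P [:: 1; 2; 3; 4; 6; 5].
- pos_tac P [:: 2; 1; 3; 4; 6; 5].
- pos_tac P [:: 1; 2; 4; 3; 6; 5].
- pos_tac P [:: 2; 1; 4; 3; 6; 5].
Qed.

Lemma chain_colorC c a b x : chain L c a b x = chain L c b a x.
Proof.
by apply: eq_finset => y; apply: eq_connect => u w /=; rewrite !inE ![(_ == a) || _]orbC.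
Qed.

Lemma rot_anti_at s : uniq (v :: s) ->
  {in s &, forall a b, a != b -> rot l lam v a b = ~~ rot l lam v b a}.
Proof.
move=> /andP[vs _] a b /= ain bin ab; apply: (rot_anti pd) => //.
  by apply: contraNneq vs => ->.
by apply: contraNneq vs => ->.
Qed.

(** From a stuck position either one swap already wins, or the links present allow a swap that
    recolors, among the six, only [r] or only [x]. It changes which vertices are paired, and
    [escapeT] shows that the new position is not stuck. *)
Lemma reach_escape c x y p r q s :
  position c [:: x; y; p; r; q; s] -> c x = c y -> c p = c r ->
  uniq [:: c x; c p; c q; c s] -> chi x y p q = false -> chi p r q x = false -> reach 2 c.
Proof.
move=> P cxy cpr Uc X1 X2; have U := pos_uniq P; have N := uniq4_neq Uc.
case NS : (nonstuck (rot l lam v) x y p r q s).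
  by apply: reach_leq (reach_nonstuck P cxy cpr Uc NS).
case X3 : (chi x y p r); last first.
  apply: reach_now; apply: (goal22 P _ _ cxy cpr X3); last sub_tac.
  by uniq_tac U [:: 1; 2; 3; 4].
have [X4 X5] : chi x y q s /\ chi p r q s.
  by move/negbT: NS; rewrite /nonstuck !negb_or !negbK => /and4P[].
have U6 : uniq [:: x; y; p; r; q; s] by case/andP: U.
have /implyP H := escapeT U6 (rot_anti_at U).
have /and5P[E1 E2 E3 _ /negbTE E5] : [&& nonstuck (rot l lam v) x y q r p s,
    nonstuck (rot l lam v) x s p r y q, chi s x q r, ~~ chi x y q p & ~~ chi y s p r].
  apply: H; apply/and5P; split; [exact: X3|exact: X4|exact: X5|exact/negbT/X1|].
  by rewrite NS andbT; exact/negbT/X2.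
have [xin yin pin rin qin] : [/\ x \in [:: x; y; p; r; q; s], y \in [:: x; y; p; r; q; s],
    p \in [:: x; y; p; r; q; s], r \in [:: x; y; p; r; q; s] & q \in [:: x; y; p; r; q; s]].
  by split; rewrite !inE eqxx ?orbT.
have sin : s \in [:: x; y; p; r; q; s] by rewrite !inE eqxx !orbT.
have xv := pos_neq P xin; have pv := pos_neq P pin.
have qv := pos_neq P qin; have sv := pos_neq P sin.
have [nq|nq] := boolP (linked c (c q) (c p) q p); last first.
  apply: (reach_step P qin _ pv); first by rewrite N.
  apply: (reach_leq (m := 0)) => //; apply: reach_now.
  have [lr|nr] := boolP (linked c (c q) (c p) q r); last first.
    apply: (@goal3 _ _ p r q (position_step P qin pv)).
    - uniq_tac U [:: 3; 4; 5].
    - sub_tac.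
    - by rewrite !swap_at_unlinked.
    - by rewrite swap_at_self tpermL swap_at_unlinked.
  apply: (@goal22 _ _ x y q p (position_step P qin pv)) => //.
  - uniq_tac U [:: 1; 2; 5; 3].
  - sub_tac.
  - by rewrite !swap_at_other ?mem_head // -?cxy !inE negb_or !N.
  - by rewrite swap_at_self tpermL swap_at_unlinked.
  by rewrite chiCr.
have [lx|nx] := boolP (linked c (c s) (c x) s x).
  have [ly|ny] := boolP (linked c (c s) (c x) s y); last first.
    apply: (reach_step P sin _ xv); first by rewrite N.
    apply: (reach_leq (m := 0)) => //; apply: reach_now.
    apply: (@goal22 _ _ y s p r (position_step P sin xv)) => //.
    - uniq_tac U [:: 2; 6; 3; 4].
    - sub_tac.
    - by rewrite swap_at_self tpermL swap_at_unlinked.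
    by rewrite !swap_at_other ?mem_head // -?cpr !inE negb_or !N.
  have nr : ~~ linked c (c q) (c p) q r.
    apply/negP => lr; suff: chi s x q r = false by rewrite [chi _ _ _ _]E3.
    by apply: (chi_linked2 P _ xv pv _ _ lx lr); rewrite ?inE ?negb_or ?N //; sub_tac.
  have nrq : ~~ linked c (c r) (c q) r q.
    by rewrite -cpr chain_colorC linkedC.
  have nrp : ~~ linked c (c r) (c q) r p.
    apply: contra nrq; rewrite -cpr chain_colorC linkedC // => lpr.
    by rewrite linkedC //; apply: chain_trans nq lpr.
  have rq : c q != c r by rewrite -cpr N.
  apply: (reach_step P rin rq qv); set d := swap_at _ _ _ _ _.
  have dx u : c u \notin [:: c r; c q] -> d u = c u.
    by move=> cu; apply: swap_at_other cu; rewrite mem_head.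
  have P' := position_step P rin qv; rewrite -/d in P'.
  have [dxE dyE dsE] : [/\ d x = c x, d y = c y & d s = c s].
    by split; apply: dx; rewrite -?cxy -cpr !inE negb_or !N.
  have dpE : d p = c p by apply: swap_at_unlinked.
  have dqE : d q = c q by apply: swap_at_unlinked.
  have drE : d r = c q by rewrite /d swap_at_self tpermL.
  apply: (reach_nonstuck (x := x) (y := y) (p := q) (r := r) (q := p) (s := s)).
  - pos_tac P' [:: 1; 2; 5; 4; 3; 6].
  - by rewrite dxE dyE.
  - by rewrite dqE drE.
  - by rewrite dxE dqE dpE dsE; ucol_tac Uc [:: 0; 2; 1; 3].
  exact: E1.
have [ly|ny] := boolP (linked c (c s) (c x) s y); last first.
  apply: (reach_step P sin _ xv); first by rewrite N.
  apply: (reach_leq (m := 0)) => //; apply: reach_now.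
  apply: (@goal3 _ _ x y s (position_step P sin xv)).
  - uniq_tac U [:: 1; 2; 6].
  - sub_tac.
  - by rewrite !swap_at_unlinked.
  - by rewrite swap_at_self tpermL swap_at_unlinked.
have nxs : ~~ linked c (c x) (c s) x s by rewrite chain_colorC linkedC.
have nxy : ~~ linked c (c x) (c s) x y.
  apply: contra nxs; rewrite chain_colorC => lxy.
  by apply: (chain_trans lxy); rewrite linkedC.
have sx : c s != c x by rewrite N.
apply: (reach_step P xin sx sv); set d := swap_at _ _ _ _ _.
have dx u : c u \notin [:: c x; c s] -> d u = c u.
  by move=> cu; apply: swap_at_other cu; rewrite mem_head.
have P' := position_step P xin sv; rewrite -/d in P'.
have [dpE drE dqE] : [/\ d p = c p, d r = c r & d q = c q].
  by split; apply: dx; rewrite -?cpr !inE negb_or !N.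
have dyE : d y = c x by rewrite cxy; apply: swap_at_unlinked.
have dsE : d s = c s by apply: swap_at_unlinked.
have dxE : d x = c s by rewrite /d swap_at_self tpermL.
apply: (reach_nonstuck (x := x) (y := s) (p := p) (r := r) (q := y) (s := q)).
- pos_tac P' [:: 1; 6; 3; 4; 2; 5].
- by rewrite dxE dsE.
- by rewrite dpE drE.
- by rewrite dxE dpE dyE dqE; ucol_tac Uc [:: 3; 1; 0; 2].
exact: E2.
Qed.

(** When the pairs interleave, exchanging [p] with [r] and then [x] with [y] achieves the
    normalization of [reach_escape]. *)
Lemma reach_two_pairs c x y p r q s :
  position c [:: x; y; p; r; q; s] -> c x = c y -> c p = c r ->
  uniq [:: c x; c p; c q; c s] -> reach 2 c.
Proof.
move=> P cxy cpr Uc; have U := pos_uniq P.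
case X : (chi x y p r); last first.
  apply: reach_now; apply: (goal22 P _ _ cxy cpr X); last sub_tac.
  by uniq_tac U [:: 1; 2; 3; 4].
wlog X1 : p r P cpr Uc X U / chi x y p q = false.
  move=> W; case X1 : (chi x y p q); last exact: W P cpr Uc X U X1.
  apply: (W r p); rewrite -?cpr //.
  - pos_tac P [:: 1; 2; 4; 3; 5; 6].
  - by rewrite chiCr.
  - uniq_tac U [:: 0; 1; 2; 4; 3; 5; 6].
  - by rewrite -(chi_addr l lam v x y r p q) X1 chiCr X.
case X2 : (chi p r q x); last exact: (reach_escape P cxy cpr Uc X1 X2).
apply: (reach_escape (x := y) (y := x) (p := p) (r := r) (q := q) (s := s)); rewrite -?cxy //.
- pos_tac P [:: 2; 1; 3; 4; 5; 6].
- by rewrite chiCl.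
have Uxy : uniq [:: v; x; y; p; r] by uniq_tac U [:: 0; 1; 2; 3; 4].
by rewrite -(chi_addr l lam v p r q x y) X2 (chiC pd Uxy) X.
Qed.

(** Three pairs and [v] use four colors, leaving one color [b]. If [q] and [s] are linked in their
    color and [b], this link is the one of [reach_linked]; otherwise recoloring [q] with [b] leaves
    two pairs and two single vertices. *)
Lemma reach_three_pairs c x y p r q s :
  position c [:: x; y; p; r; q; s] -> c x = c y -> c p = c r -> c q = c s ->
  uniq [:: c x; c p; c q] -> reach 3 c.
Proof.
move=> P cxy cpr cqs Uc; have U := pos_uniq P.
case X : (chi x y p r); last first.
  apply: reach_now; apply: (goal22 P _ _ cxy cpr X); last sub_tac.
  by uniq_tac U [:: 1; 2; 3; 4].
case X1 : (chi x y q s); last first.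
  apply: reach_now; apply: (goal22 P _ _ cxy cqs X1); last sub_tac.
  by uniq_tac U [:: 1; 2; 5; 6].
case X2 : (chi p r q s); last first.
  apply: reach_now; apply: (goal22 P _ _ cpr cqs X2); last sub_tac.
  by uniq_tac U [:: 3; 4; 5; 6].
have [b] : exists b : 'I_5, b \notin [:: c x; c p; c q; c v].
  apply/existsP; rewrite -negb_forall; apply/negP => /forallP A.
  have := uniq_leq_size (enum_uniq 'I_5) (fun b _ => A b).
  by rewrite -cardE card_ord.
rewrite !inE !negb_or => /and4P[bx bp bq bv].
move: Uc; rewrite /= !inE !negb_or -!andbA => /and4P[xp xq pq _].
have qin : q \in [:: x; y; p; r; q; s] by rewrite !inE eqxx !orbT.
have [lk|nl] := boolP (linked c (c q) b q s).
  apply: (reach_leq (m := 1)) => //.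
  apply: (reach_linked P cxy cpr xp bv _ _ lk) => //.
    by rewrite !inE negb_or xq eq_sym.
  by rewrite !inE negb_or pq eq_sym.
apply: (reach_step P qin bq bv); set d := swap_at _ _ _ _ _.
have P' := position_step P qin bv; rewrite -/d in P'.
have dx u : c u \notin [:: c q; b] -> d u = c u.
  by move=> cu; apply: swap_at_other cu; rewrite mem_head.
have cb u : c u != c q -> b != c u -> d u = c u.
  by move=> uq bu; apply: dx; rewrite !inE negb_or uq eq_sym.
have [dxE dyE] : d x = c x /\ d y = c y by split; apply: cb; rewrite -?cxy.
have [dpE drE] : d p = c p /\ d r = c r by split; apply: cb; rewrite -?cpr.
have dqE : d q = b by rewrite /d swap_at_self tpermL.
have dsE : d s = c q by rewrite cqs; apply: swap_at_unlinked.
apply: (reach_two_pairs P'); rewrite ?dxE ?dyE ?dpE ?drE ?dqE ?dsE //.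
by rewrite /= !inE !negb_or xp xq pq bq [c x == b]eq_sym bx [c p == b]eq_sym bp.
Qed.

Lemma color_pair c (s : seq V) : ~~ uniq (map c s) ->
  exists x y t, perm_eq s [:: x, y & t] /\ c x = c y.
Proof.
elim: s => [//|a s IH]; rewrite /= negb_and negbK => /orP[/mapP[b bs E]|/IH[x [y [t [st E]]]]].
  by exists a, b, (rem b s); split=> //; rewrite perm_cons perm_to_rem.
exists x, y, (a :: t); split=> //.
rewrite -[[:: x, y & _]]/([:: x; y] ++ [:: a] ++ t) perm_sym perm_catCA /= perm_cons.
by rewrite perm_sym.
Qed.

Lemma color_all c (s : seq V) (k : 'I_5) : all (fun u => c u != k) s -> uniq (map c s) ->
  size s <= 4 /\ (size s = 4 -> forall k', k' != k -> k' \in map c s).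
Proof.
move=> /allP sk Us.
have Uk : uniq (k :: map c s).
  by rewrite /= Us andbT; apply/mapP => -[u /sk + E]; rewrite -E eqxx.
have sub : {subset k :: map c s <= enum 'I_5} by move=> u _; rewrite mem_enum.
have sz : size (enum 'I_5) = 5 by rewrite size_enum_ord.
have := uniq_leq_size Uk sub; rewrite sz /= size_map ltnS; split=> // s4 k' k'k.
have [|_ E] := uniq_min_size Uk sub; first by rewrite sz /= size_map s4.
by have := E k'; rewrite mem_enum in_cons (negPf k'k) orFb => ->.
Qed.

(** Six vertices in four colors: unless three agree, they form two pairs and two single vertices, or
    three pairs. *)
Lemma reach_mono_merge c s : size s = 6 -> position c s -> reach 3 c.
Proof.
move=> s6 P.
have [|x [y [t [st cxy]]]] := @color_pair c s.
  by apply/negP => /(color_all (pos_col P)) []; rewrite s6.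
have {}P := position_perm st P; have {s6 st} t4 : size t = 4.
  by move/perm_size: st; rewrite s6 => -[].
have xv : c x != c v by apply: (pos_neq P); rewrite mem_head.
have [Ut|Ut] := boolP (uniq (map c t)).
  have tk : all (fun u => c u != c v) t by have /and3P[] := pos_col P.
  have [_ /(_ t4 _ xv) /mapP[p pt xp]] := color_all tk Ut.
  apply: reach_now; apply: (@goal3 _ _ x y p P) => //.
    have := pos_uniq P; rewrite /= !inE !negb_or -!andbA.
    case/and5P=> _ _ _ xy /and3P[xt yt _]; rewrite xy andbT /=.
    by apply/andP; split; apply/eqP => E; rewrite E pt in xt yt.
  by apply/allP; rewrite /= !inE !eqxx pt !orbT.
have [p [r [t' [tt' cpr]]]] := color_pair Ut.
have : perm_eq [:: x, y & t] [:: x, y, p, r & t'] by rewrite !perm_cons.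
move=> /position_perm/(_ P) {}P.
have : size t' = 2 by move/perm_size: tt'; rewrite t4 => -[].
case: t' P {tt'} => [|q [|s' [|//]]] //= P _; have U := pos_uniq P.
have tri z : z \in [:: p; r; q; s'] -> c x = c z -> reach 3 c.
  move=> zin E; apply: reach_now; apply: (@goal3 _ _ x y z P) => //.
    move: zin; rewrite !inE => /or4P[] /eqP->.
    - uniq_tac U [:: 1; 2; 3].
    - uniq_tac U [:: 1; 2; 4].
    - uniq_tac U [:: 1; 2; 5].
    - uniq_tac U [:: 1; 2; 6].
  apply/allP; rewrite /= !inE !eqxx orbT /=.
  by move: zin; rewrite !inE => ->; rewrite !orbT.
have tri' z : z \in [:: q; s'] -> c p = c z -> reach 3 c.
  move=> zin E; apply: reach_now; apply: (@goal3 _ _ p r z P) => //.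
    move: zin; rewrite !inE => /orP[] /eqP->.
    - uniq_tac U [:: 3; 4; 5].
    - uniq_tac U [:: 3; 4; 6].
  apply/allP; rewrite /= !inE !eqxx !orbT /=.
  by move: zin; rewrite !inE => ->; rewrite !orbT.
have [E|xp] := eqVneq (c x) (c p); first by apply: (tri p) => //; rewrite mem_head.
have [E|xq] := eqVneq (c x) (c q); first by apply: (tri q) => //; rewrite !inE eqxx !orbT.
have [E|xs] := eqVneq (c x) (c s'); first by apply: (tri s') => //; rewrite !inE eqxx !orbT.
have [E|pq] := eqVneq (c p) (c q); first by apply: (tri' q) => //; rewrite !inE eqxx.
have [E|ps] := eqVneq (c p) (c s'); first by apply: (tri' s') => //; rewrite !inE eqxx !orbT.
have [E|qs] := eqVneq (c q) (c s').
  by apply: (reach_three_pairs P cxy cpr E); rewrite /= !inE !negb_or xp xq pq.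
apply: (reach_leq (m := 2)) => //.
by apply: (reach_two_pairs P cxy cpr); rewrite /= !inE !negb_or xp xq xs pq ps qs.
Qed.

End Game6.

(** * Removing many vertices at once *)

Section Phase.
Variables (V : finType) (e l : rel V) (lam : V -> V -> V -> bool).
Hypotheses (esym : symmetric e) (eirr : irreflexive e) (pd : parity_drawing e l lam).
Variable Q : V -> {set V}.
Implicit Types (c d : {ffun V -> 'I_5}) (S : {set V}) (t : V -> V).

(** Degree five has to lose one class, for which [reach_mono_pair] takes four marked neighbors;
    degree six has to lose two, which takes all six. *)
Definition reducible v : bool :=
  (Q v \subset [set x | e v x]) &&
  [|| (deg e v <= 4) && (Q v == set0), (deg e v == 5) && (#|Q v| == 4) |
      (deg e v == 6) && (#|Q v| == 6)].

Definition spread S : Prop :=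
  {in S &, forall v w, v != w -> ~~ e v w /\ [disjoint Q v & Q w]}.

(** The last clause bounds the classes around [v] by four: the images of [Q v] together with the
    [deg e v - #|Q v|] unmarked neighbors, written without a truncated subtraction. *)
Definition merges_at t v : Prop :=
  [/\ {in Q v, forall x, t x \in Q v /\ t (t x) = t x},
      {in Q v &, forall x y, t x != x -> t y != y -> t x != t y -> chi l lam v x (t x) y (t y) = false},
      {in Q v &, forall x y, t x = t y -> ~~ e x y} &
      #|t @: Q v| + deg e v <= 4 + #|Q v|].

Lemma merges_at_ext t t' v : {in Q v, t' =1 t} -> merges_at t v -> merges_at t' v.
Proof.
move=> E [h1 h2 h3 h4]; split.
- by move=> x xQ; have [tQ tt] := h1 x xQ; rewrite !E.
- by move=> x y xQ yQ; rewrite !E //; apply: h2.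
- by move=> x y xQ yQ; rewrite !E //; apply: h3.
- by rewrite (eq_in_imset E).
Qed.

Definition owner S x : V := odflt x [pick v in S | x \in Q v].

Definition merge_all S t x : V := if x \in cover (Q @: S) then t x else x.

Lemma coverQ S x : reflect (exists2 v, v \in S & x \in Q v) (x \in cover (Q @: S)).
Proof.
apply: (iffP bigcupP) => [[B /imsetP[v vS ->] xQ]|[v vS xQ]]; first by exists v.
by exists (Q v) => //; apply: imset_f.
Qed.

Lemma merge_all_in S t v x : v \in S -> x \in Q v -> merge_all S t x = t x.
Proof. by move=> vS xQ; rewrite /merge_all ifT //; apply/coverQ; exists v. Qed.

Lemma merge_all_moved S t x : merge_all S t x != x -> exists2 v, v \in S & x \in Q v.
Proof. by rewrite /merge_all; case: ifP => [/coverQ //|_]; rewrite eqxx. Qed.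

Lemma ownerP S x v : spread S -> v \in S -> x \in Q v -> owner S x = v.
Proof.
move=> sp vS xQ; rewrite /owner; case: pickP => [w /andP[wS xw]|/(_ v)]; last by rewrite /= vS xQ.
by apply: contraTeq xQ => wv; have [_ /disjointFr ->] := sp _ _ wS vS wv.
Qed.

Lemma merge_all_data S t : spread S -> {in S, forall v, reducible v} ->
  {in S, forall v, merges_at t v} -> merge_data e l lam S (merge_all S t) (owner S).
Proof.
move=> sp red tS.
have adj v x : v \in S -> x \in Q v -> e v x.
  by move=> /red /andP[/subsetP sub _] /sub; rewrite inE.
have out v x : v \in S -> x \in Q v -> x \notin S.
  move=> vS xQ; apply/negP => xS; have evx := adj v x vS xQ.
  have vx : v != x by apply: contraTneq evx => ->; rewrite eirr.
  by have [] := sp _ _ vS xS vx; rewrite evx.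
have mv v x : v \in S -> x \in Q v -> merge_all S t x \in Q v.
  by move=> vS xQ; rewrite (merge_all_in t vS xQ); have [/(_ x xQ)[]] := tS v vS.
have fixS x : x \in S -> merge_all S t x = x.
  by move=> xS; apply: contraTeq xS => /merge_all_moved[v vS]; apply: out.
have qq v w x : v \in S -> w \in S -> x \in Q v -> x \in Q w -> v = w.
  by move=> vS wS xv xw; rewrite -(ownerP sp vS xv) (ownerP sp wS xw).
split=> //.
- move=> x xS; have [->//|/merge_all_moved[v vS xQ]] := eqVneq (merge_all S t x) x.
  exact: (out _ _ vS (mv _ _ vS xQ)).
- move=> x; have [mx|/merge_all_moved[v vS xQ]] := eqVneq (merge_all S t x) x.
    by rewrite !mx.
  rewrite (merge_all_in t vS (mv _ _ vS xQ)) (merge_all_in t vS xQ).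
  by have [/(_ x xQ)[]] := tS v vS.
- move=> x /merge_all_moved[v vS xQ]; rewrite (ownerP sp vS xQ).
  by split=> //; apply: adj => //; apply: mv.
- move=> x y mx my mxy E; case/merge_all_moved: (mx) => v vS xQ.
  case/merge_all_moved: (my) => w wS yQ.
  move: E; rewrite (ownerP sp vS xQ) (ownerP sp wS yQ) => vw; subst w.
  have [_ nc _ _] := tS v vS.
  rewrite (merge_all_in t vS xQ) (merge_all_in t vS yQ) in mx my mxy *.
  exact: nc.
- move=> x y xS yS E.
  case: (boolP (x \in cover (Q @: S))) => [/coverQ[v vS xQ]|xN]; last first.
    have mx : merge_all S t x = x by rewrite /merge_all (negPf xN).
    case: (boolP (y \in cover (Q @: S))) => [/coverQ[w wS yQ]|yN].
      by case/coverQ: xN; exists w => //; rewrite -mx E; apply: mv.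
    by move: E; rewrite mx /merge_all (negPf yN) => ->; rewrite eirr.
  case: (boolP (y \in cover (Q @: S))) => [/coverQ[w wS yQ]|yN]; last first.
    have my : merge_all S t y = y by rewrite /merge_all (negPf yN).
  by case/coverQ: yN; exists v => //; rewrite -my -E; apply: mv.
  have vw : v = w by apply: (qq v w (merge_all S t x)) => //; [apply: mv | rewrite E; apply: mv].
  subst w; have [_ _ ind _] := tS v vS.
  by apply: ind => //; rewrite -(merge_all_in t vS xQ) -(merge_all_in t vS yQ).
- move=> v w vS wS; case: (eqVneq v w) => [->|vw]; first by rewrite eirr.
  by have [] := sp _ _ vS wS vw.
- move=> v vS; have /andP[sub _] := red v vS; have [_ _ _ cnt] := tS v vS.
  rewrite -(setID [set y | e v y] (Q v)) imsetU (setIidPr sub).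
  have -> : merge_all S t @: Q v = t @: Q v.
    by apply: eq_in_imset => x xQ; apply: merge_all_in xQ.
  have := cardsU (t @: Q v) (merge_all S t @: ([set y | e v y] :\: Q v)).
  have := leq_imset_card (merge_all S t) ([set y | e v y] :\: Q v).
  have := cardsD [set y | e v y] (Q v); rewrite (setIidPr sub) -degE.
  by have := subset_leq_card sub; rewrite -degE; move: cnt; lia.
- move=> v /red /andP[_] /or3P[/andP[d4 _]|/andP[/eqP -> _]|/andP[/eqP -> _]] //.
  exact: leq_trans d4 _.
Qed.

(* At most three swaps are made, and each costs a vertex at most 12 changes. *)
Lemma reduce_at S t c v : spread (v |: S) -> v \notin S -> reducible v ->
  {in S, forall w, reducible w} -> {in S, forall w, merges_at t w} ->
  proper_coloring e c -> class_const S (merge_all S t) c ->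
  exists d t', [/\ reconf e 36 c d, proper_coloring e d, class_const S (merge_all S t) d,
    merges_at t' v & {in Q v, forall x, d (t' x) = d x}].
Proof.
move=> sp vS /andP[/subsetP sub red] redS tS pc cc.
have spS : spread S by move=> a b aS bS; apply: sp; rewrite !inE ?aS ?bS orbT.
have md := merge_all_data spS redS tS.
set m := merge_all S t in md cc *; set cen := owner S in md.
have evQ x : x \in Q v -> e v x by move=> /sub; rewrite inE.
have outQ x : x \in Q v -> x \notin S.
  move=> xQ; apply/negP => xS; have vx : v != x by apply: contraNneq vS => ->.
  have [vSv xSv] : v \in v |: S /\ x \in v |: S by rewrite !inE eqxx xS orbT.
  by have [/negP] := sp _ _ vSv xSv vx; case; apply: evQ.
have ind d t' : proper_coloring e d -> {in Q v, forall x, d (t' x) = d x} ->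
    {in Q v &, forall x y, t' x = t' y -> ~~ e x y}.
  move=> pd' dt x y xQ yQ E; apply/negP => /pd'; rewrite -(dt x xQ) -(dt y yQ) E eqxx.
  by [].
have Lsym := merged_adj_sym esym S m.
have pdL : parity_drawing (merged_adj e S m) l (merged_lam e lam m cen) by apply: merged_adj_pd.
have LR x y : merged_adj e S m x y -> y \notin S by case/and3P.
(* The game is played in the merged graph of [S], so that the merges already made survive; at most
   three moves are then extended to [S] at twelve changes each. *)
have game P : reach (merged_adj e S m) S 3 c P -> exists d d',
    [/\ reconf e 36 c d', proper_coloring e d', class_const S m d',
      forall x, x \notin S -> d' x = d x & P d].
  case=> s [d [p sz av Pd]].
  have [|d' [r pd' cd' E]] := extend_bound esym eirr md pc cc (fun _ _ => erefl) p av (n := 3).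
    by move=> x _; apply: leq_trans (count_size _ _) sz.
  by exists d, d'.
have pos : position (merged_adj e S m) v [in Q v] c (enum (Q v)).
  split; try by apply/allP => x; rewrite mem_enum => xQ; rewrite ?inE.
  - rewrite /= enum_uniq andbT mem_enum; apply/negP => /evQ; by rewrite eirr.
  - by apply/allP => x; rewrite mem_enum => xQ; rewrite /merged_adj vS outQ //= evQ.
  by apply/allP => x; rewrite mem_enum => xQ; rewrite eq_sym pc // evQ.
case/or3P: red => [/andP[d4 /eqP Q0]|/andP[/eqP d5 /eqP Q4]|/andP[/eqP d6 /eqP Q6]].
- exists c, id; split=> //.
  + exact: reconf_refl.
  + by split; rewrite ?Q0 ?imset0 ?cards0 // => x; rewrite inE.
- have /game[d [d' [r pd' cd' E [x [y [xQ yQ xy dxy]]]]]] :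
      reach (merged_adj e S m) S 3 c (mono_pair [in Q v]).
    have := pos; have : size (enum (Q v)) = 4 by rewrite -cardE.
    case: (enum (Q v)) => [|x [|y [|z [|w [|//]]]]] //= _ [U q a k].
    exact: reach_leq (reach_mono_pair pdL LR U q a k).
  pose t' z := if z == x then y else z; exists d', t'.
  have dt : {in Q v, forall z, d' (t' z) = d' z}.
    by move=> z zQ; rewrite /t'; case: eqP => // ->; rewrite !E ?outQ.
  split=> //; split.
  + move=> z zQ; rewrite /t'; case: (eqVneq z x) => [_|zx]; last by rewrite (negPf zx).
    by rewrite eq_sym (negPf xy).
  + by move=> z w _ _; rewrite /t'; case: (eqVneq z x) => _; case: (eqVneq w x) => _; rewrite ?eqxx.
  + exact: ind pd' dt.
  have sub' : t' @: Q v \subset Q v :\ x.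
    apply/subsetP => z /imsetP[w wQ ->]; rewrite /t'; case: (eqVneq w x) => [_|wx].
      by rewrite !inE eq_sym xy.
    by rewrite !inE wx.
  by have := subset_leq_card sub'; have := cardsD1 x (Q v); rewrite xQ Q4 d5; lia.
have /game[d [d' [r pd' cd' E]]] :
    reach (merged_adj e S m) S 3 c (mono_merge l (merged_lam e lam m cen) v [in Q v]).
  have := pos; have := cardE (Q v); rewrite Q6; case: (enum _) => // *.
  by apply: (reach_mono_merge Lsym pdL LR _ pos); rewrite -cardE.
have fin t' : {in Q v, forall z, t' z \in Q v /\ t' (t' z) = t' z} ->
    {in Q v, forall z, d' (t' z) = d' z} ->
    {in Q v &, forall x y, t' x != x -> t' y != y -> t' x != t' y ->
      chi l lam v x (t' x) y (t' y) = false} ->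
    (exists x y, [/\ x != y, x \in Q v, y \in Q v & t' @: Q v \subset Q v :\: [set x; y]]) ->
    exists d t', [/\ reconf e 36 c d, proper_coloring e d, class_const S m d, merges_at t' v &
      {in Q v, forall x, d (t' x) = d x}].
  move=> h1 dt h2 [x [y [xy xQ yQ sub']]]; exists d', t'; split=> //; split=> //.
    exact: ind pd' dt.
  have := subset_leq_card sub'; rewrite cardsD (setIidPr _) ?cards2 ?xy ?Q6 ?d6; first lia.
  by apply/subsetP => z; rewrite !inE => /orP[] /eqP ->.
case=> [[x [y [z [U /and4P[xQ yQ zQ _] dxy dxz]]]]|[x [y [z [w [U /and5P[xQ yQ zQ wQ _] dxy dzw X]]]]]].
  move: U; rewrite /= !inE !negb_or andbT => /andP[/andP[xy xz] yz].
  apply: (fin (fun u => if (u == x) || (u == y) then z else u)).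
  + move=> u uQ; case: (boolP ((u == x) || (u == y))) => [_|/negPf -> //].
    by rewrite ![z == _]eq_sym (negPf xz) (negPf yz).
  + by move=> u uQ; case: ifP => // /orP[] /eqP ->; rewrite !E ?outQ // -dxz.
  + by move=> u u' _ _; case: ifP; case: ifP; rewrite ?eqxx.
  exists x, y; split=> //; apply/subsetP => u /imsetP[u' u'Q ->].
  case: ifP => [_|N]; rewrite !inE ?u'Q ?N //.
  by rewrite zQ andbT ![z == _]eq_sym (negPf xz) (negPf yz).
move: (U); rewrite /= !inE !negb_or -!andbA => /and5P[xy xz xw yz /and3P[yw zw _]].
have Uv : uniq [:: v; x; y; z; w].
  rewrite cons_uniq U andbT !inE !negb_or; apply/and4P.
  by split; apply: contraTneq isT => vE;
    [move: (evQ _ xQ)|move: (evQ _ yQ)|move: (evQ _ zQ)|move: (evQ _ wQ)];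
    rewrite -vE eirr.
have {}X : chi l lam v x y z w = false.
  by rewrite -(chi_plus l lam m cen (evQ _ xQ) (evQ _ yQ) (evQ _ zQ) (evQ _ wQ)).
apply: (fin (fun u => if u == x then y else if u == z then w else u)).
- move=> u uQ; case: (eqVneq u x) => [_|ux].
    by rewrite [y == x]eq_sym (negPf xy) (negPf yz).
  case: (eqVneq u z) => [_|uz]; last by rewrite (negPf ux) (negPf uz).
  by rewrite [w == x]eq_sym [w == z]eq_sym (negPf xw) (negPf zw).
- move=> u uQ; case: eqP => [->|_]; first by rewrite !E ?outQ.
  by case: eqP => [->|//]; rewrite !E ?outQ.
- move=> u u' _ _; case: (eqVneq u x) => [->|_]; case: (eqVneq u' x) => [->|_]; rewrite ?eqxx //.
  + by case: (eqVneq u' z) => [->|_]; rewrite ?eqxx.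
  + by case: (eqVneq u z) => [->|_]; rewrite ?eqxx // (chiC pd Uv).
  by case: (eqVneq u z) => [->|_]; case: (eqVneq u' z) => [->|_]; rewrite ?eqxx.
exists x, z; split=> //; apply/subsetP => u /imsetP[u' u'Q ->].
case: (eqVneq u' x) => [_|ux]; first by rewrite !inE yQ negb_or eq_sym xy yz.
case: (eqVneq u' z) => [_|uz]; last by rewrite !inE u'Q negb_or ux uz.
by rewrite !inE wQ negb_or eq_sym xw eq_sym zw.
Qed.

Lemma reduce_all S c : spread S -> {in S, forall v, reducible v} -> proper_coloring e c ->
  exists d t, [/\ reconf e (36 * #|S|) c d, proper_coloring e d,
    class_const S (merge_all S t) d & {in S, forall v, merges_at t v}].
Proof.
have [n] := ubnP #|S|; elim: n => // n IH in S c * => ltS sp red pc.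
have [S0|[v vS]] := set_0Vmem S.
  exists c, id; rewrite S0 cards0; split=> //; first exact: reconf_refl.
    by move=> x _; rewrite /merge_all; case: ifP.
  by move=> v; rewrite inE.
have vS' : v \notin S :\ v by rewrite !inE eqxx.
have SE := setD1K vS; have cS : #|S| = #|S :\ v|.+1 by rewrite (cardsD1 v) vS.
have sub w : w \in S :\ v -> w \in S by move=> /setD1P[].
have [||||d [t [r1 pd1 cd tS]]] := IH (S :\ v) c.
- by move: ltS; rewrite cS.
- by move=> a b /sub aS /sub bS; apply: sp.
- by move=> w /sub /red.
- exact: pc.
have sp' : spread (v |: S :\ v) by rewrite SE.
have red' : {in S :\ v, forall w, reducible w} by move=> w /sub /red.
have [d' [t' [r2 pd2 cd' tv dv]]] := reduce_at sp' vS' (red v vS) red' tS pd1 cd.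
pose t2 x := if x \in Q v then t' x else t x.
have t2v : {in Q v, t2 =1 t'} by move=> x xQ; rewrite /t2 xQ.
have nQ w x : w \in S :\ v -> x \in Q w -> x \notin Q v.
  case/setD1P=> wv wS xQ.
  by have [_ /disjointFr ->] := sp _ _ wS vS wv.
have t2w w : w \in S :\ v -> {in Q w, t2 =1 t}.
  by move=> wS x xQ; rewrite /t2 (negPf (nQ _ _ wS xQ)).
exists d', t2; split=> //.
- by rewrite cS mulnS addnC; apply: reconf_trans r1 r2.
- move=> x xS; rewrite /merge_all; case: ifP => // /coverQ[w wS xQ].
  case: (eqVneq w v) => [wv|wv].
    by subst w; rewrite t2v // dv.
  have wS' : w \in S :\ v by rewrite !inE wv.
  have xS' : x \notin S :\ v by apply: contra xS => /sub.
  by rewrite (t2w w wS' x xQ) -(merge_all_in t wS' xQ) // cd'.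
- move=> w wS; case: (eqVneq w v) => [->|wv]; first exact: merges_at_ext t2v tv.
  have wS' : w \in S :\ v by rewrite !inE wv.
  exact: merges_at_ext (t2w _ wS') (tS _ wS').
Qed.

End Phase.

(** Both ends are arbitrary 5-colorings because the recursive calls compare a given coloring with a
    hub, which may use every color. *)
Definition uniformly_reconf N B : Prop :=
  forall (V : finType) (e : rel V), symmetric e -> irreflexive e -> planar_like e -> #|V| <= N ->
  forall c d : {ffun V -> 'I_5}, proper_coloring e c -> proper_coloring e d -> reconf e B c d.

Section TwoSides.
Variables (V : finType) (e l : rel V) (lam : V -> V -> V -> bool).
Hypotheses (esym : symmetric e) (eirr : irreflexive e) (pd : parity_drawing e l lam).
Variables N B : nat.
Hypothesis IH : uniformly_reconf N B.
Implicit Types c d : {ffun V -> 'I_5}.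

Lemma reconf_merged R m cen c d : merge_data e l lam R m cen -> #|V| <= N + #|R| ->
  proper_coloring e c -> proper_coloring e d -> class_const R m c -> class_const R m d ->
  reconf e (12 * B + 1) c d.
Proof.
move=> md NR pc pd' cc cd; apply: (reconf_quot esym eirr md) => //.
apply: IH; try exact: quot_col_proper.
- exact: quot_adj_sym.
- exact: quot_adj_irr.
- exact: quot_planar_like md.
by rewrite -(leq_add2r #|R|); apply: leq_trans (card_quot R m) NR.
Qed.

Lemma exists_hub R m cen : merge_data e l lam R m cen ->
  exists2 h, proper_coloring e h & class_const R m h.
Proof.
move=> md; have [||| cq pq] := @five_colorable _ (@quot_adj V e R m).
- exact: quot_adj_sym.
- exact: quot_adj_irr.
- exact: quot_planar_like md.
exact: (hub_coloring esym md pq).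
Qed.

Lemma reconf_two_sides (Q : V -> {set V}) (S S' : {set V}) c d :
  spread e Q (S :|: S') -> [disjoint S & S'] -> {in S :|: S', forall v, reducible e Q v} ->
  #|V| <= N + #|S| -> #|V| <= N + #|S'| -> proper_coloring e c -> proper_coloring e d ->
  reconf e (36 * #|S| + (12 * B + 1) + ((12 * B + 1) + 36 * #|S'|)) c d.
Proof.
move=> sp dis red NS NS' pc pd'.
have inl v : v \in S -> v \in S :|: S' by rewrite inE => ->.
have inr v : v \in S' -> v \in S :|: S' by rewrite inE orbC => ->.
have spl : spread e Q S by move=> v w /inl vS /inl wS; apply: sp.
have spr : spread e Q S' by move=> v w /inr vS /inr wS; apply: sp.
have redl : {in S, forall v, reducible e Q v} by move=> v /inl /red.
have redr : {in S', forall v, reducible e Q v} by move=> v /inr /red.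
have [c1 [t [rc pc1 cc1 tS]]] := reduce_all esym eirr pd spl redl pc.
have [d1 [t' [rd pd1 cd1 tS']]] := reduce_all esym eirr pd spr redr pd'.
(* The marked sets belonging to [S] and [S'] are disjoint, so the merges found separately for [c]
   and [d] combine into one map. *)
pose T x := if x \in cover (Q @: S) then t x else t' x.
have Tl v : v \in S -> {in Q v, T =1 t}.
  by move=> vS x xQ; rewrite /T ifT //; apply/coverQ; exists v.
have Tr v : v \in S' -> {in Q v, T =1 t'}.
  move=> vS x xQ; rewrite /T ifN //; apply/coverQ => -[w wS xw].
  have wv : w != v by apply: contraTneq vS => <-; rewrite (disjointFr dis).
  by have [_ /disjointFr/(_ xw)] := sp _ _ (inl _ wS) (inr _ vS) wv; rewrite xQ.
have TS : {in S :|: S', forall v, merges_at e l lam Q T v}.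
  move=> v; rewrite inE => /orP[] vS.
    exact: merges_at_ext (Tl v vS) (tS v vS).
  exact: merges_at_ext (Tr v vS) (tS' v vS).
have [h ph ch] := exists_hub (merge_all_data eirr sp red TS).
have out v x : v \in S :|: S' -> x \in Q v -> x \notin S :|: S'.
  move=> vS xQ; apply/negP => xS; have /andP[/subsetP/(_ x xQ) + _] := red v vS.
  rewrite inE => evx; have vx : v != x by apply: contraTneq evx => ->; rewrite eirr.
  by have [] := sp _ _ vS xS vx; rewrite evx.
have chl : class_const S (merge_all Q S t) h.
  move=> x xS; rewrite /merge_all; case: ifP => // /coverQ[v vS xQ].
  rewrite -(Tl v vS) // -(merge_all_in T (inl v vS) xQ) ch //; exact: out (inl v vS) xQ.
have chr : class_const S' (merge_all Q S' t') h.
  move=> x xS; rewrite /merge_all; case: ifP => // /coverQ[v vS xQ].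
  rewrite -(Tr v vS) // -(merge_all_in T (inr v vS) xQ) ch //; exact: out (inr v vS) xQ.
have mdl := merge_all_data eirr spl redl tS.
have mdr := merge_all_data eirr spr redr tS'.
apply: reconf_trans (reconf_trans rc _) (reconf_trans _ (reconf_sym rd)).
  exact: reconf_merged mdl NS pc1 ph cc1 chl.
exact: reconf_merged mdr NS' ph pd1 chr cd1.
Qed.

End TwoSides.

(** * Removing one vertex *)

Section OneVertex.
Variables (V : finType) (e l : rel V) (lam : V -> V -> V -> bool).
Hypotheses (esym : symmetric e) (eirr : irreflexive e) (pd : parity_drawing e l lam).
Variables B : nat.
Hypothesis IH : uniformly_reconf #|V|.-1 B.
Hypothesis V0 : 0 < #|V|.
Implicit Types c d : {ffun V -> 'I_5}.

Let size1 (v : V) : #|V| <= #|V|.-1 + #|[set v]|.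
Proof. by rewrite cards1 addn1 prednK. Qed.

Lemma reconf_low v c d : deg e v <= 4 -> proper_coloring e c -> proper_coloring e d ->
  reconf e (12 * B + 1) c d.
Proof.
move=> d4 pc pd'.
have md : merge_data e l lam [set v] id id.
  rewrite -[[set v]]setU0; apply: merge_extend_low => //; first exact: merge_nothing.
    by rewrite in_set0.
  by move=> r; rewrite in_set0.
by apply: (reconf_merged esym eirr pd IH md (size1 v) pc pd').
Qed.

Definition pair_reached c x a b : Prop := exists c',
  [/\ reconf e 36 c c', proper_coloring e c', c' a = c' b & [/\ e x a, e x b & a != b]].

Lemma pair_reachedC c x a b : pair_reached c x a b -> pair_reached c x b a.
Proof. by case=> c' [r pc E [xa xb ab]]; exists c'; rewrite eq_sym. Qed.

Lemma pair_nonadj c x a b : pair_reached c x a b -> ~~ e a b.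
Proof. by case=> c' [_ pc E _]; apply/negP => /pc; rewrite E eqxx. Qed.

(** Four of the five neighbors are enough to produce a pair, so any one vertex [f] can be kept out
    of it. *)
Lemma pair_avoiding c x f : deg e x = 5 -> proper_coloring e c ->
  exists a b, [/\ pair_reached c x a b, a != f & b != f].
Proof.
move=> d5 pc; pose N := [set y | e x y].
have N5 : #|N| = 5 by rewrite -degE.
have [Q [QN Q4 Qf]] : exists Q : {set V}, [/\ Q \subset N, #|Q| = 4 & f \notin Q].
  have [fN|fN] := boolP (f \in N).
    exists (N :\ f); rewrite subD1set setD11; split=> //.
    by have := cardsD1 f N; rewrite fN N5 => -[].
  have [y yN] : exists y, y \in N by apply/set0Pn; rewrite -card_gt0 N5.
  exists (N :\ y); rewrite subD1set; split=> //.
    by have := cardsD1 y N; rewrite yN N5 => -[].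
  by apply: contra fN; rewrite in_setD1 => /andP[].
have red : reducible e (fun=> Q) x by rewrite /reducible QN d5 Q4 orbT.
have [|v /set1P -> //|c' [t [r pc' cc tS]]] :=
  reduce_all (Q := fun=> Q) esym eirr pd (S := [set x]) _ _ pc.
  by move=> v w /set1P -> /set1P ->; rewrite eqxx.
have xS := set11 x; have [h1 _ _ h4] := tS x xS.
have /existsP[a /andP[aQ ta]] : [exists a, (a \in Q) && (t a != a)].
  rewrite -negb_forall_in; apply/negP => /forall_inP E.
  have : t @: Q = Q by rewrite -[RHS]imset_id; apply: eq_in_imset => a /E/eqP.
  by move: h4 => /[swap] ->; rewrite Q4 d5.
have [tQ _] := h1 a aQ.
have adj y : y \in Q -> e x y by move=> /(subsetP QN); rewrite inE.
exists (t a), a; split; try by apply: contraNneq Qf => <-.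
exists c'; split=> //.
- by rewrite cards1 in r.
- have ax : a \notin [set x].
    by rewrite inE; apply: contraTneq (adj a aQ) => ->; rewrite eirr.
  by rewrite -(merge_all_in t xS aQ) cc.
- by split=> //; apply: adj.
Qed.

(* The obstruction to merging both pairs in one graph. *)
Definition clash a b f g : bool :=
  [|| (a == f) && e b g, (a == g) && e b f, (b == f) && e a g | (b == g) && e a f].

Lemma pair_data v a b : deg e v = 5 -> e v a -> e v b -> a != b -> ~~ e a b ->
  merge_data e l lam [set v] (merge_map id [set a] (fun=> b)) (merge_cen id [set a] v).
Proof.
move=> v5 va vb ab nab; rewrite -[[set v]]setU0.
apply: merge_extend_pair => //; first exact: merge_nothing.
- by rewrite in_set0.
- by move=> r; rewrite in_set0.
- by rewrite v5.
- by move=> z ->.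
Qed.

Lemma pair_const R a b c : c a = c b -> class_const R (merge_map id [set a] (fun=> b)) c.
Proof. by move=> E x _; rewrite /merge_map in_set1; case: eqP => // ->. Qed.

Lemma hub_two_pairs v w x y p q : v != w -> ~~ e v w -> deg e v = 5 -> deg e w = 5 ->
  [/\ e v x, e v y, x != y & ~~ e x y] -> [/\ e w p, e w q, p != q & ~~ e p q] ->
  x != p -> y != p -> x != q -> (q == y) ==> ~~ e x p ->
  exists h : {ffun V -> 'I_5}, [/\ proper_coloring e h, h x = h y & h p = h q].
Proof.
move=> vw nvw v5 w5 [vx vy xy nxy] [wp wq pq npq] xp yp xq /implyP nxp.
have mdw := pair_data w5 wp wq pq npq.
set m1 := merge_map _ _ _ in mdw.
have m1E z : z != p -> m1 z = z by move=> zp; rewrite /m1 /merge_map in_set1 (negPf zp).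
have m1p : m1 p = q by rewrite /m1 /merge_map set11.
have md : merge_data e l lam (v |: [set w]) (merge_map m1 [set x] (fun=> y))
    (merge_cen (merge_cen id [set p] w) [set x] v).
  apply: merge_extend_pair => //; rewrite ?m1E //.
  - by rewrite inE.
  - by move=> r /set1P ->.
  - by rewrite v5.
  - move=> z; case: (eqVneq z p) => [->|zp]; last by rewrite m1E.
    by rewrite m1p => E; rewrite E eqxx in xq.
  - move=> z; case: (eqVneq z p) => [->|zp]; last by rewrite m1E // => ->.
    by rewrite m1p => /eqP.
have [h ph ch] := exists_hub esym pd md.
exists h; split=> //.
  have := ch x; rewrite /merge_map set11 => -> //.
  rewrite !inE negb_or; apply/andP; split; first by apply: contraTneq vx => ->; rewrite eirr.
  by apply: contraTneq vx => ->.
have := ch p; rewrite /merge_map in_set1 eq_sym (negPf xp) m1p => -> //.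
rewrite !inE negb_or; apply/andP; split; last by apply: contraTneq wp => ->; rewrite eirr.
by apply: contraTneq wp => ->; rewrite esym.
Qed.

(** Equal pairs need a single merge. Pairs with one common vertex fall into one class of three: both
    merges are directed to the common vertex, and the two other members are nonadjacent because the
    pairs do not clash. *)
Lemma hub_pairs v w a b f g : v != w -> ~~ e v w -> deg e v = 5 -> deg e w = 5 ->
  [/\ e v a, e v b, a != b & ~~ e a b] -> [/\ e w f, e w g, f != g & ~~ e f g] ->
  ~~ clash a b f g -> exists h : {ffun V -> 'I_5}, [/\ proper_coloring e h, h a = h b & h f = h g].
Proof.
move=> vw nvw v5 w5 A F; rewrite /clash !negb_or !negb_and => /and4P[C1 C2 C3 C4].
have [va vb ab nab] := A; have [wf wg fg nfg] := F.
have A' : [/\ e v b, e v a, b != a & ~~ e b a] by rewrite eq_sym (esym b).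
have F' : [/\ e w g, e w f, g != f & ~~ e g f] by rewrite eq_sym (esym g).
have hub1 : exists h : {ffun V -> 'I_5}, proper_coloring e h /\ h a = h b.
  have [h ph ch] := exists_hub esym pd (pair_data v5 va vb ab nab).
  exists h; split=> //; have := ch a; rewrite /merge_map set11 => -> //.
  by rewrite inE; apply: contraTneq va => ->; rewrite eirr.
have two := @hub_two_pairs v w _ _ _ _ vw nvw v5 w5.
have [af|af] := eqVneq a f.
  have [bg|bg] := eqVneq b g.
    by have [h [ph E]] := hub1; exists h; rewrite -af -bg.
  have [||||h [ph h1 h2]] := two b a g f A' F' => //.
  - by rewrite af.
  - by rewrite eq_sym -af.
  - by apply/implyP => _; move: C1; rewrite af eqxx.
  by exists h.
have [ag|ag] := eqVneq a g.
  have [bf|bf] := eqVneq b f.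
    by have [h [ph E]] := hub1; exists h; rewrite -ag -bf.
  have [||||h [ph h1 h2]] := two b a f g A' F => //.
  - by rewrite eq_sym -ag.
  - by apply/implyP => _; move: C2; rewrite ag eqxx.
  by exists h.
have [bf|bf] := eqVneq b f.
  have [||||h [ph h1 h2]] := two a b g f A F' => //.
  - by rewrite bf.
  - by apply/implyP => _; move: C3; rewrite bf eqxx.
  by exists h.
have [||||h [ph h1 h2]] := two a b f g A F => //; last by exists h.
by apply/implyP => /eqP E; move: C4; rewrite E eqxx.
Qed.

Lemma reconf_pairs v w a b f g c d : v != w -> ~~ e v w -> deg e v = 5 -> deg e w = 5 ->
  pair_reached c v a b -> pair_reached d w f g -> ~~ clash a b f g ->
  reconf e (36 + (12 * B + 1) + ((12 * B + 1) + 36)) c d.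
Proof.
move=> vw nvw v5 w5 C D ncl; have nab := pair_nonadj C; have nfg := pair_nonadj D.
have [c' [rc pc Ec [va vb ab]]] := C; have [d' [rd pd' Ed [wf wg fg]]] := D.
have [||h [ph hab hfg]] := hub_pairs vw nvw v5 w5 _ _ ncl; try by split.
apply: (reconf_trans (d := h) (reconf_trans rc _) (reconf_trans _ (reconf_sym rd))).
  by apply: (reconf_merged esym eirr pd IH (pair_data v5 va vb ab nab) (size1 v)) => //;
    apply: pair_const.
by apply: (reconf_merged esym eirr pd IH (pair_data w5 wf wg fg nfg) (size1 w)) => //;
  apply: pair_const.
Qed.

Section Clashes.
Variables (w : V) (c d : {ffun V -> 'I_5}).
Hypotheses (pc : proper_coloring e c) (pd' : proper_coloring e d) (w5 : deg e w = 5).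
Local Notation goal := (reconf e (36 + (12 * B + 1) + ((12 * B + 1) + 36)) c d).

(** A pair at [x] avoiding [f] can clash with [f g] only by containing [g] together with a neighbor
    of [f]. *)
Lemma clash_partner x f g : x != w -> ~~ e x w -> deg e x = 5 -> pair_reached d w f g ->
  goal \/ exists2 h, pair_reached c x g h & e h f.
Proof.
move=> xw nxw x5 F; have [a [b [E af bf]]] := pair_avoiding f x5 pc.
have [cl|ncl] := boolP (clash a b f g); last by left; apply: reconf_pairs E F ncl.
right; move: cl; rewrite /clash (negPf af) (negPf bf) /=.
by case/orP=> /andP[/eqP <- h]; [exists b | exists a => //; apply: pair_reachedC].
Qed.

(** Using [clash_partner] with [f g] and with [g f] yields pairs [g h] and [f k] at [x]. As both
    must also clash with [p q], the vertices [h] and [k] are [p] and [q] in some order. *)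
Lemma clash_neighbors x f g p q : x != w -> ~~ e x w -> deg e x = 5 ->
  pair_reached d w f g -> pair_reached d w p q -> p != f -> q != f ->
  goal \/ [/\ e x f, e x g, e x p, e x q & (e q f && e p g) || (e p f && e q g)].
Proof.
move=> xw nxw x5 F F2 pf qf.
have [|[h H hf]] := clash_partner xw nxw x5 F; first by left.
have [|[k K kg]] := clash_partner xw nxw x5 (pair_reachedC F); first by left.
have nfg := pair_nonadj F; have ngh := pair_nonadj H; have nfk := pair_nonadj K.
have [cl1|ncl] := boolP (clash f k p q); last by left; apply: (reconf_pairs _ _ _ _ K F2 ncl).
have [cl2|ncl] := boolP (clash g h p q); last by left; apply: (reconf_pairs _ _ _ _ H F2 ncl).
right; have [_ [_ _ _ [xg xh _]]] := H; have [_ [_ _ _ [xf xk _]]] := K.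
move: cl1; rewrite /clash ![f == _]eq_sym (negPf pf) (negPf qf) /=.
case/orP=> /andP[/eqP kE fq].
  subst k; move: cl2; rewrite /clash.
  have -> : (g == p) = false by apply: contraTF kg => /eqP ->; rewrite eirr.
  have -> : (g == q) = false by apply: contraTF fq => /eqP <-.
  have -> : (h == p) = false by apply: contraTF kg => /eqP <-; rewrite esym.
  by rewrite /= => /andP[/eqP <- _]; rewrite hf kg.
subst k; move: cl2; rewrite /clash.
have -> : (g == p) = false by apply: contraTF fq => /eqP <-.
have -> : (g == q) = false by apply: contraTF kg => /eqP ->; rewrite eirr.
have -> : (h == q) = false by apply: contraTF kg => /eqP <-; rewrite esym.
by rewrite /= orbF => /andP[/eqP <- _]; rewrite hf kg orbT.
Qed.

End Clashes.

(* If all merges at [v] and at [u] clash with all merges at [w], then [{v, g}],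
   [{u, k}], [w], [f], [h] are the branch sets of a complete minor. *)
Lemma reconf_one_vertex c d : proper_coloring e c -> proper_coloring e d ->
  reconf e (36 + (12 * B + 1) + ((12 * B + 1) + 36)) c d.
Proof.
move=> pc pd'; have [/existsP[v d4]|/existsPn high] := boolP [exists v, deg e v <= 4].
  by apply: reconf_leq (reconf_low d4 pc pd'); lia.
have {}high v : 5 <= deg e v by rewrite ltnNge high.
have V3 : 3 <= #|V|.
  have /card_gt0P[v _] := V0; apply: leq_trans (max_card [set y | e v y]).
  by rewrite -degE; apply: leq_trans (high v).
have pl : planar_like e by exists l, lam.
pose F := [set x | deg e x == 5].
(* All degrees are at least five and their sum is at most 6n - 12, so at least twelve vertices fall
   short of six. *)
have F12 : 12 <= #|F|.
  have : 6 * #|V| <= degsum e + #|F|.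
    rewrite -sum1_card big_mkcond -big_split mulnC -sum_nat_const; apply: leq_sum => x _ /=.
    by rewrite inE; have := high x; case: eqP => [->|]; lia.
  by have := planar_like_degsum esym eirr pl V3; lia.
have /card_gt0P[w] : 0 < #|F| by apply: leq_trans F12.
rewrite inE => /eqP w5; set N := [set y | e w y].
(* [w] and its five neighbors leave at least six of the twelve. *)
have : 1 < #|F :\: (w |: N)|.
  have := cardsD F (w |: N); have := subset_leq_card (subsetIr F (w |: N)).
  by have := cardsU1 w N; rewrite -degE w5 inE eirr; lia.
case/card_gt1P=> v [u [vF uF vu]].
have far z : z \in F :\: (w |: N) -> [/\ z != w, ~~ e z w & deg e z = 5].
  by rewrite !inE negb_or esym => /andP[/andP[-> ->] /eqP ->].
have [vw nvw v5] := far v vF; have [uw nuw u5] := far u uF.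
have [f [g [A _ _]]] := pair_avoiding w w5 pd'.
have [p [q [D pf qf]]] := pair_avoiding f w5 pd'.
have [//|[vf vg vp vq X]] := clash_neighbors pc w5 vw nvw v5 A D pf qf.
have [//|[uf ug up uq _]] := clash_neighbors pc w5 uw nuw u5 A D pf qf.
have [_ [_ _ _ [wf wg fg]]] := A; have [_ [_ _ _ [wp wq pq]]] := D.
have nfg := pair_nonadj A; have ngf : ~~ e g f by rewrite esym.
have ne x y : e x y -> x != y by apply: contraTneq => ->; rewrite eirr.
have ne' x y : e x y -> y != x by move/ne; rewrite eq_sym.
suff K h k : [&& e v h, e v k, e u h, e u k, e w h & e w k] -> e h f -> e k g -> h != k -> False.
  case/orP: X => /andP[X1 X2]; case: (K _ _ _ X1 X2); rewrite ?vp ?vq ?up ?uq ?wp ?wq //.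
  by rewrite eq_sym.
case/and5P=> vh vk uh uk /andP[wh wk] hf kg hk.
apply: (no_K5_model (bs := [:: (v, g); (u, k); (w, w); (f, f); (h, h)]) esym pl) => //=.
  by rewrite vg uk !eqxx !orbT.
have [gh fk] : g != h /\ k != f.
  by split; [apply: contraTneq hf => <- | apply: contraTneq kg => ->].
rewrite /touching /= vu (ne _ _ vk) (ne' _ _ ug) (ne' _ _ kg) vw (ne' _ _ wg) (ne _ _ vf).
rewrite [g == f]eq_sym fg (ne _ _ vh) gh uw (ne' _ _ wk) (ne _ _ uf) fk (ne _ _ uh).
rewrite [k == h]eq_sym hk (ne _ _ wf) (ne _ _ wh) (ne' _ _ hf).
by rewrite vf vh uf uh wf wh [e g k]esym kg [e g w]esym wg [e k w]esym wk [e f h]esym hf !orbT.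
Qed.

End OneVertex.

(** * Many removable vertices *)

Lemma greedy_independent (T : finType) (r : rel T) (D : nat) (A : {set T}) : symmetric r ->
  {in A, forall v, #|[set w in A | (w == v) || r v w]| <= D} ->
  exists S : {set T}, [/\ S \subset A, {in S &, forall v w, v != w -> ~~ r v w} & #|A| <= D * #|S|].
Proof.
move=> rsym; have [n] := ubnP #|A|; elim: n => // n IH in A * => ltA HD.
have [A0|[v vA]] := set_0Vmem A.
  by exists set0; rewrite A0 cards0; split=> // x; rewrite inE.
pose C := [set w in A | (w == v) || r v w].
have CA : C \subset A by apply/subsetP => w; rewrite inE => /andP[].
have vC : v \in C by rewrite inE vA eqxx.
have cA : #|A| = #|C| + #|A :\: C| by rewrite cardsD (setIidPr CA) subnKC // subset_leq_card.
have C0 : 0 < #|C| by apply/card_gt0P; exists v.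
have [||S [SA Sr Sc]] := IH (A :\: C).
- by move: ltA; rewrite cA; move: C0; lia.
- move=> w /setDP[wA _]; apply: leq_trans (HD w wA); apply: subset_leq_card.
  by apply/subsetP => u; rewrite !inE => /andP[/andP[_ ->] ->].
have sub w : w \in S -> w \in A /\ ~~ ((w == v) || r v w).
  move=> /(subsetP SA); rewrite !inE => /andP[+ wA]; by rewrite wA.
have vS : v \notin S by apply/negP => /sub[_]; rewrite eqxx.
exists (v |: S); split.
- by apply/subsetP => w; rewrite in_setU1 => /orP[/eqP -> //|/sub[]].
- move=> a b; rewrite !in_setU1 => /orP[/eqP ->|aS] /orP[/eqP ->|bS]; rewrite ?eqxx //.
  + by move=> _; have [_] := sub _ bS; rewrite negb_or => /andP[].
  + by move=> _; have [_] := sub _ aS; rewrite negb_or rsym => /andP[].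
  exact: Sr.
by rewrite cardsU1 vS cA; have := HD v vA; rewrite -/C; move: Sc; lia.
Qed.

Lemma take_half (T : finType) (A : {set T}) : exists S S' : {set T},
  [/\ S :|: S' \subset A, [disjoint S & S'], #|S| = #|A|./2 & #|S'| = #|A|./2].
Proof.
have sub n (B : {set T}) : n <= #|B| -> exists2 S : {set T}, S \subset B & #|S| = n.
  move=> nB; exists [set x in take n (enum B)].
    by apply/subsetP => x; rewrite inE => /mem_take; rewrite mem_enum.
  by rewrite cardsE; have /card_uniqP -> := take_uniq n (enum_uniq B); rewrite size_takel // -cardE.
have [|S SA Sc] := sub #|A|./2 A; first lia.
have [|S' SA' Sc'] := sub #|A|./2 (A :\: S).
  by rewrite cardsD (setIidPr SA) Sc; lia.
exists S, S'; split=> //.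
  by rewrite subUset SA; apply: subset_trans SA' (subsetDl _ _).
rewrite disjoint_sym disjoint_subset; apply/subsetP => x /(subsetP SA').
by rewrite !inE => /andP[].
Qed.

Section Selection.
Variables (V : finType) (e : rel V).
Hypotheses (esym : symmetric e) (eirr : irreflexive e) (pl : planar_like e).

(** Only vertices of degree at most 27 will be marked, which bounds the number of vertices that
    compete for the same marked neighbor. *)
Definition high x : bool := 28 <= deg e x.

Definition low_nbrs v : {set V} := [set y | e v y && ~~ high y].

Definition high_nbrs v : nat := \sum_y (e v y && high y).

Lemma low_high v : #|low_nbrs v| + high_nbrs v = deg e v.
Proof.
rewrite -sum1_card big_mkcond -big_split; apply: eq_bigr => y _ /=.
by rewrite inE; case: (e v y); case: (high y).
Qed.

(** At degree five one neighbor stays unmarked and may be high; at degree six all neighbors are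
    marked, so none may be. *)
Definition suitable v : bool :=
  [|| deg e v <= 4, (deg e v == 5) && (high_nbrs v <= 1) | (deg e v == 6) && (high_nbrs v == 0)].

(* Discharging: a high vertex gives 3 to each of its neighbors. *)
Lemma many_suitable : #|V| <= 13 * #|[set v | suitable v]|.
Proof.
set g := #|_|; have [V3|V3] := leqP 3 #|V|; last first.
  suff -> : #|V| = g by lia.
  rewrite -cardsT; apply: eq_card => v; rewrite !inE; symmetry; apply/or3P/Or31.
  rewrite degE; apply: leq_trans (max_card _) _; lia.
(* Degree five with two high neighbors is tight, 26 = 4 * 5 + 3 * 2, and a high vertex affords its
   gifts because its degree is at least 26. In the sum the gifts cancel by [S1], and 26 n <= 4 (6 n
   - 12) + 26 g remains. *)
have ineq v : 26 + 3 * (high v * deg e v) <= 4 * deg e v + 3 * high_nbrs v + 26 * suitable v.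
  rewrite /suitable /high; case: (leqP (deg e v) 4) => [d4|d4] /=.
    by rewrite leqNgt; case: ltnP => /=; lia.
  case: (eqVneq (deg e v) 5) => [->|d5] /=; first by case: leqP => /=; lia.
  case: (eqVneq (deg e v) 6) => [->|d6] /=; first by case: eqP => /=; lia.
  by case: leqP => /=; lia.
have S1 : \sum_v (high v * deg e v) = \sum_v high_nbrs v.
  rewrite /high_nbrs exchange_big; apply: eq_bigr => v _ /=.
  rewrite /deg big_distrr; apply: eq_bigr => y _ /=.
  by rewrite esym; case: (e y v); case: (high v).
have S2 : \sum_v suitable v = g.
  rewrite /g -sum1_card [RHS]big_mkcond; apply: eq_bigr => v _.
  by rewrite inE; case: suitable.
have : \sum_v (26 + 3 * (high v * deg e v)) <=
    \sum_v (4 * deg e v + 3 * high_nbrs v + 26 * suitable v) by apply: leq_sum => v _.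
have E k (F : V -> nat) : \sum_v (k * F v) = k * \sum_v F v by rewrite big_distrr.
rewrite big_split [X in _ <= X]big_split [X in _ <= X + _]big_split /=.
rewrite !E S1 S2 sum_nat_const -/(degsum e).
by have := planar_like_degsum esym eirr pl V3; rewrite -[#|xpredT|]/#|V|; lia.
Qed.

Definition quota v : nat := if deg e v <= 4 then 0 else if deg e v == 5 then 4 else 6.

Definition targets v : {set V} := [set x in take (quota v) (enum (low_nbrs v))].

Lemma targets_low v x : x \in targets v -> e v x /\ ~~ high x.
Proof. by rewrite inE => /mem_take; rewrite mem_enum inE => /andP[]. Qed.

Lemma suitable_reducible v : suitable v -> reducible e targets v.
Proof.
move=> sv; have cl := low_high v; apply/andP; split.
  by apply/subsetP => x /targets_low[vx _]; rewrite inE.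
have -> : (targets v == set0) = (#|targets v| == 0) by rewrite cards_eq0.
have -> : #|targets v| = minn (quota v) #|low_nbrs v|.
  rewrite cardsE; have /card_uniqP -> := take_uniq (quota v) (enum_uniq (low_nbrs v)).
  by rewrite size_take_min -cardE.
move: sv; rewrite /suitable /quota; case: leqP => [d4 _|d4] /=; first by rewrite min0n.
by case/orP=> /andP[/eqP dE /=]; move: cl; rewrite dE /= => cl h; apply/eqP; move: h; lia.
Qed.

Definition conflict v w : bool := e v w || ~~ [disjoint targets v & targets w].

Lemma conflict_sym : symmetric conflict.
Proof. by move=> v w; rewrite /conflict esym disjoint_sym. Qed.

Lemma few_conflicts v : suitable v -> #|[set w | (w == v) || conflict v w]| <= 169.
Proof.
move=> sv.
have d6 : deg e v <= 6.
  by case/or3P: sv => [d4|/andP[/eqP -> _]|/andP[/eqP -> _]] //; apply: leq_trans d4 _.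
have t6 : #|targets v| <= 6.
  apply: leq_trans d6; rewrite degE; apply: subset_leq_card.
  by apply/subsetP => x /targets_low[vx _]; rewrite inE.
have sub : [set w | (w == v) || conflict v w] \subset
    (v |: [set w | e v w]) :|: \bigcup_(x in targets v) [set w | e x w].
  apply/subsetP => w; rewrite !inE => /or3P[->//|->|]; first by rewrite orbT.
  case/pred0Pn=> x /andP[/= xv xw]; apply/orP; right; apply/bigcupP; exists x => //.
  by rewrite inE esym; have [] := targets_low xw.
apply: leq_trans (subset_leq_card sub) _; apply: leq_trans (leq_card_setU _ _) _.
(* 169 = 7 + 6 * 27: the vertex with its neighbors, then the neighbors of at most six marked
   vertices of degree at most 27. *)
have H1 : #|v |: [set w | e v w]| <= 7 by rewrite cardsU1 inE eirr -degE.
suff H2 : #|\bigcup_(x in targets v) [set w | e x w]| <= 162 by lia.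
apply: leq_trans (leq_trans (_ : _ <= \sum_(x in targets v) deg e x) _) (_ : 6 * 27 <= 162) => //.
  elim/big_rec2: _ => [|x B n _ IH]; first by rewrite cards0.
  by apply: leq_trans (leq_card_setU _ _) _; rewrite degE leq_add.
apply: leq_trans (leq_mul t6 (leqnn _)); rewrite -sum_nat_const; apply: leq_sum => x /targets_low[_].
by rewrite /high -ltnNge.
Qed.

(* 2197 = 13 * 169. *)
Lemma two_halves : 0 < #|V| -> (exists S S' : {set V},
    [/\ spread e targets (S :|: S'), [disjoint S & S'], {in S :|: S', forall v, reducible e targets v},
      #|S| = #|S'| & (0 < #|S|) && (#|V| <= 3 * 2197 * #|S|)]) \/ #|V| <= 3 * 2197.
Proof.
move=> V0; have [|S [SA Sc cS]] := @greedy_independent V conflict 169 [set v | suitable v] conflict_sym.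
  move=> v; rewrite inE => /few_conflicts; apply: leq_trans; apply: subset_leq_card.
  by apply/subsetP => w; rewrite !inE => /andP[].
have {}cS : #|V| <= 13 * (169 * #|S|) by apply: leq_trans many_suitable _; rewrite leq_mul2l.
(* A set of at least two vertices has a rounded half of at least a third, hence the factor 3; a set
   with fewer cannot be split, and then the graph is small. *)
have [S1|S1] := leqP #|S| 1; first by right; move: cS S1; lia.
have [S2 [S3 [sub dis c2 c3]]] := take_half S; left; exists S2, S3; split=> //.
- move=> v w /(subsetP sub) vS /(subsetP sub) wS vw.
  by have := Sc _ _ vS wS vw; rewrite negb_or negbK => /andP[].
- by move=> v /(subsetP sub)/(subsetP SA); rewrite inE; apply: suitable_reducible.
- by rewrite c2 c3.
by rewrite c2; apply/andP; split; move: cS S1; lia.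
Qed.

End Selection.

(** * The recursion *)

(** In a graph of bounded size a single vertex is already a fixed fraction, so both ways of removing
    vertices fit the same recurrence. *)
Lemma reconf_step (V : finType) (e : rel V) : symmetric e -> irreflexive e -> planar_like e ->
  0 < #|V| -> exists s, [/\ 0 < s <= #|V|, #|V| <= 3 * 2197 * s &
    forall B, uniformly_reconf (#|V| - s) B -> forall c d : {ffun V -> 'I_5},
      proper_coloring e c -> proper_coloring e d -> reconf e (24 * B + 72 * #|V| + 2) c d].
Proof.
move=> esym eirr pl V0; have [l [lam pd]] := pl.
have [[S [S' [sp dis red cS /andP[S0 big]]]]|small] := two_halves esym eirr pl V0.
  have SV := max_card S.
  exists #|S|; split=> // [|B IH c d pc pd']; first by rewrite S0.
  have sz : #|V| <= #|V| - #|S| + #|S| by rewrite subnK.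
  have sz' : #|V| <= #|V| - #|S| + #|S'| by rewrite -cS.
  apply: reconf_leq (reconf_two_sides esym eirr pd IH sp dis red sz sz' pc pd').
  by rewrite -cS; move: SV; lia.
exists 1; split=> [||B]; rewrite ?muln1 //.
rewrite subn1 => IH c d pc pd'.
apply: reconf_leq (reconf_one_vertex esym eirr pd IH V0 pc pd').
by move: V0; lia.
Qed.

(** Bernoulli's inequality for (1 + 1/a)^k, without denominators. *)
Lemma expn_ratio a k : a ^ k * (a + k) <= a.+1 ^ k * a.
Proof.
elim: k => [|k IH]; first by rewrite !expn0 addn0.
rewrite !expnS; move: IH; move: (a ^ k) (a.+1 ^ k) => x y; nia.
Qed.

Lemma geometric_decay M : 0 < M -> exists2 k, 0 < k & forall m s, 0 < s <= m -> m <= M * s ->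
  48 * (m - s).+1 ^ k <= m.+1 ^ k.
Proof.
(* The ratio of [(m - s).+1] to [m.+1] is at most 1 - 1/(2M) = a/(a+1), as m + 1 <= 2 M s. *)
move=> M0; pose a := (2 * M).-1; have a0 : 0 < a by rewrite /a; lia.
(* With this exponent a + k = 48 a, so Bernoulli gives the factor 48. *)
exists (47 * a); first by rewrite muln_gt0.
move=> m s /andP[s0 sm] ms; set k := 47 * a.
have ak : 48 * a ^ k <= a.+1 ^ k.
  have := expn_ratio a k; have -> : a + k = 48 * a by rewrite /k; lia.
  by rewrite mulnA leq_mul2r eqn0Ngt a0 mulnC.
have H : (m - s).+1 * a.+1 <= m.+1 * a by rewrite /a; nia.
have Hk : (m - s).+1 ^ k * a.+1 ^ k <= m.+1 ^ k * a ^ k.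
  by rewrite -!expnMn leq_exp2r // /k muln_gt0.
have ap : 0 < a.+1 ^ k by rewrite expn_gt0.
rewrite -(leq_pmul2r ap) -mulnA; apply: (@leq_trans (48 * (m.+1 ^ k * a ^ k))).
  by rewrite leq_mul2l Hk.
by rewrite mulnCA leq_mul2l ak orbT.
Qed.

(** As 48 is twice the factor 24 of the recursion, the recursive call takes at most 75 of the 150
    units, and the term 72 n + 2 fits in the other 75. *)
Lemma uniform_bound : exists k, forall n, uniformly_reconf n (150 * n.+1 ^ k).
Proof.
have [k k0 decay] := @geometric_decay (3 * 2197) isT.
exists k; elim/ltn_ind => n IH V e esym eirr pl Vn c d pc pd'.
have [V0|V0] := posnP #|V|.
  have -> : d = c by apply/ffunP => x; have := card0_eq V0 x; rewrite inE.
  exact: reconf_refl.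
have [s [s0 Vs step]] := reconf_step esym eirr pl V0.
have ltV : #|V| - s < n by move: s0 Vn; lia.
apply: reconf_leq (step _ (IH _ ltV) _ _ pc pd').
have D := decay _ _ s0 Vs.
have mono : #|V|.+1 ^ k <= n.+1 ^ k by rewrite leq_exp2r.
have lin : #|V|.+1 <= #|V|.+1 ^ k by rewrite -[leqLHS]expn1 leq_exp2l.
move: D mono lin; move: ((#|V| - s).+1 ^ k) (#|V|.+1 ^ k) (n.+1 ^ k) => x y z; lia.
Qed.

(** * Plane drawings *)

From mathcomp Require Import all_order all_algebra ring lra.
Import Order.TTheory GRing.Theory Num.Theory.
Local Open Scope ring_scope.

Section Lines.
Variables (R : realFieldType) (X Y : R * R -> R).
Implicit Types (a b c u v w t : R * R).

Definition on_line a b (x : R) : R := Y a + (Y b - Y a) / (X b - X a) * (x - X a).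

Definition before a b : bool := X a < X b.

(** The exclusive or places [c] in the half-open vertical strip over the segment; for a vertical
    segment the strip is empty. *)
Definition above a b c : bool :=
  (before a c (+) before b c) && (on_line a b (X c) < Y c).

Definition segments_meet u v w t : Prop := exists x,
  [/\ X u <= x <= X v, X w <= x <= X t & on_line u v x = on_line w t x].

Lemma on_lineC a b x : X a != X b -> on_line a b x = on_line b a x.
Proof.
move=> ab; rewrite /on_line; field; rewrite !subr_eq0 ab eq_sym ab //.
Qed.

Lemma aboveC a b c : above a b c = above b a c.
Proof.
rewrite /above addbC /before; case: (eqVneq (X a) (X b)) => [->|ab]; first by rewrite addbb.
by rewrite on_lineC.
Qed.

Lemma on_line_left a b : on_line a b (X a) = Y a.
Proof. by rewrite /on_line subrr mulr0 addr0. Qed.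

Lemma on_line_right a b : X a != X b -> on_line a b (X b) = Y b.
Proof. by move=> ab; rewrite on_lineC // on_line_left. Qed.

Lemma on_line_affine a b : exists m k, forall x, on_line a b x = m * x + k.
Proof.
exists ((Y b - Y a) / (X b - X a)), (Y a - (Y b - Y a) / (X b - X a) * X a) => x.
by rewrite /on_line mulrBr addrA addrAC addrC; ring.
Qed.

(** The intermediate value theorem for an affine function: its explicit root exists over any real
    field. *)
Lemma affine_zero (m k p q : R) : p <= q -> 0 < (m * p + k) * - (m * q + k) ->
  exists2 x, p <= x <= q & m * x + k = 0.
Proof.
move=> pq H; have m0 : m != 0.
  by apply: contraTneq H => ->; rewrite !mul0r !add0r mulrN oppr_gt0 -expr2 ltNge sqr_ge0.
exists (- k / m); last by field.
set a := m * p + k in H; set b := m * q + k in H.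
have ab : a * b < 0 by move: H; rewrite mulrN oppr_gt0.
case: (ltP 0 m) => mp.
  have le_ab : a <= b by rewrite lerD2r ler_pM2l.
  have [a0 b0] : a <= 0 /\ 0 <= b by split; rewrite leNgt; apply/negP => h; nra.
  by rewrite ler_pdivlMr // ler_pdivrMr //; move: a0 b0; rewrite /a /b; lra.
have mn : m < 0 by rewrite lt_neqAle m0 mp.
have le_ba : b <= a by rewrite lerD2r ler_nM2l.
have [a0 b0] : 0 <= a /\ b <= 0 by split; rewrite leNgt; apply/negP => h; nra.
by rewrite ler_ndivlMr // ler_ndivrMr //; move: a0 b0; rewrite /a /b; lra.
Qed.

Lemma same_side u v w t p q : ~ segments_meet u v w t -> p <= q ->
  X u <= p -> X w <= p -> q <= X v -> q <= X t ->
  (on_line u v p < on_line w t p) = (on_line u v q < on_line w t q) /\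
  on_line u v p != on_line w t p /\ on_line u v q != on_line w t q.
Proof.
move=> sep pq up wp qv qt.
have ne x : p <= x <= q -> on_line u v x != on_line w t x.
  move=> /andP[px xq]; apply/eqP => E; apply: sep; exists x; split=> //; apply/andP; split; lra.
have np := ne p; have nq := ne q; rewrite !lexx pq in np nq.
split; last by split; [apply: np | apply: nq].
have [m1 [k1 E1]] := on_line_affine u v; have [m2 [k2 E2]] := on_line_affine w t.
have no x : p <= x <= q -> (m2 - m1) * x + (k2 - k1) != 0.
  by move=> /ne; rewrite E1 E2; apply: contraNneq => H; apply/eqP; lra.
have [H|H] := ltP 0 (((m2 - m1) * p + (k2 - k1)) * - ((m2 - m1) * q + (k2 - k1))).
  by have [x /no/eqP nx E] := affine_zero pq H.
move: np nq H; rewrite !E1 !E2 => /(_ isT) np /(_ isT) nq H.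
apply/idP/idP => L; rewrite ltNge; apply/negP => L'.
  have {L'} : m2 * q + k2 < m1 * q + k1 by rewrite lt_neqAle eq_sym nq.
  nra.
have {L'} : m2 * p + k2 < m1 * p + k1 by rewrite lt_neqAle eq_sym np.
nra.
Qed.

Lemma segments_meetC u v w t : segments_meet w t u v -> segments_meet u v w t.
Proof. by case=> x [h1 h2 h3]; exists x. Qed.

(** With [u] leftmost, the two ranges of abscissae are disjoint, overlapping or nested. In the last
    two cases [same_side], applied at the ends of the common range, makes the [above] bits cancel
    the [before] bits. *)
Lemma cross4_ordered u v w t : X u < X v -> X w < X t -> X u < X w ->
  X u != X t -> X v != X w -> X v != X t -> ~ segments_meet u v w t ->
  cross4 before above u v w t = false.
Proof.
move=> uv wt uw ut vw vt sep; rewrite /cross4 /above /before.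
have uvn : X u != X v by rewrite lt_eqF.
have wtn : X w != X t by rewrite lt_eqF.
have [C1|C1] := ltP (X v) (X w).
  have -> : X u < X w by []. have -> : X u < X t by lra. have -> : X v < X t by lra.
  have -> : (X w < X u) = false by lra. have -> : (X t < X u) = false by lra.
  have -> : (X w < X v) = false by lra. by have -> : (X t < X v) = false by lra.
have {C1}vw' : X w < X v by rewrite lt_neqAle eq_sym vw.
have [C2|C2] := ltP (X v) (X t).
  have [] := same_side sep (ltW vw') (ltW uw) (lexx _) (lexx _) (ltW C2).
  rewrite on_line_left on_line_right // => E [n1 n2].
  have -> : (X u < X w) by []. have -> : X u < X t by lra.
  have -> : (X w < X u) = false by lra. have -> : (X t < X u) = false by lra.
  have -> : (X t < X v) = false by lra.
  have -> : X w < X v by [].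
  rewrite /= E; rewrite lt_neqAle n2 /= leNgt. by case: (_ < _).
have {C2}tv : X t < X v by rewrite lt_neqAle eq_sym vt.
have [] := same_side sep (ltW wt) (ltW uw) (lexx _) (ltW tv) (lexx _).
rewrite on_line_left on_line_right // => E _.
have -> : X u < X w by []. have -> : X u < X t by lra.
have -> : (X w < X u) = false by lra. have -> : (X t < X u) = false by lra.
have -> : X w < X v by []. have -> : X t < X v by [].
by rewrite /= E addbF addbb.
Qed.

Lemma cross4_swapl u v w t : cross4 before above v u w t = cross4 before above u v w t.
Proof. by rewrite /cross4 ![above v u _]aboveC; xor_tauto. Qed.

Lemma cross4_swapr u v w t : cross4 before above u v t w = cross4 before above u v w t.
Proof. by rewrite /cross4 ![above t w _]aboveC; xor_tauto. Qed.

Lemma before_anti a b : X a != X b -> before a b = ~~ before b a.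
Proof. by move=> ab; rewrite /before -leNgt le_eqVlt (negPf ab). Qed.

Lemma cross4_swap u v w t : X u != X w -> X u != X t -> X v != X w -> X v != X t ->
  cross4 before above w t u v = cross4 before above u v w t.
Proof.
move=> uw ut vw vt; rewrite /cross4 (before_anti uw) (before_anti ut) (before_anti vw).
by rewrite (before_anti vt); xor_tauto.
Qed.

Definition generic a b : Prop := X a = X b -> a = b.

Lemma cross4_apart u v w t : generic u v -> generic w t ->
  X u != X w -> X u != X t -> X v != X w -> X v != X t ->
  (forall a b c d, (a, b) \in [:: (u, v); (v, u)] -> (c, d) \in [:: (w, t); (t, w)] ->
    ~ segments_meet a b c d) ->
  cross4 before above u v w t = false.
Proof.
move=> guv gwt uw ut vw vt sep.
have [uv|uv] := eqVneq (X u) (X v).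
  by rewrite (guv uv) /cross4 /above addbb; xor_tauto.
have [wt|wt] := eqVneq (X w) (X t).
  by rewrite (gwt wt) /cross4 /above addbb; xor_tauto.
have step a b c d : X a < X b -> X c < X d -> (a, b) \in [:: (u, v); (v, u)] ->
    (c, d) \in [:: (w, t); (t, w)] -> X a != X c -> X a != X d -> X b != X c -> X b != X d ->
    cross4 before above a b c d = false.
  move=> ab cd P1 P2 ac ad bc bd; have [lt_ac|] := ltP (X a) (X c).
    by apply: cross4_ordered => //; apply: sep.
  rewrite le_eqVlt eq_sym (negPf ac) /= => lt_ca; rewrite cross4_swap 1?eq_sym //.
  apply: cross4_ordered; rewrite // 1?eq_sym // => /segments_meetC; exact: sep.
case: (ltP (X u) (X v)) => [uv'|]; last rewrite le_eqVlt eq_sym (negPf uv) /= => vu';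
case: (ltP (X w) (X t)) => [wt'|]; try (rewrite le_eqVlt eq_sym (negPf wt) /= => tw').
- by apply: step; rewrite // !inE eqxx ?orbT.
- by rewrite -cross4_swapr; apply: step; rewrite // !inE eqxx ?orbT.
- by rewrite -cross4_swapl; apply: step; rewrite // !inE eqxx ?orbT.
- by rewrite -cross4_swapl -cross4_swapr; apply: step; rewrite // !inE eqxx ?orbT.
Qed.

End Lines.

Section Shear.
Variable R : realFieldType.
Implicit Types (a b p u v w t : R * R) (r s : R).

Definition shear s p : R := p.1 + s * p.2.

Definition box_close r a b : bool := (`|a.1 - b.1| < r) && (`|a.2 - b.2| < r).

Lemma box_close_sym r : symmetric (box_close r).
Proof. by move=> a b; rewrite /box_close distrC [X in _ && (X < _)]distrC. Qed.

(** A common point of two short segments is within [r / 2] of an end of each. *)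
Lemma segments_meet_box_close s r u v w t : segments_meet (shear s) snd u v w t ->
  box_close (r / 2) u v -> box_close (r / 2) w t -> box_close r u w.
Proof.
case=> x [/andP[ux xv] /andP[wx xt] E] cuv cwt.
have near a b : shear s a <= x -> x <= shear s b -> box_close (r / 2) a b ->
    exists z : R * R, [/\ shear s z = x, z.2 = on_line (shear s) snd a b x & box_close (r / 2) a z].
  move=> ax xb /andP[c1 c2]; set A := shear s a in ax *; set B := shear s b in xb *.
  have [ab|ab] := eqVneq A B.
    have xA : x = A by apply/le_anti; rewrite ax andbT; move: xb; rewrite -ab.
    exists a; split; first by rewrite xA.
      by rewrite xA /A on_line_left.
    by rewrite /box_close !subrr normr0; move: c1; have := normr_ge0 (a.1 - b.1); lra.
  pose m := (x - A) / (B - A).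
  have AB : 0 < B - A by rewrite subr_gt0 lt_neqAle ab /=; lra.
  have m01 : 0 <= m <= 1.
    by rewrite /m divr_ge0 ?(ltW AB) ?subr_ge0 //= ler_pdivrMr // mul1r lerD2r.
  have mE : m * (B - A) = x - A by rewrite /m divfK // gt_eqF.
  exists (a.1 + m * (b.1 - a.1), a.2 + m * (b.2 - a.2)); split.
  - by move: mE; rewrite /B /A /shear /=; lra.
  - by rewrite /on_line -/A -/B /m /=; field; rewrite gt_eqF.
  have shrink (y : R) : `|y| < r / 2 -> `|m * y| < r / 2.
    move=> yr; apply: le_lt_trans yr; rewrite normrM ger0_norm; last by case/andP: m01.
    by rewrite ler_piMl //; case/andP: m01.
  rewrite /box_close /= !opprD !addNKr !normrN !shrink // distrC //.
have [z [zx z2 /andP[u1 u2]]] := near u v ux xv cuv.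
have [z' [zx' z2' /andP[w1 w2]]] := near w t wx xt cwt.
have e2 : z'.2 = z.2 by rewrite z2 z2' E.
have e1 : z'.1 = z.1 by move: zx zx'; rewrite /shear e2; lra.
rewrite e1 in w1; rewrite e2 in w2.
have tri (x1 x2 x3 : R) : `|x1 - x3| < r / 2 -> `|x2 - x3| < r / 2 -> `|x1 - x2| < r.
  move=> h1 h2; have -> : x1 - x2 = (x1 - x3) - (x2 - x3) by ring.
  by apply: le_lt_trans (ler_normB _ _) _; lra.
by rewrite /box_close (tri _ _ _ u1 w1) (tri _ _ _ u2 w2).
Qed.

Lemma exists_outside (s : seq R) : exists r, r \notin s.
Proof.
pose S := \sum_(x <- s) `|x|; exists (1 + S); apply/negP => rs.
have : S = `|1 + S| + \sum_(x <- rem (1 + S) s) `|x| by rewrite {1}/S (big_rem _ rs).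
have : 0 <= \sum_(x <- rem (1 + S) s) `|x| by apply: sumr_ge0.
by have := ler_norm (1 + S); lra.
Qed.

(** Two points with different ordinates get the same abscissa for only one value of [s], so finitely
    many values are to be avoided. *)
Lemma generic_shear (P : seq (R * R)) : exists s, {in P &, forall a b, generic (shear s) a b}.
Proof.
have [s sN] := exists_outside [seq (a.1 - b.1) / (b.2 - a.2) | a <- P, b <- P].
exists s => a b aP bP E; have [e2|n2] := eqVneq a.2 b.2.
  by apply: injective_projections => //; move: E; rewrite /shear e2; lra.
case/negP: sN; apply/allpairsP; exists (a, b); split=> //=.
have n2' : b.2 - a.2 != 0 by rewrite subr_eq0 eq_sym.
by apply: (mulIf n2'); rewrite divfK //; move: E; rewrite /shear; lra.
Qed.

End Shear.

From mathcomp Require Import all_classical all_reals all_analysis.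
Import numFieldNormedType.Exports.
Local Open Scope classical_set_scope.
Local Open Scope ring_scope.

Section Arcs.
Variable R : realType.
Implicit Types (A B C : set (R * R)) (p q : R * R) (r : R).

Lemma box_closeE r p q : ball p r q = box_close r p q.
Proof. by apply/propext; split => [[h1 h2]|/andP[h1 h2]]; [apply/andP; split|split]. Qed.

Lemma simple_arc_compact A p q : simple_arc A p q -> compact A.
Proof.
case=> f [cf _ _ _ ->]; apply: continuous_compact cf _; exact: segment_compact.
Qed.

Lemma simple_arc_connected A p q : simple_arc A p q -> connected A.
Proof.
case=> f [cf _ _ _ ->]; apply: connected_continuous_connected cf; exact: segment_connected.
Qed.

Lemma simple_arc_ends A p q : simple_arc A p q -> A p /\ A q.
Proof.
case=> f [_ _ <- <- ->]; split; [exists 0|exists 1] => //=; rewrite in_itv /= ?lexx ?ler01 //.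
Qed.

(** The points reachable from [p] by steps shorter than [r] form a subset of [A] that is relatively
    open and closed. *)
Lemma connected_chain A r p q : 0 < r -> connected A -> A p -> A q ->
  exists s, [/\ path (box_close r) p s, last p s = q & {in p :: s, forall z, A z}].
Proof.
move=> r0 cA Ap Aq.
pose B := [set z | A z /\ exists s,
  [/\ path (box_close r) p s, last p s = z & {in p :: s, forall z, A z}]].
suff : B = A by move=> BA; have [_] : B q by rewrite BA.
have Bp : B p by split=> //; exists [::]; split=> // z; rewrite inE => /eqP ->.
have step z w : B z -> A w -> box_close r z w -> B w.
  case=> Az [s [ps ls sA]] Aw zw; split=> //; exists (rcons s w).
  rewrite rcons_path last_rcons ps ls zw; split=> // u.
  by rewrite -rcons_cons mem_rcons inE => /orP[/eqP -> //|/sA].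
apply: cA; first by exists p.
  exists (\bigcup_(z in B) ball z r).
    by apply: bigcup_open => z _; exact: ball_open.
  apply/seteqP; split=> [z Bz|z [Az [w Bw]]].
    by split; [case: Bz | exists z => //; exact: ballxx].
  by rewrite /= box_closeE; apply: step.
exists (~` \bigcup_(z in A `\` B) ball z r).
  by apply: open_closedC; apply: bigcup_open => z _; exact: ball_open.
apply/seteqP; split=> [z Bz|z [Az nz]].
  split; [by case: Bz | case=> w [Aw nBw]; rewrite box_closeE => wz].
  by apply: nBw; apply: step Bz Aw _; rewrite box_close_sym.
by apply: contrapT => nBz; apply: nz; exists z => //; exact: ballxx.
Qed.

(** Disjoint compact sets have positive distance; the form with [near] lets finitely many pairs of
    arcs share one [r]. *)
Lemma compact_apart A B : compact A -> compact B -> A `&` B = set0 ->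
  \forall r \near 0^'+, forall p q, A p -> B q -> ~~ box_close r p q.
Proof.
move=> cA cB AB.
have clB : closed B by apply: compact_closed => //; exact: norm_hausdorff.
have /compact_near_coveringP nA := cA.
suff H : \forall r \near 0^'+, A `<=` [set p | forall q, B q -> ~~ box_close r p q].
  by apply: filterS H => r h p q Ap; exact: h.
apply: nA => p Ap.
have : nbhs p (~` B).
  apply: open_nbhs_nbhs; split; first exact: closed_openC.
  by move=> Bp; have : (A `&` B) p by []; rewrite AB.
case/nbhs_ballP => r /= r0 br.
exists (ball p (r / 2), [set s | s < r / 2]) => /=.
  by split; [apply: nbhsx_ballx; rewrite divr_gt0 | apply: nbhs_right_lt; rewrite divr_gt0].
case=> p' s /= [pp' sr] q Bq; apply/negP; rewrite -box_closeE => pq.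
apply: (br q) Bq; rewrite [r]splitr; apply: ball_triangle pp' _.
exact: le_ball (ltW sr) _ pq.
Qed.

End Arcs.

Section Planarity.
Variables (R : realType) (G : plane_graph R).
Local Notation V := (vertex G).
Local Notation e := (@adj R G).
Implicit Types (u v w t : G).

Definition independent u v w t : bool :=
  [&& e u v, e w t, u != w, u != t, v != w & v != t].

Lemma curves_disjoint u v w t : independent u v w t -> curve u v `&` curve w t = set0.
Proof.
case/and5P=> uv wt uw ut /andP[vw vt]; rewrite -subset0 => p [puv pwt].
have n1 : ~ (w = u /\ t = v) by case=> E; rewrite E eqxx in uw.
have n2 : ~ (w = v /\ t = u) by case=> E; rewrite E eqxx in vw.
case: (curve_disjoint uv wt n1 n2 (conj puv pwt)) => /= E; rewrite E in pwt.
  by case: (curve_vertex wt pwt) => E'; rewrite E' eqxx in uw ut.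
by case: (curve_vertex wt pwt) => E'; rewrite E' eqxx in vw vt.
Qed.

Lemma exists_gap : exists2 r, 0 < r & forall u v w t, independent u v w t ->
  forall p q, curve u v p -> curve w t q -> ~~ box_close r p q.
Proof.
have H : \forall r \near 0^'+, forall i : (G * G) * (G * G),
    independent i.1.1 i.1.2 i.2.1 i.2.2 ->
    forall p q : R * R, curve i.1.1 i.1.2 p -> curve i.2.1 i.2.2 q -> ~~ box_close r p q.
  apply: filter_forall => -[[u v] [w t]] /=.
  have [ind|nind] := boolP (independent u v w t); last first.
    by apply: nearW => r ind; case/negP: nind.
  have [uv wt] : e u v /\ e w t by case/and3P: ind.
  have := compact_apart (simple_arc_compact (curve_arc uv)) (simple_arc_compact (curve_arc wt))
    (curves_disjoint ind).
  by apply: filterS => r h _ p q; exact: h.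
have [r [r0 Hr]] := filter_ex (filterI (nbhs_right_gt (0 : R)) H).
by exists r => // u v w t ind; apply: (Hr ((u, v), (w, t))).
Qed.

(** Each arc is replaced by a chain of its points with steps below [r / 2], where [r] separates the
    arcs of independent edges. The polygons may cross themselves or those of adjacent edges, but
    segments of independent edges never meet, and a shear makes all abscissae distinct. *)
Lemma plane_graph_planar_like : planar_like e.
Proof.
have [r r0 gap] := exists_gap.
have /choice[c cP] : forall i : G * G, exists s, e i.1 i.2 ->
    [/\ path (box_close (r / 2)) (pos i.1) s, last (pos i.1) s = pos i.2 &
      {in pos i.1 :: s, forall z, curve i.1 i.2 z}].
  case=> u v /=; have [uv|nuv] := boolP (e u v); last by exists [::].
  have arc := curve_arc uv; have [cu cv] := simple_arc_ends arc.
  have r20 : 0 < r / 2 by rewrite divr_gt0.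
  by have [s H] := connected_chain r20 (simple_arc_connected arc) cu cv; exists s.
pose P : seq (R * R) := [seq pos x | x : G] ++ flatten [seq c i | i : G * G].
have posP u : pos u \in P by rewrite mem_cat map_f // mem_enum.
have cinP i z : z \in pos i.1 :: c i -> z \in P.
  rewrite inE => /orP[/eqP -> //|zc]; rewrite mem_cat; apply/orP; right.
  by apply/flattenP; exists (c i) => //; apply: map_f; rewrite mem_enum.
have [s gs] := generic_shear P; pose X := shear s.
apply: (planar_likeI (l := fun u v => before X (pos u) (pos v))
  (lam := fun u v w => lamw (above X snd) (pos u) (c (u, v)) (pos w))).
- exact: adj_sym.
- move=> u w uw; apply: before_anti; apply: contra_neq uw => E.
  by apply: (@pos_inj _ G); apply: gs.
move=> u v w t uv wt uw ut vw vt.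
have ind : independent u v w t by rewrite /independent uv wt uw ut vw vt.
have [p1 l1 c1] := cP (u, v) uv; have [p2 l2 c2] := cP (w, t) wt.
rewrite /= in p1 l1 c1 p2 l2 c2.
have -> : cross4 (fun u v => before X (pos u) (pos v))
    (fun u v w => lamw (above X snd) (pos u) (c (u, v)) (pos w)) u v w t =
  crossw (before X) (above X snd) (pos u) (c (u, v)) (pos w) (c (w, t)).
  by rewrite crosswE l1 l2.
apply: (crossw_eq0 (A := mem (pos u :: c (u, v))) (B := mem (pos w :: c (w, t))) _ p1 p2);
  try by apply/allP.
move=> a b a' b' ab ab' aA bA aB bB.
have far x y : x \in pos u :: c (u, v) -> y \in pos w :: c (w, t) -> ~~ box_close r x y.
  by move=> /c1 xc /c2 yc; apply: gap ind _ _ xc yc.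
have ne x y : x \in pos u :: c (u, v) -> y \in pos w :: c (w, t) -> X x != X y.
  move=> xc yc; apply: contraNneq (far _ _ xc yc) => E.
  have -> : x = y by apply: gs E; [apply: (cinP (u, v))|apply: (cinP (w, t))].
  by rewrite -box_closeE; exact: ballxx.
apply: cross4_apart; try exact: ne.
- by apply: gs; apply: (cinP (u, v)).
- by apply: gs; apply: (cinP (w, t)).
move=> x y x' y' xy xy' meet.
have [xA cxy] : x \in pos u :: c (u, v) /\ box_close (r / 2) x y.
  by move: xy; rewrite !inE => /orP[] /eqP[-> ->]; split; rewrite // box_close_sym.
have [xB cxy'] : x' \in pos w :: c (w, t) /\ box_close (r / 2) x' y'.
  by move: xy'; rewrite !inE => /orP[] /eqP[-> ->]; split; rewrite // box_close_sym.
by have := far _ _ xA xB; rewrite (segments_meet_box_close meet cxy cxy').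
Qed.

End Planarity.

Local Close Scope classical_set_scope.

Theorem theorem3p1 (R : realType) :
  exists p : {poly R},
    forall (G : plane_graph R)
           (alpha : {ffun G -> 'I_5}) (beta : {ffun G -> 'I_4}),
      proper_coloring (@adj R G) alpha ->
      proper_coloring (@adj R G) beta ->
      exists s : seq (kchange G 5),
        kempe_sequence (@adj R G) alpha s (as_5coloring beta) /\
        (forall v : G, (color_changes s v)%:R <= p.[#|G|%:R]).
Proof.
have [k bound] := uniform_bound.
exists (150%:R *: ('X + 1%:P) ^+ k) => G alpha beta pa pb.
have pb' : proper_coloring (@adj R G) (as_5coloring beta).
  move=> x y /pb; apply: contraNneq => E; apply/eqP; apply: val_inj.
  by move/(congr1 val): E; rewrite /as_5coloring !ffunE.
have [s ks cs] := bound _ _ _ (@adj_sym R G) (@adj_irr R G) (plane_graph_planar_like G)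
  (leqnn _) _ _ pa pb'.
have [s' [ks' cs']] := kempe_path_sequence (@adj_sym R G) ks.
exists s'; split=> // v.
by rewrite hornerZ horner_exp hornerD hornerX hornerC natr1 -natrX -natrM ler_nat cs'.
Qed.
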